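(* Let $\alpha\in[0,1)$ be fixed. Let $\psi\in L^2(\mathbb{R})\setminus\{0\}$ be such that its Fourier transform $\hat\psi$ is continuous and there is a constant $C>0$ with $$|\hat\psi(\xi)|\le C(1+|\xi|)^{-r}\qquad\text{for all }\xi\in\mathbb{R},$$ where $r$ is a real number with $$r>\max\left\{1,\frac{\alpha}{2(1-\alpha)}\right\}.$$ Then $\psi$ is admissible (with respect to the parameter $\alpha$).
   Context: For $x,\omega\in\mathbb{R}$ and $a>0$ define the following unitary operators on $L^2(\mathbb{R})$: translation $T_xf(t)=f(t-x)$, modulation $M_\omega f(t)=e^{2\pi i\omega t}f(t)$, dilation $D_af(t)=\frac{1}{\sqrt a}f(\frac{t}{a})$. For $\alpha\in[0,1)$ set $\beta(\omega)=(1+|\omega|)^{-\alpha}$, $\omega\in\mathbb{R}$. For $\psi\in L^2(\mathbb{R})\setminus\{0\}$ and $(x,\omega)\in\mathbb{R}^2$ put $\psi_{x,\omega}=T_xM_\omega D_{\beta(\omega)}\psi$. (This is $\pi(\sigma(x,\omega))\psi$, where $\pi(x,\omega,a,\tau)=e^{2\pi i\tau}T_xM_\omega D_a$ is the Stone-Von Neumann representation of the affine Weyl-Heisenberg group $G_{aWH}=\mathbb{R}^2\times\mathbb{R}_+\times\mathbb{R}$, and $\sigma(x,\omega)=(x,\omega,\beta(\omega),0)$ is a section of the quotient $G_{aWH}/H\simeq\mathbb{R}^2$, $H=\{(0,0,a,\tau)\}$, equipped with the invariant measure $dx\,d\omega$.) Define the operator $A_{\sigma,\psi}$ weakly by $$A_{\sigma,\psi}f=\int_{\mathbb{R}}\int_{\mathbb{R}}\langle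 f,\psi_{x,\omega}\rangle\,\psi_{x,\omega}\,dx\,d\omega,$$ i.e. $\langle A_{\sigma,\psi}f,g\rangle=\int_{\mathbb{R}}\int_{\mathbb{R}}\langle f,\psi_{x,\omega}\rangle\langle\psi_{x,\omega},g\rangle\,dx\,d\omega$. The function $\psi$ is called admissible (with respect to $\alpha$) if $A_{\sigma,\psi}$ is a bounded and boundedly invertible operator on $L^2(\mathbb{R})$. The Fourier transform is $\hat f(\xi)=\int_{\mathbb{R}}f(t)e^{-2\pi i t\xi}\,dt$ (extended to $L^2(\mathbb{R})$); ''$\hat\psi$ is continuous'' means that it has a continuous representative, which is the one used. *)

(* Defs.v *)
From HB Require Import structures.
From mathcomp Require Import all_boot all_order all_algebra.
From mathcomp Require Import all_classical all_reals all_analysis.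
From mathcomp Require Import complex.

Set Implicit Arguments.
Unset Strict Implicit.
Unset Printing Implicit Defensive.

Import Order.TTheory GRing.Theory Num.Theory.
Import numFieldNormedType.Exports.
Import ComplexField.Normc.

Local Open Scope classical_set_scope.
Local Open Scope ring_scope.
Local Open Scope complex_scope.

Section complex_integration.
Context d (T : measurableType d) (R : realType).
Variable mu : {measure set T -> \bar R}.
Implicit Types f : T -> R[i].

Definition cmeasurable f :=
  measurable_fun setT (fun x => complex.Re (f x)) /\
  measurable_fun setT (fun x => complex.Im (f x)).

Definition cintegrable f :=
  mu.-integrable setT (fun x => (complex.Re (f x))%:E) /\
  mu.-integrable setT (fun x => (complex.Im (f x))%:E).

Definition cintegral f : R[i] :=
  Rintegral mu setT (fun x => complex.Re (f x)) +i*
  Rintegral mu setT (fun x => complex.Im (f x)).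

End complex_integration.

Section L2.
Variable R : realType.
Notation mu := (@lebesgue_measure R).
Implicit Types f g h : R -> R[i].

(* Elements of L^2(R) are represented by measurable square-integrable
   functions, considered up to almost everywhere equality. *)
Definition L2norm f : \bar R := Lnorm mu 2%:E (fun t => (normc (f t))%:E).

Definition L2 f := cmeasurable f /\ (L2norm f < +oo)%E.

Definition aeeq f g := {ae mu, forall t, f t = g t}.

Definition inner f g : R[i] := cintegral mu (fun t => f t * conjc (g t)).

Definition expi (theta : R) : R[i] := cos theta +i* sin theta.

Definition fourier f (xi : R) : R[i] :=
  cintegral mu (fun t => f t * expi (- (2 * pi * t * xi))).

(* [g] represents the L^2 Fourier transform of [f]: the extension by continuity
   of [fourier] from the dense subspace of L^1 `&` L^2. *)
Definition is_L2_fourier f g :=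
  [/\ L2 f, L2 g &
    forall u : nat -> R -> R[i],
      (forall n, cintegrable mu (u n) /\ L2 (u n)) ->
      L2norm (u n \- f) @[n --> \oo] --> 0%E ->
      L2norm (fourier (u n) \- g) @[n --> \oo] --> 0%E].

(* An operator on L^2(R) is given by its action on representatives; outside of
   [L2] its values are irrelevant. *)
Definition bounded_operator (A : (R -> R[i]) -> (R -> R[i])) :=
  [/\ forall f, L2 f -> L2 (A f),
      forall f g, L2 f -> L2 g -> aeeq f g -> aeeq (A f) (A g),
      forall (c : R[i]) f g, L2 f -> L2 g ->
        aeeq (A (fun t => c * f t + g t)) (fun t => c * A f t + A g t) &
      exists K : R, forall f, L2 f -> (L2norm (A f) <= K%:E * L2norm f)%E].

(* The inverse is only required on classes, hence the almost everywhere
   equalities. *)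
Definition boundedly_invertible (A : (R -> R[i]) -> (R -> R[i])) :=
  exists2 B, bounded_operator B &
    forall f, L2 f -> aeeq (A (B f)) f /\ aeeq (B (A f)) f.

Definition translation (x : R) f : R -> R[i] := fun t => f (t - x).

Definition modulation (w : R) f : R -> R[i] :=
  fun t => expi (2 * pi * w * t) * f t.

Definition dilation (a : R) f : R -> R[i] :=
  fun t => ((Num.sqrt a)^-1)%:C * f (t / a).

Definition beta (alpha w : R) : R := (1 + `|w|) `^ (- alpha).

Definition atom (alpha : R) (psi : R -> R[i]) (x w : R) : R -> R[i] :=
  translation x (modulation w (dilation (beta alpha w) psi)).

(* The weak definition of A includes the absolute convergence of the double
   integral. *)
Definition weakly_represents (alpha : R) (psi : R -> R[i])
    (A : (R -> R[i]) -> (R -> R[i])) :=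
  forall f g, L2 f -> L2 g ->
    cintegrable (mu \x mu)%E
      (fun p : R * R => inner f (atom alpha psi p.1 p.2) *
                inner (atom alpha psi p.1 p.2) g) /\
    inner (A f) g =
      cintegral mu (fun w => cintegral mu (fun x =>
        inner f (atom alpha psi x w) * inner (atom alpha psi x w) g)).

Definition admissible (alpha : R) (psi : R -> R[i]) :=
  exists A, [/\ weakly_represents alpha psi A,
                bounded_operator A & boundedly_invertible A].

End L2.

(* Main.v *)
Require Import Defs.
From mathcomp Require Import all_boot all_order all_algebra.
From mathcomp Require Import all_classical all_reals all_analysis.
From mathcomp Require Import complex ring lra measurable_realfun.
Import Order.TTheory GRing.Theory Num.Theory.
Import numFieldNormedType.Exports.
Import ComplexField.Normc.
Local Open Scope classical_set_scope.
Local Open Scope ring_scope.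
Local Open Scope complex_scope.

(** Write [m xi] for the integral over [w] of
    [beta w * |psihat (beta w * (xi - w))| ^+ 2], the [symbol]. The operator of
    the atoms is the Fourier multiplier with symbol [m]: the transform of the
    atom [psi_(x, w)] at [xi] is
    [expi (- 2 pi x xi) * sqrt (beta w) * psihat (beta w * (xi - w))], so for
    fixed [w] the coefficients of [f] are, as a function of the position [x],
    the inverse transform of [f^ * conj (window)]. Plancherel in [x] and Fubini
    in [w] then give [<A f, g> = <m f^, g^>]. Hence [A] is bounded and boundedly
    invertible as soon as [m] lies between two positive constants
    ([bounded_multiplier], [invertible_multiplier]).

    Upper bound ([symbol_le]). With [W w = (1 + |w|)^alpha = (beta w)^-1], the
    decay of [psihat] bounds the integrand by a multiple of
    [W w / (W w + |xi - w|) ^+ 2]. For [w] close to [xi], at the scale [W xi],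
    this is at most a bump of width [W xi] and height [(W xi)^-1]; far away it
    is integrable because [W] grows with the exponent [alpha < 1]
    ([weighted_decay_bound]).

    Lower bound ([symbol_lower_bound]). As [psi] is not zero, [psihat] does not
    vanish at some [c], hence stays away from zero around [c] by continuity. As
    [W] is sublinear, some [w1] satisfies [beta w1 * (xi - w1) = c], and
    [beta w * (xi - w)] stays close to [c] on an interval around [w1] of length
    proportional to [W w1], where the factor [beta w] is of order [(W w1)^-1].

    The transform [FT] on [L2] with Plancherel's theorem is constructed as
    follows. Damping by [abel e], whose transform is the Poisson kernel, and
    Schur's test show that the Fourier integral contracts the norm of
    integrable, square-integrable functions ([fourier_contraction]). It thus
    extends to [L2], by truncation and completeness ([riesz_fischer]).
    Parseval's identity against the indicators of intervals follows from Abel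
    summation, since their Poisson means are explicit ([parseval_cindic_L1]);
    as a function is determined by its integrals over intervals, this already
    gives the inversion formula [iFTK] and therefore [plancherel]. *)

Set Implicit Arguments.
Unset Strict Implicit.
Unset Printing Implicit Defensive.

(** * Complex-valued functions and their integrals *)

Section complex_numbers.
Context {R : realType}.
Implicit Types (z w : R[i]) (x : R).

Lemma ReD z w : complex.Re (z + w) = complex.Re z + complex.Re w.
Proof. by case: z; case: w. Qed.

Lemma ImD z w : complex.Im (z + w) = complex.Im z + complex.Im w.
Proof. by case: z; case: w. Qed.

Lemma ReN z : complex.Re (- z) = - complex.Re z.
Proof. by case: z. Qed.

Lemma ImN z : complex.Im (- z) = - complex.Im z.
Proof. by case: z. Qed.

Lemma ReM z w :
  complex.Re (z * w) = complex.Re z * complex.Re w - complex.Im z * complex.Im w.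
Proof. by case: z; case: w. Qed.

Lemma ImM z w :
  complex.Im (z * w) = complex.Re z * complex.Im w + complex.Im z * complex.Re w.
Proof. by case: z; case: w. Qed.

Lemma ReCM x z : complex.Re (x%:C * z) = x * complex.Re z.
Proof. by rewrite ReM /= mul0r subr0. Qed.

Lemma ImCM x z : complex.Im (x%:C * z) = x * complex.Im z.
Proof. by rewrite ImM /= mul0r addr0. Qed.

Lemma ReJ z : complex.Re (conjc z) = complex.Re z.
Proof. by case: z. Qed.

Lemma ImJ z : complex.Im (conjc z) = - complex.Im z.
Proof. by case: z. Qed.

Lemma complex_ext z w :
  complex.Re z = complex.Re w -> complex.Im z = complex.Im w -> z = w.
Proof. by case: z => a b; case: w => c d /= -> ->. Qed.

Lemma nrmc_ge0 z : 0 <= normc z.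
Proof. by case: z => a b; exact: sqrtr_ge0. Qed.

Lemma nrmc_sqr z : normc z ^+ 2 = complex.Re z ^+ 2 + complex.Im z ^+ 2.
Proof. by case: z => a b /=; rewrite sqr_sqrtr// addr_ge0// sqr_ge0. Qed.

Lemma nrmcJ z : normc (conjc z) = normc z.
Proof. by case: z => a b /=; rewrite sqrrN. Qed.

Lemma nrmcN z : normc (- z) = normc z.
Proof. by case: z => a b /=; rewrite !sqrrN. Qed.

Lemma nrmc_real x : normc (x%:C : R[i]) = `|x|.
Proof. by rewrite /= expr0n/= addr0 sqrtr_sqr. Qed.

Lemma conjcM z w : conjc (z * w) = conjc z * conjc w.
Proof. exact: rmorphM. Qed.

Lemma conjcD z w : conjc (z + w) = conjc z + conjc w.
Proof. exact: rmorphD. Qed.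

Lemma mulzJ z : z * conjc z = (normc z ^+ 2)%:C.
Proof.
apply: complex_ext; rewrite ?ReM ?ImM ReJ ImJ ?nrmc_sqr /=; ring.
Qed.

Lemma Re_le_nrmc z : `|complex.Re z| <= normc z.
Proof.
rewrite -(ler_pXn2r (n := 2))// ?nnegrE ?nrmc_ge0//.
by rewrite nrmc_sqr real_normK ?num_real// lerDl sqr_ge0.
Qed.

Lemma Im_le_nrmc z : `|complex.Im z| <= normc z.
Proof.
rewrite -(ler_pXn2r (n := 2))// ?nnegrE ?nrmc_ge0//.
by rewrite nrmc_sqr real_normK ?num_real// lerDr sqr_ge0.
Qed.

Lemma nrmc_le_ReIm z : normc z <= `|complex.Re z| + `|complex.Im z|.
Proof.
rewrite -(ler_pXn2r (n := 2))// ?nnegrE ?nrmc_ge0 ?addr_ge0//.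
rewrite nrmc_sqr sqrrD !real_normK ?num_real// -addrA lerD2l lerDr.
by rewrite mulrn_wge0// mulr_ge0.
Qed.

Lemma nrmcD z w : normc (z + w) <= normc z + normc w.
Proof. exact: le_normcD. Qed.

Lemma nrmcD_sqr z w :
  normc (z + w) ^+ 2 <= 2 * normc z ^+ 2 + 2 * normc w ^+ 2.
Proof.
rewrite !nrmc_sqr ReD ImD.
have := sqr_ge0 (complex.Re z - complex.Re w).
have := sqr_ge0 (complex.Im z - complex.Im w).
nra.
Qed.

Lemma nrmcM_le z w : normc (z * w) <= (normc z ^+ 2 + normc w ^+ 2) / 2.
Proof.
rewrite normcM; have := sqr_ge0 (normc z - normc w); nra.
Qed.

Lemma expiD x y : expi (x + y) = expi x * expi y :> R[i].
Proof.
apply: complex_ext; rewrite ?ReM ?ImM /= ?cosD ?sinD; ring.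
Qed.

Lemma nrmc_expi x : normc (expi x : R[i]) = 1.
Proof. by rewrite /= cos2Dsin2 sqrtr1. Qed.

Lemma conj_expi x : conjc (expi x) = expi (- x) :> R[i].
Proof. by rewrite /expi /= cosN sinN. Qed.

Lemma expi0 : expi 0 = 1 :> R[i].
Proof. by rewrite /expi cos0 sin0. Qed.

End complex_numbers.

Section cmeasurable_theory.
Context d (T : measurableType d) (R : realType).
Implicit Types f g : T -> R[i].

Lemma cmeasurable_cst (c : R[i]) : cmeasurable (fun _ : T => c).
Proof. by split; exact: measurable_cst. Qed.

Lemma cmeasurableD f g :
  cmeasurable f -> cmeasurable g -> cmeasurable (fun x => f x + g x).
Proof.
move=> [f1 f2] [g1 g2]; split.
- by under eq_fun do rewrite ReD; exact: measurable_funD.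
- by under eq_fun do rewrite ImD; exact: measurable_funD.
Qed.

Lemma cmeasurableM f g :
  cmeasurable f -> cmeasurable g -> cmeasurable (fun x => f x * g x).
Proof.
move=> [f1 f2] [g1 g2]; split.
- under eq_fun do rewrite ReM.
  by apply: measurable_funB; exact: measurable_funM.
- under eq_fun do rewrite ImM.
  by apply: measurable_funD; exact: measurable_funM.
Qed.

Lemma cmeasurableJ f : cmeasurable f -> cmeasurable (fun x => conjc (f x)).
Proof.
move=> [f1 f2]; split; first by under eq_fun do rewrite ReJ.
by under eq_fun do rewrite ImJ; exact: measurableT_comp.
Qed.

Lemma cmeasurableN f : cmeasurable f -> cmeasurable (fun x => - f x).
Proof.
move=> [f1 f2]; split.
- by under eq_fun do rewrite ReN; exact: measurableT_comp.
- by under eq_fun do rewrite ImN; exact: measurableT_comp.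
Qed.

Lemma cmeasurableB f g :
  cmeasurable f -> cmeasurable g -> cmeasurable (fun x => f x - g x).
Proof. by move=> mf mg; apply: cmeasurableD => //; exact: cmeasurableN. Qed.

Lemma cmeasurable_real (f : T -> R) :
  measurable_fun setT f -> cmeasurable (fun x => (f x)%:C).
Proof. by move=> mf; split => //=; exact: measurable_cst. Qed.

Lemma cmeasurable_expi (f : T -> R) :
  measurable_fun setT f -> cmeasurable (fun x => expi (f x)).
Proof.
move=> mf; split => /=; apply: measurableT_comp => //.
- by apply: continuous_measurable_fun; exact: continuous_cos.
- by apply: continuous_measurable_fun; exact: continuous_sin.
Qed.

Lemma measurable_nrmc f :
  cmeasurable f -> measurable_fun setT (fun x => normc (f x)).
Proof.
move=> [f1 f2].
have -> : (fun x => normc (f x)) =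
   (fun x => Num.sqrt (complex.Re (f x) ^+ 2 + complex.Im (f x) ^+ 2)).
  by apply/funext => x; case: (f x).
apply: (measurableT_comp (f := @Num.sqrt R)).
  by apply: continuous_measurable_fun; exact: sqrt_continuous.
by apply: measurable_funD; apply: measurable_funX.
Qed.

Lemma measurable_nrmc_sqr f :
  cmeasurable f -> measurable_fun setT (fun x => normc (f x) ^+ 2).
Proof. by move=> mf; apply: measurable_funX; exact: measurable_nrmc. Qed.

Lemma cmeasurable_comp d' (U : measurableType d') (h : U -> T) f :
  cmeasurable f -> measurable_fun setT h -> cmeasurable (fun x => f (h x)).
Proof.
move=> [f1 f2] mh; split.
- exact: (measurableT_comp f1 mh).
- exact: (measurableT_comp f2 mh).
Qed.

End cmeasurable_theory.

Section cintegral_theory.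
Context d (T : measurableType d) (R : realType).
Variable mu : {measure set T -> \bar R}.
Implicit Types f g : T -> R[i].

(** Each coordinate is dominated by the modulus, and the modulus by the sum of
    the coordinates: integrability can be tested on the modulus. *)
Lemma cintegrableP f :
  cintegrable mu f <->
  cmeasurable f /\ (\int[mu]_x (normc (f x))%:E < +oo)%E.
Proof.
split=> [[/integrableP[m1 i1] /integrableP[m2 i2]]|[[m1 m2] fi]].
  have mf : cmeasurable f by split; apply/measurable_EFinP.
  split => //.
  apply: (@le_lt_trans _ _ (\int[mu]_x (`|(complex.Re (f x))%:E| +
                                        `|(complex.Im (f x))%:E|))%E).
    apply: ge0_le_integral => //=.
    - by move=> x _; rewrite lee_fin nrmc_ge0.
    - by apply/measurable_EFinP; exact: measurable_nrmc.
    - by apply: emeasurable_funD; apply/measurable_EFinP;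
        apply: measurableT_comp => //; [exact: mf.1|exact: mf.2].
    - by move=> x _; rewrite lee_fin nrmc_le_ReIm.
  rewrite ge0_integralD//; last 2 first.
    by apply: measurableT_comp.
    by apply: measurableT_comp.
  by rewrite lte_add_pinfty.
split; apply/integrableP; split.
- exact/measurable_EFinP.
- apply: le_lt_trans fi; apply: ge0_le_integral => //=.
  + by apply/measurable_EFinP; apply: measurableT_comp.
  + by apply/measurable_EFinP; exact: measurable_nrmc.
  + by move=> x _; rewrite lee_fin Re_le_nrmc.
- exact/measurable_EFinP.
- apply: le_lt_trans fi; apply: ge0_le_integral => //=.
  + by apply/measurable_EFinP; apply: measurableT_comp.
  + by apply/measurable_EFinP; exact: measurable_nrmc.
  + by move=> x _; rewrite lee_fin Im_le_nrmc.
Qed.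

Lemma cintegrable_measurable f : cintegrable mu f -> cmeasurable f.
Proof. by move=> /cintegrableP[]. Qed.

Lemma le_cintegrable f g : cmeasurable f -> cintegrable mu g ->
  (forall x, normc (f x) <= normc (g x)) -> cintegrable mu f.
Proof.
move=> mf /cintegrableP[mg gi] fg; apply/cintegrableP; split => //.
apply: le_lt_trans gi; apply: ge0_le_integral => //=.
- by move=> x _; rewrite lee_fin nrmc_ge0.
- by apply/measurable_EFinP; exact: measurable_nrmc.
- by apply/measurable_EFinP; exact: measurable_nrmc.
- by move=> x _; rewrite lee_fin.
Qed.

Lemma cintegrable_nrmc f : cintegrable mu f ->
  mu.-integrable setT (fun x => (normc (f x))%:E).
Proof.
move=> /cintegrableP[mf fi]; apply/integrableP; split.
  by apply/measurable_EFinP; exact: measurable_nrmc.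
by under eq_integral do rewrite abse_EFin ger0_norm ?nrmc_ge0//.
Qed.

Lemma cintegrableD f g : cintegrable mu f -> cintegrable mu g ->
  cintegrable mu (fun x => f x + g x).
Proof.
move=> [f1 f2] [g1 g2]; split.
- by under eq_fun do rewrite ReD EFinD; exact: integrableD.
- by under eq_fun do rewrite ImD EFinD; exact: integrableD.
Qed.

Lemma cintegrableZ (c : R[i]) f : cintegrable mu f ->
  cintegrable mu (fun x => c * f x).
Proof.
move=> [f1 f2]; split.
- under eq_fun do rewrite ReM EFinB !EFinM.
  by apply: integrableB => //; exact: integrableZl.
- under eq_fun do rewrite ImM EFinD !EFinM.
  by apply: integrableD => //; exact: integrableZl.
Qed.

Lemma cintegrableJ f : cintegrable mu f -> cintegrable mu (fun x => conjc (f x)).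
Proof.
move=> [f1 f2]; split; first by under eq_fun do rewrite ReJ.
by under eq_fun do rewrite ImJ EFinN; apply: integrableN.
Qed.

Lemma eq_cintegral f g : f =1 g -> cintegral mu f = cintegral mu g.
Proof. by move=> fg; congr cintegral; apply/funext. Qed.

Lemma cintegralD f g : cintegrable mu f -> cintegrable mu g ->
  cintegral mu (fun x => f x + g x) = cintegral mu f + cintegral mu g.
Proof.
move=> [f1 f2] [g1 g2]; apply: complex_ext; rewrite ?ReD ?ImD /=.
- by under eq_Rintegral do rewrite ReD; rewrite RintegralD.
- by under eq_Rintegral do rewrite ImD; rewrite RintegralD.
Qed.

Lemma cintegralZ (c : R[i]) f : cintegrable mu f ->
  cintegral mu (fun x => c * f x) = c * cintegral mu f.
Proof.
move=> [f1 f2]; apply: complex_ext; rewrite ?ReM ?ImM /=.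
- under eq_Rintegral do rewrite ReM.
  rewrite RintegralB//; [|exact: (integrableZl _ _ f1)|exact: (integrableZl _ _ f2)].
  by rewrite !RintegralZl.
- under eq_Rintegral do rewrite ImM.
  rewrite RintegralD//; [|exact: (integrableZl _ _ f2)|exact: (integrableZl _ _ f1)].
  by rewrite !RintegralZl.
Qed.

Lemma cintegralN f : cintegrable mu f ->
  cintegral mu (fun x => - f x) = - cintegral mu f.
Proof.
move=> fi; under eq_cintegral do rewrite -mulN1r.
by rewrite cintegralZ// mulN1r.
Qed.

Lemma cintegralB f g : cintegrable mu f -> cintegrable mu g ->
  cintegral mu (fun x => f x - g x) = cintegral mu f - cintegral mu g.
Proof.
move=> fi gi; rewrite cintegralD// ?cintegralN//.
by have := cintegrableZ (-1) gi; under eq_fun do rewrite mulN1r.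
Qed.

Lemma cintegralJ f : cintegral mu (fun x => conjc (f x)) = conjc (cintegral mu f).
Proof.
rewrite /cintegral /= ; congr (_ +i* _).
  by apply: eq_Rintegral => x _; rewrite ReJ.
rewrite /Rintegral; under eq_integral do rewrite ImJ EFinN.
rewrite integralE funeposN funenegN [in RHS]integralE.
set a := integral _ _ _; set b := integral _ _ _.
have a0 : (0 <= a)%E by exact: integral_ge0.
have b0 : (0 <= b)%E by exact: integral_ge0.
by move: a b a0 b0 => [a| |] [b| |] //= _ _; ring.
Qed.

Lemma ae_eq_cintegral f g : cmeasurable f -> cmeasurable g ->
  {ae mu, forall x, f x = g x} -> cintegral mu f = cintegral mu g.
Proof.
move=> [f1 f2] [g1 g2] fg; rewrite /cintegral; congr (_ +i* _); congr fine;
  (apply: ae_eq_integral => //; first exact/measurable_EFinP;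
   first exact/measurable_EFinP);
  by apply: filterS fg => x /= ->.
Qed.

Lemma cintegral0 : cintegral mu (fun _ => 0) = 0.
Proof. by rewrite /cintegral /Rintegral !integral0. Qed.

Lemma cintegral_real (f : T -> R) :
  cintegral mu (fun x => (f x)%:C) = (Rintegral mu setT f)%:C.
Proof.
by rewrite /cintegral /=; congr (_ +i* _); rewrite /Rintegral integral0.
Qed.

Lemma Re_cintegral_le f : cintegrable mu f ->
  complex.Re (cintegral mu f) <= Rintegral mu setT (fun x => normc (f x)).
Proof.
move=> fi; have [f1 f2] := fi; apply: le_Rintegral => //.
  exact: cintegrable_nrmc.
by move=> x _; apply: le_trans (Re_le_nrmc _); exact: ler_norm.
Qed.

(** Rotating the integral onto the positive real axis reduces the complex
    triangle inequality to the real one. *)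
Lemma nrmc_cintegral_le f : cintegrable mu f ->
  normc (cintegral mu f) <= Rintegral mu setT (fun x => normc (f x)).
Proof.
move=> fi; set I := cintegral mu f.
have [->|I0] := eqVneq I 0.
  by rewrite normc0; apply: Rintegral_ge0 => x _; exact: nrmc_ge0.
have nI0 : 0 < normc I.
  rewrite lt_def nrmc_ge0 andbT; apply/eqP => /eq0_normc I00.
  by rewrite I00 eqxx in I0.
have := Re_cintegral_le (cintegrableZ (conjc I) fi).
rewrite cintegralZ// mulrC mulzJ.
under eq_Rintegral do rewrite normcM nrmcJ.
rewrite RintegralZl//; last exact: cintegrable_nrmc.
by rewrite [complex.Re _]/= expr2 ler_pM2l.
Qed.

Lemma nrmc_cintegral_lee f : cintegrable mu f ->
  ((normc (cintegral mu f))%:E <= \int[mu]_x (normc (f x))%:E)%E.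
Proof.
move=> fi; rewrite -[leRHS]fineK; first by rewrite lee_fin nrmc_cintegral_le.
by apply: integrable_fin_num => //; exact: cintegrable_nrmc.
Qed.

(** Convergence of complex sequences is read off the two coordinates, so that
    the real dominated convergence theorem applies to each of them. *)
Definition ccvg (u : nat -> R[i]) (l : R[i]) :=
  (fun n => complex.Re (u n)) @ \oo --> complex.Re l /\
  (fun n => complex.Im (u n)) @ \oo --> complex.Im l.

Lemma ccvg_nrmc (u : nat -> R[i]) l :
  (fun n => normc (u n - l)) @ \oo --> (0 : R) -> ccvg u l.
Proof.
move=> ul; split.
- apply/cvgrPdist_le => /= e e0.
  move/cvgrPdist_le : ul => /(_ e e0); apply: filterS => n /=.
  rewrite sub0r normrN ger0_norm ?nrmc_ge0//; apply: le_trans.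
  by rewrite distrC -ReN -ReD Re_le_nrmc.
- apply/cvgrPdist_le => /= e e0.
  move/cvgrPdist_le : ul => /(_ e e0); apply: filterS => n /=.
  rewrite sub0r normrN ger0_norm ?nrmc_ge0//; apply: le_trans.
  by rewrite distrC -ImN -ImD Im_le_nrmc.
Qed.

Lemma eq_ccvg (u v : nat -> R[i]) l : u =1 v -> ccvg u l -> ccvg v l.
Proof. by move=> /funext ->. Qed.

Lemma ccvg_scale (a : nat -> R) (k : R) (z : R[i]) : a @ \oo --> k ->
  ccvg (fun n => (a n)%:C * z) (k%:C * z).
Proof.
move=> ak; split.
- under eq_fun do rewrite ReCM; rewrite ReCM.
  by apply: cvgM => //; exact: cvg_cst.
- under eq_fun do rewrite ImCM; rewrite ImCM.
  by apply: cvgM => //; exact: cvg_cst.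
Qed.

Lemma ccvg_unique (u : nat -> R[i]) k l : ccvg u k -> ccvg u l -> k = l.
Proof.
move=> [k1 k2] [l1 l2]; apply: complex_ext.
- exact: (cvg_unique _ k1 l1).
- exact: (cvg_unique _ k2 l2).
Qed.

Lemma cdominated_convergence (u : nat -> T -> R[i]) f (g : T -> R) :
  (forall n, cmeasurable (u n)) -> cmeasurable f ->
  {ae mu, forall x, ccvg (u ^~ x) (f x)} ->
  mu.-integrable setT (EFin \o g) ->
  (forall n x, normc (u n x) <= g x) ->
  ccvg (fun n => cintegral mu (u n)) (cintegral mu f).
Proof.
move=> mu_ mf uf gi ug; split.
- have /= [] := @dominated_convergence _ _ _ mu setT measurableT
    (fun n x => (complex.Re (u n x))%:E) (fun x => (complex.Re (f x))%:E) (EFin \o g).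
  + by move=> n; apply/measurable_EFinP; exact: (mu_ n).1.
  + by apply/measurable_EFinP; exact: mf.1.
  + by apply: filterS uf => x [ux _] _; apply: cvg_EFin => //; exact: nearW.
  + exact: gi.
  + by apply: nearW => x n _ /=; rewrite lee_fin (le_trans (Re_le_nrmc _)).
  + move=> fi _ cv; apply: fine_cvg; rewrite fineK//.
    exact: integrable_fin_num.
- have /= [] := @dominated_convergence _ _ _ mu setT measurableT
    (fun n x => (complex.Im (u n x))%:E) (fun x => (complex.Im (f x))%:E) (EFin \o g).
  + by move=> n; apply/measurable_EFinP; exact: (mu_ n).2.
  + by apply/measurable_EFinP; exact: mf.2.
  + by apply: filterS uf => x [_ ux] _; apply: cvg_EFin => //; exact: nearW.
  + exact: gi.
  + by apply: nearW => x n _ /=; rewrite lee_fin (le_trans (Im_le_nrmc _)).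
  + move=> fi _ cv; apply: fine_cvg; rewrite fineK//.
    exact: integrable_fin_num.
Qed.

(** Polarization: the modulus of the mixed product is at most half the sum of
    the two squares. *)
Lemma cintegrable_mulJ f g : cmeasurable f -> cmeasurable g ->
  cintegrable mu (fun z => f z * conjc (f z)) ->
  cintegrable mu (fun z => g z * conjc (g z)) ->
  cintegrable mu (fun z => f z * conjc (g z)).
Proof.
move=> mf mg fi gi; apply: (le_cintegrable _ (cintegrableD fi gi)).
  by apply: cmeasurableM => //; exact: cmeasurableJ.
move=> z; rewrite !mulzJ -rmorphD nrmc_real ger0_norm ?addr_ge0 ?sqr_ge0//.
apply: le_trans (nrmcM_le _ _) _; rewrite nrmcJ ler_pdivrMr//.
by rewrite ler_peMr ?addr_ge0 ?sqr_ge0// ler1n.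
Qed.

End cintegral_theory.

Section cfubini.
Context d1 d2 (T1 : measurableType d1) (T2 : measurableType d2) (R : realType).
Variable m1 : {sigma_finite_measure set T1 -> \bar R}.
Variable m2 : {sigma_finite_measure set T2 -> \bar R}.
Implicit Types f : T1 * T2 -> R[i].

Lemma cintegrable_prod12 f : cmeasurable f ->
  (\int[m1]_x \int[m2]_y (normc (f (x, y)))%:E < +oo)%E ->
  cintegrable (m1 \x m2)%E f.
Proof.
move=> mf fi; apply/cintegrableP; split => //.
rewrite (fubini_tonelli1 (fun z => (normc (f z))%:E))//.
- by apply/measurable_EFinP; exact: measurable_nrmc.
- by move=> x; rewrite lee_fin nrmc_ge0.
Qed.

Lemma cintegrable_prod21 f : cmeasurable f ->
  (\int[m2]_y \int[m1]_x (normc (f (x, y)))%:E < +oo)%E ->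
  cintegrable (m1 \x m2)%E f.
Proof.
move=> mf fi; apply/cintegrableP; split => //.
rewrite (fubini_tonelli2 (fun z => (normc (f z))%:E))//.
- by apply/measurable_EFinP; exact: measurable_nrmc.
- by move=> x; rewrite lee_fin nrmc_ge0.
Qed.

(** Tonelli's theorem, applied to the positive and to the negative part, gives
    measurability before anything is known about integrability. *)
Lemma measurable_Rintegral_param (f : T1 * T2 -> R) :
  measurable_fun setT f ->
  measurable_fun setT (fun x => Rintegral m2 setT (fun y => f (x, y))).
Proof.
move=> mf; rewrite /Rintegral; apply: measurableT_comp.
  exact: fine_measurable.
have mf' : measurable_fun setT (EFin \o f) by apply/measurable_EFinP.
have -> : (fun x => \int[m2]_y (f (x, y))%:E)%E =
  (fubini_F m2 (EFin \o f)^\+ \- fubini_F m2 (EFin \o f)^\-)%E.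
  apply/funext => x /=; rewrite integralE /fubini_F.
  by congr (_ - _)%E; apply: eq_integral => y _; rewrite ?funeposE ?funenegE.
apply: emeasurable_funB; apply: measurable_fun_fubini_tonelli_F => //.
- exact: measurable_funepos.
- exact: measurable_funeneg.
Qed.

Lemma cmeasurable_cintegral_param f : cmeasurable f ->
  cmeasurable (fun x => cintegral m2 (fun y => f (x, y))).
Proof.
move=> [f1 f2]; split => /=.
- exact: (measurable_Rintegral_param (f := fun z => complex.Re (f z))).
- exact: (measurable_Rintegral_param (f := fun z => complex.Im (f z))).
Qed.

Let Rfubini (f : T1 * T2 -> R) : (m1 \x m2)%E.-integrable setT (EFin \o f) ->
  Rintegral m1 setT (fun x => Rintegral m2 setT (fun y => f (x, y))) =
  fine (\int[m1]_x \int[m2]_y (f (x, y))%:E)%E.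
Proof.
move=> fi; rewrite /Rintegral; congr fine.
apply: ae_eq_integral => //.
- apply/measurable_EFinP; apply: measurable_Rintegral_param.
  by apply/measurable_EFinP; exact: (measurable_int _ fi).
- exact: (measurable_fubini_F fi).
have := ae_integrable1 fi; apply: filterS => x /= fxi _.
by rewrite fineK//; apply: integrable_fin_num.
Qed.

Let Rfubini2 (f : T1 * T2 -> R) : (m1 \x m2)%E.-integrable setT (EFin \o f) ->
  Rintegral m2 setT (fun y => Rintegral m1 setT (fun x => f (x, y))) =
  fine (\int[m2]_y \int[m1]_x (f (x, y))%:E)%E.
Proof.
move=> fi; rewrite /Rintegral; congr fine.
have mf : measurable_fun setT (EFin \o f) by exact: (measurable_int _ fi).
apply: ae_eq_integral => //.
- apply/measurable_EFinP.
  have mG := measurable_fubini_G fi.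
  exact: (measurableT_comp (fine_measurable measurableT) mG).
- exact: (measurable_fubini_G fi).
have := ae_integrable2 fi; apply: filterS => x /= fxi _.
by rewrite fineK//; apply: integrable_fin_num.
Qed.

Lemma cfubini f : cintegrable (m1 \x m2)%E f ->
  cintegral m1 (fun x => cintegral m2 (fun y => f (x, y))) =
  cintegral m2 (fun y => cintegral m1 (fun x => f (x, y))).
Proof.
move=> [f1 f2]; apply: complex_ext => /=.
- by rewrite (Rfubini f1) (Rfubini2 f1) (Fubini f1).
- by rewrite (Rfubini f2) (Rfubini2 f2) (Fubini f2).
Qed.

Lemma integral21_cintegrable f : cintegrable (m1 \x m2)%E f ->
  (\int[m2]_y \int[m1]_x (normc (f (x, y)))%:E < +oo)%E.
Proof.
move=> /cintegrableP[mf].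
rewrite (fubini_tonelli2 (fun z => (normc (f z))%:E))//.
- by apply/measurable_EFinP; exact: measurable_nrmc.
- by move=> x; rewrite lee_fin nrmc_ge0.
Qed.

End cfubini.

(** * Square-integrable functions *)

(** Lets [filterS] and the like see through the two presentations of the
    measurable structure of the line. *)
Global Instance lebesgue_ae_filter (R : realType) :
  Filter (nbhs (almost_everywhere (@lebesgue_measure R))).
Proof.
exact: (@ae_filter_ringOfSetsType _ _ _ (@lebesgue_measure R : {measure set _ -> \bar R})).
Qed.

Section square_norm.
Context {R : realType}.
Notation mu := (@lebesgue_measure R).
Implicit Types (f g : R -> R[i]) (u : nat -> R -> R[i]).

(** The squared norm as a real number. As an integral it is additive and
    monotone without any root, and [L2norm_nrm2] recovers the norm. *)
Definition nrm2 f : R := Rintegral mu setT (fun t => normc (f t) ^+ 2).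

Lemma L2normE f :
  L2norm f = sqrte (\int[mu]_t (normc (f t) ^+ 2)%:E)%E.
Proof.
rewrite /L2norm unlock /Lnorm -poweR12_sqrt; last first.
  by apply: integral_ge0 => x _; rewrite lee_fin sqr_ge0.
congr (_ `^ _)%E; apply: eq_integral => t _.
by rewrite abse_EFin ger0_norm ?nrmc_ge0// poweR_EFin powR_mulrn ?nrmc_ge0.
Qed.

Lemma L2P f : L2 f <->
  cmeasurable f /\ (\int[mu]_t (normc (f t) ^+ 2)%:E < +oo)%E.
Proof.
rewrite /L2 L2normE; set I := integral _ _ _.
have I0 : (0 <= I)%E by apply: integral_ge0 => x _; rewrite lee_fin sqr_ge0.
suff -> : (sqrte I < +oo)%E = (I < +oo)%E by [].
by rewrite -!ge0_fin_numE ?sqrte_ge0// sqrte_fin_num.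
Qed.

Lemma L2_measurable f : L2 f -> cmeasurable f. Proof. by case. Qed.

Lemma nrm2_ge0 f : 0 <= nrm2 f.
Proof. by apply: Rintegral_ge0 => x _; exact: sqr_ge0. Qed.

Lemma nrm2E f : L2 f -> (\int[mu]_t (normc (f t) ^+ 2)%:E)%E = (nrm2 f)%:E.
Proof.
move=> /L2P[mf fi]; rewrite /nrm2 /Rintegral fineK// ge0_fin_numE//.
by apply: integral_ge0 => x _; rewrite lee_fin sqr_ge0.
Qed.

Lemma L2norm_nrm2 f : L2 f -> L2norm f = (Num.sqrt (nrm2 f))%:E.
Proof. by move=> Lf; rewrite L2normE nrm2E. Qed.

Lemma L2_integrable_sqr f : L2 f ->
  mu.-integrable setT (fun t => (normc (f t) ^+ 2)%:E).
Proof.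
move=> /L2P[mf fi]; apply/integrableP; split.
  by apply/measurable_EFinP; exact: measurable_nrmc_sqr.
by under eq_integral do rewrite abse_EFin ger0_norm ?sqr_ge0//.
Qed.

Lemma le_L2 f (h : R -> R) : cmeasurable f ->
  mu.-integrable setT (EFin \o h) ->
  (forall t, normc (f t) ^+ 2 <= h t) -> L2 f /\ nrm2 f <= Rintegral mu setT h.
Proof.
move=> mf hi fh.
have mf2 : measurable_fun setT (fun t => (normc (f t) ^+ 2)%:E).
  by apply/measurable_EFinP; exact: measurable_nrmc_sqr.
have fi : mu.-integrable setT (fun t => (normc (f t) ^+ 2)%:E).
  apply: le_integrable hi => // t _.
  rewrite !abse_EFin lee_fin ger0_norm ?sqr_ge0//.
  by apply: le_trans (ler_norm _); exact: fh.
split; last by apply: le_Rintegral.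
apply/L2P; split => //; move/integrableP : fi => [_].
by under eq_integral do rewrite abse_EFin ger0_norm ?sqr_ge0//.
Qed.

Lemma L2D f g : L2 f -> L2 g ->
  L2 (fun t => f t + g t) /\
  nrm2 (fun t => f t + g t) <= 2 * nrm2 f + 2 * nrm2 g.
Proof.
move=> Lf Lg; have fi := L2_integrable_sqr Lf; have gi := L2_integrable_sqr Lg.
have := @le_L2 (fun t => f t + g t)
  (fun t => 2 * normc (f t) ^+ 2 + 2 * normc (g t) ^+ 2).
rewrite RintegralD//; last 2 first.
  exact: (integrableZl _ 2 fi).
  exact: (integrableZl _ 2 gi).
rewrite !RintegralZl//; apply.
- exact: cmeasurableD (L2_measurable Lf) (L2_measurable Lg).
- apply: (@integrableD _ _ _ mu setT measurableT (fun t => 2%:E * (normc (f t) ^+ 2)%:E)%E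
    (fun t => 2%:E * (normc (g t) ^+ 2)%:E)%E).
    exact: (integrableZl _ 2 fi).
  exact: (integrableZl _ 2 gi).
- by move=> t; exact: nrmcD_sqr.
Qed.

Lemma L2_bounded_mul (m : R -> R[i]) (M : R) f : cmeasurable m ->
  (forall t, normc (m t) <= M) -> L2 f ->
  L2 (fun t => m t * f t) /\ nrm2 (fun t => m t * f t) <= M ^+ 2 * nrm2 f.
Proof.
move=> mm mM Lf; have fi := L2_integrable_sqr Lf.
have := @le_L2 (fun t => m t * f t) (fun t => M ^+ 2 * normc (f t) ^+ 2).
rewrite RintegralZl//; apply.
- exact: cmeasurableM mm (L2_measurable Lf).
- exact: (integrableZl _ (M ^+ 2) fi).
- move=> t; rewrite normcM exprMn ler_wpM2r ?sqr_ge0//.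
  by rewrite lerXn2r ?nnegrE ?nrmc_ge0// (le_trans (nrmc_ge0 _) (mM t)).
Qed.

Lemma L2Z (c : R[i]) f : L2 f -> L2 (fun t => c * f t).
Proof.
move=> Lf.
by case: (L2_bounded_mul (M := normc c) (cmeasurable_cst _ c) _ Lf).
Qed.

Lemma L2J f : L2 f -> L2 (fun t => conjc (f t)).
Proof.
move=> /L2P[mf fi]; apply/L2P; split; first exact: cmeasurableJ.
by under eq_integral do rewrite nrmcJ.
Qed.

Lemma nrm2J f : nrm2 (fun t => conjc (f t)) = nrm2 f.
Proof. by apply: eq_Rintegral => t _; rewrite nrmcJ. Qed.

Lemma L2N f : L2 f -> L2 (fun t => - f t).
Proof. by move=> /(L2Z (-1)); under eq_fun do rewrite mulN1r. Qed.

Lemma nrm2N f : nrm2 (fun t => - f t) = nrm2 f.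
Proof. by apply: eq_Rintegral => t _; rewrite nrmcN. Qed.

Lemma nrm2BC f g : nrm2 (fun t => f t - g t) = nrm2 (fun t => g t - f t).
Proof. by rewrite -nrm2N; congr nrm2; apply/funext => t; rewrite opprB. Qed.

Lemma L2B f g : L2 f -> L2 g ->
  L2 (fun t => f t - g t) /\
  nrm2 (fun t => f t - g t) <= 2 * nrm2 f + 2 * nrm2 g.
Proof. by move=> Lf Lg; have := L2D Lf (L2N Lg); rewrite nrm2N. Qed.

Lemma nrm2_triangle f g h : L2 f -> L2 g -> L2 h ->
  nrm2 (fun t => f t - h t) <=
  2 * nrm2 (fun t => f t - g t) + 2 * nrm2 (fun t => g t - h t).
Proof.
move=> Lf Lg Lh; have := (L2D (L2B Lf Lg).1 (L2B Lg Lh).1).2.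
by under eq_fun do rewrite addrA subrK.
Qed.

Lemma nrm2_eq0 f : L2 f -> nrm2 f = 0 -> aeeq f (fun _ => 0).
Proof.
move=> Lf f0.
have mF : measurable_fun [set: measurableTypeR R] (fun t => (normc (f t) ^+ 2)%:E).
  by apply/measurable_EFinP; apply: measurable_nrmc_sqr; exact: L2_measurable.
have [+ _] := ae_eq_integral_abs (@lebesgue_measure R) measurableT mF.
under eq_integral do rewrite abse_EFin ger0_norm ?sqr_ge0//.
rewrite nrm2E// f0 => /(_ erefl); apply: filterS => t /(_ I)[] /eqP.
by rewrite expf_eq0 /= => /eqP /eq0_normc.
Qed.

Lemma aeeq_nrm2 f g : L2 f -> L2 g ->
  nrm2 (fun t => f t - g t) = 0 -> aeeq f g.
Proof.
move=> Lf Lg /(nrm2_eq0 (L2B Lf Lg).1); apply: filterS => t /eqP.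
by rewrite subr_eq0 => /eqP.
Qed.

Lemma nrm2_aeeq0 f g : cmeasurable f -> cmeasurable g -> aeeq f g ->
  nrm2 (fun t => f t - g t) = 0.
Proof.
move=> mf mg fg.
have -> : 0 = nrm2 (fun _ => 0).
  by rewrite /nrm2 /Rintegral normc0 expr0n integral0.
congr fine; apply: ae_eq_integral => //.
- by apply/measurable_EFinP; apply: measurable_nrmc_sqr; exact: cmeasurableB.
- by apply: filterS fg => t /= -> _; rewrite subrr.
Qed.

Lemma aeeq_sym f g : aeeq f g -> aeeq g f.
Proof. by apply: filterS => t ->. Qed.

Lemma aeeq_trans g f h : aeeq f g -> aeeq g h -> aeeq f h.
Proof. by move=> fg gh; apply: filterS2 fg gh => t -> ->. Qed.

End square_norm.

Section inner_product.
Context {R : realType}.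
Notation mu := (@lebesgue_measure R).
Implicit Types (f g : R -> R[i]) (u : nat -> R -> R[i]).

Lemma inner_integrable f g : L2 f -> L2 g ->
  cintegrable mu (fun t => f t * conjc (g t)).
Proof.
move=> Lf Lg; apply/cintegrableP.
have mfg : cmeasurable (fun t => f t * conjc (g t)).
  apply: cmeasurableM (L2_measurable Lf) _.
  exact: cmeasurableJ (L2_measurable Lg).
split => //.
have fi := L2_integrable_sqr Lf; have gi := L2_integrable_sqr Lg.
have si := integrableD measurableT fi gi.
have /integrableP[_] : mu.-integrable setT (fun t => (normc (f t * conjc (g t)))%:E).
  apply: (le_integrable _ _ _ si) => //.
    by apply/measurable_EFinP; exact: measurable_nrmc.
  move=> t _; rewrite -EFinD !abse_EFin lee_fin ger0_norm ?nrmc_ge0//.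
  rewrite ger0_norm ?addr_ge0 ?sqr_ge0//.
  apply: le_trans (nrmcM_le _ _) _; rewrite nrmcJ.
  have : 0 <= normc (f t) ^+ 2 + normc (g t) ^+ 2 by rewrite addr_ge0 ?sqr_ge0.
  by lra.
move=> h; apply: le_lt_trans h; rewrite le_eqVlt; apply/orP; left; apply/eqP.
by apply: eq_integral => t _; rewrite abse_EFin ger0_norm ?nrmc_ge0//.
Qed.

Lemma innerJ f g : inner f g = conjc (inner g f).
Proof.
rewrite /inner -cintegralJ; apply: eq_cintegral => t.
by rewrite rmorphM /= conjcK mulrC.
Qed.

Lemma innerDl f g h : L2 f -> L2 g -> L2 h ->
  inner (fun t => f t + g t) h = inner f h + inner g h.
Proof.
move=> Lf Lg Lh; rewrite /inner -cintegralD; [|exact: inner_integrable..].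
by apply: eq_cintegral => t; rewrite mulrDl.
Qed.

Lemma innerZl (c : R[i]) f h : L2 f -> L2 h ->
  inner (fun t => c * f t) h = c * inner f h.
Proof.
move=> Lf Lh; rewrite /inner -cintegralZ; last exact: inner_integrable.
by apply: eq_cintegral => t; rewrite mulrA.
Qed.

Lemma innerBl f g h : L2 f -> L2 g -> L2 h ->
  inner (fun t => f t - g t) h = inner f h - inner g h.
Proof.
move=> Lf Lg Lh; rewrite innerDl//; last exact: L2N.
rewrite -mulN1r -innerZl//; congr (_ + _).
by congr inner; apply/funext => t; rewrite mulN1r.
Qed.

Lemma inner_nrm2 f : inner f f = (nrm2 f)%:C.
Proof.
by rewrite /inner /nrm2 -cintegral_real; apply: eq_cintegral => t; exact: mulzJ.
Qed.

Lemma inner_ae f f' g g' : L2 f -> L2 g -> cmeasurable f' -> cmeasurable g' ->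
  aeeq f f' -> aeeq g g' -> inner f g = inner f' g'.
Proof.
move=> Lf Lg mf' mg' ff' gg'; apply: ae_eq_cintegral.
- apply: cmeasurableM (L2_measurable Lf) _.
  exact: cmeasurableJ (L2_measurable Lg).
- by apply: cmeasurableM => //; exact: cmeasurableJ.
- by apply: filterS2 ff' gg' => t -> ->.
Qed.

(** Integrating [2 * t * |f| * |g| <= t ^+ 2 * |f| ^+ 2 + |g| ^+ 2] gives a
    quadratic inequality in [t], which is then optimized. *)
Lemma cauchy_schwarz f g : L2 f -> L2 g ->
  normc (inner f g) ^+ 2 <= nrm2 f * nrm2 g.
Proof.
move=> Lf Lg; set c := normc _; set a := nrm2 f; set b := nrm2 g.
have H t : 2 * t * c <= t ^+ 2 * a + b.
  have [t0|t0] := leP t 0.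
    apply: (@le_trans _ _ 0).
      by rewrite mulr_le0_ge0 ?nrmc_ge0// mulr_ge0_le0.
    by apply: addr_ge0; [apply: mulr_ge0; [exact: sqr_ge0|exact: nrm2_ge0]|exact: nrm2_ge0].
  have fgi := inner_integrable Lf Lg.
  have := nrmc_cintegral_le fgi; rewrite -/(inner f g) -/c => cle.
  have fi := L2_integrable_sqr Lf; have gi := L2_integrable_sqr Lg.
  have -> : t ^+ 2 * a + b =
      Rintegral mu setT (fun x => t ^+ 2 * normc (f x) ^+ 2 + normc (g x) ^+ 2).
    by rewrite RintegralD// ?RintegralZl//; exact: (integrableZl _ _ fi).
  apply: (@le_trans _ _ (2 * t * Rintegral mu setT
      (fun x => normc (f x * conjc (g x))))).
    by rewrite ler_pM2l// mulr_gt0.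
  rewrite -RintegralZl//; last exact: cintegrable_nrmc.
  apply: le_Rintegral => //.
  - exact: (integrableZl _ _ (cintegrable_nrmc fgi)).
  - apply: (@integrableD _ _ _ mu setT measurableT
      (fun x => (t ^+ 2)%:E * (normc (f x) ^+ 2)%:E)%E
      (fun x => (normc (g x) ^+ 2)%:E)) => //.
    exact: (integrableZl _ _ fi).
  - move=> x _; rewrite normcM nrmcJ.
    have := sqr_ge0 (t * normc (f x) - normc (g x)); nra.
(* without the quadratic term, a large [t] forces the inner product to vanish *)
have [a0|a0] := eqVneq a 0.
  rewrite a0 mul0r; suff -> : c = 0 by rewrite expr0n.
  apply/eqP; rewrite eq_le nrmc_ge0 andbT; apply: contraT; rewrite -ltNge => c0.
  have := H ((b + 1) / (2 * c)); rewrite a0 mulr0 add0r.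
  rewrite (_ : 2 * _ * c = b + 1); last by field; rewrite gt_eqF.
  by rewrite -subr_ge0 opprD addrA subrr sub0r oppr_ge0 ler10.
have {}a0 : 0 < a by rewrite lt_def a0 nrm2_ge0.
have := H (c / a).
rewrite (_ : 2 * _ * c = 2 * (c ^+ 2 / a)); last by field; rewrite gt_eqF.
rewrite (_ : _ ^+ 2 * a = c ^+ 2 / a); last by field; rewrite gt_eqF.
move=> h; have : c ^+ 2 / a <= b by lra.
by rewrite ler_pdivrMr// mulrC.
Qed.

Lemma inner_cvgl u f g : (forall n, L2 (u n)) -> L2 f -> L2 g ->
  (fun n => nrm2 (fun t => u n t - f t)) @ \oo --> (0 : R) ->
  ccvg (fun n => inner (u n) g) (inner f g).
Proof.
move=> Lu Lf Lg uf; apply: ccvg_nrmc.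
apply: (@squeeze_cvgr _ _ _ _ (cst 0) (fun n =>
   Num.sqrt (nrm2 (fun t => u n t - f t) * nrm2 g))).
- apply: nearW => n; apply/andP; split; first exact: nrmc_ge0.
  rewrite -(innerBl (Lu n) Lf Lg).
  rewrite -[leLHS]ger0_norm ?nrmc_ge0// -sqrtr_sqr ler_wsqrtr//.
  by apply: cauchy_schwarz => //; exact: (L2B _ _).1.
- exact: cvg_cst.
- rewrite -[X in _ --> X]sqrtr0; apply: continuous_cvg; first exact: sqrt_continuous.
  rewrite -[X in _ --> X](mul0r (nrm2 g)); apply: cvgM => //; exact: cvg_cst.
Qed.

Lemma inner_cvgr u f g : (forall n, L2 (u n)) -> L2 f -> L2 g ->
  (fun n => nrm2 (fun t => u n t - f t)) @ \oo --> (0 : R) ->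
  ccvg (fun n => inner g (u n)) (inner g f).
Proof.
move=> Lu Lf Lg uf; have [c1 c2] := inner_cvgl Lu Lf Lg uf; split.
- by under eq_fun do rewrite innerJ ReJ; rewrite innerJ ReJ.
- under eq_fun do rewrite innerJ ImJ; rewrite innerJ ImJ; exact: cvgN.
Qed.

End inner_product.

(** * Completeness *)

Section riesz_fischer.
Context {R : realType}.
Notation mu := (@lebesgue_measure R).
Implicit Types (f g : R -> R[i]) (u v : nat -> R -> R[i]).

Lemma ae_lt_pinfty (S : R -> \bar R) : measurable_fun setT S ->
  (forall x, (0 <= S x)%E) -> (\int[mu]_x S x < +oo)%E ->
  {ae mu, forall x, (S x < +oo)%E}.
Proof.
move=> mS S0 Sfin.
have Si : mu.-integrable setT S.
  by apply/integrableP; split => //; under eq_integral do rewrite gee0_abs//.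
have := integrable_ae measurableT Si; apply: filterS => x /(_ I).
by rewrite ge0_fin_numE.
Qed.

Lemma half_series_le (n : nat) : \sum_(0 <= k < n) (2^-1 : R) ^+ k <= 2.
Proof.
suff -> : \sum_(0 <= k < n) (2^-1 : R) ^+ k = 2 - 2 * 2^-1 ^+ n.
  by rewrite gerBl mulr_ge0// exprn_ge0.
elim: n => [|n IH]; first by rewrite big_geq// expr0 mulr1 subrr.
by rewrite big_nat_recr//= IH exprS; field.
Qed.

Lemma geometric_increments_cvg (w : nat -> R) (M : R) :
  (forall k, `|w k.+1 - w k| <= M * 2^-1 ^+ k) -> cvgn w.
Proof.
move=> wM.
have cs : cvgn (series (telescope w)).
  apply: normed_cvg; apply: (series_le_cvg (v_ := geometric M 2^-1)).
  - by move=> n /=.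
  - by move=> n /=; apply: le_trans (wM n); rewrite normr_ge0.
  - by move=> n; exact: wM.
  - apply: is_cvg_geometric_series; rewrite ger0_norm// invf_lt1//.
    by rewrite ltr1n.
have -> : w = (fun n => w 0%N + series (telescope w) n).
  by apply/funext => n; rewrite -eq_sum_telescope.
by apply: is_cvgD => //; exact: is_cvg_cst.
Qed.

(** A sequence whose consecutive squared distances decay like [8^-k] converges
    almost everywhere: the series of the squared increments with the weights
    [4^k] has a finite integral, so that almost everywhere the increments
    decay like [2^-k]. *)
Lemma L2_fast_cauchy_ae v : (forall k, L2 (v k)) ->
  (forall k, nrm2 (fun t => v k.+1 t - v k t) <= 8^-1 ^+ k) ->
  exists2 g, cmeasurable g & {ae mu, forall t, ccvg (v ^~ t) (g t)}.
Proof.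
move=> Lv vk.
have Ld k : L2 (fun t => v k.+1 t - v k t) by exact: (L2B _ _).1.
pose D k t : R := 4 ^+ k * normc (v k.+1 t - v k t) ^+ 2.
have D0 k t : 0 <= D k t by rewrite mulr_ge0 ?sqr_ge0 ?exprn_ge0.
have mD k : measurable_fun setT (EFin \o D k).
  apply/measurable_EFinP; apply: measurable_funM => //.
  by apply: measurable_nrmc_sqr; exact: L2_measurable.
pose S t := (\sum_(0 <= k <oo) (D k t)%:E)%E.
have mS : measurable_fun setT S.
  have -> : S = (fun t => \sum_(0 <= k <oo | k \in xpredT) (EFin \o D k) t)%E by [].
  by apply: ge0_emeasurable_sum => // k t _ _; exact: D0.
have Sfin : (\int[mu]_t S t < +oo)%E.
  rewrite integral_nneseries//; last by move=> k t _; rewrite lee_fin.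
  apply: (@le_lt_trans _ _ 2%:E); last exact: ltry.
  apply: lime_le.
    apply: is_cvg_nneseries => k _ _; apply: integral_ge0 => t _.
    by rewrite lee_fin.
  apply: nearW => n.
  apply: (@le_trans _ _ (\sum_(0 <= k < n) (2^-1 ^+ k)%:E)%E); last first.
    by rewrite sumEFin lee_fin half_series_le.
  apply: lee_sum => k _; rewrite /D.
  under eq_integral do rewrite EFinM.
  rewrite ge0_integralZl_EFin//; last 2 first.
  - by move=> t _; rewrite lee_fin sqr_ge0.
  - by apply/measurable_EFinP; apply: measurable_nrmc_sqr; exact: L2_measurable.
  rewrite nrm2E// -EFinM lee_fin.
  apply: le_trans (ler_wpM2l _ (vk k)) _; first by rewrite exprn_ge0.
  by rewrite -exprMn (_ : 4 * 8^-1 = 2^-1 :> R)//; field.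
have aeS := ae_lt_pinfty mS
  (fun t => nneseries_ge0 (fun k _ _ => D0 k t : (0 <= (D k t)%:E)%E)) Sfin.
pose lr (p : R[i] -> R) t := fine (limn_esup (fun k => (p (v k t))%:E)).
exists (fun t => lr (@complex.Re R) t +i* lr (@complex.Im R) t).
  split => /=; apply: measurableT_comp (fine_measurable measurableT) _ ;
    apply: measurable_fun_limn_esup => k; apply/measurable_EFinP.
  - exact: (L2_measurable (Lv k)).1.
  - exact: (L2_measurable (Lv k)).2.
apply: filterS aeS => t St.
have [M M0 HM] : exists2 M : R, 0 <= M & forall k, D k t <= M.
  exists (fine (S t)) => [|k].
    by rewrite fine_ge0//; apply: nneseries_ge0 => k _ _; rewrite lee_fin.
  rewrite -lee_fin fineK; last first.
    by rewrite ge0_fin_numE//; apply: nneseries_ge0 => ? _ _; rewrite lee_fin.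
  apply: le_trans (nneseries_lim_ge k.+1 _); last first.
    by move=> ? _ _; rewrite lee_fin.
  rewrite big_nat_recr//= leeDr// sume_ge0// => ? _; by rewrite lee_fin.
have vM k : normc (v k.+1 t - v k t) <= Num.sqrt M * 2^-1 ^+ k.
  have : 4 ^+ k * normc (v k.+1 t - v k t) ^+ 2 <= M by exact: HM.
  move=> h; rewrite -(ler_pM2l (x := 2 ^+ k)) ?exprn_gt0//.
  rewrite mulrCA -exprMn mulfV// expr1n mulr1.
  rewrite -[leLHS]ger0_norm ?mulr_ge0 ?exprn_ge0 ?nrmc_ge0//.
  rewrite -sqrtr_sqr ler_wsqrtr// exprMn -exprM mulnC exprM.
  by rewrite (_ : 2 ^+ 2 = 4 :> R)// -natrX.
have lrP (p : R[i] -> R) : cvgn (fun k => p (v k t)) ->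
    (fun k => p (v k t)) @ \oo --> lr p t.
  move=> /cvg_ex[l vl]; rewrite /lr.
  have vE : (fun k => (p (v k t))%:E) @ \oo --> l%:E.
    by apply: cvg_EFin => //; exact: nearW.
  by rewrite (cvg_limn_einf_sup vE).2.
split => /=; apply: lrP; apply: geometric_increments_cvg => k.
- by apply: le_trans (vM k); rewrite -ReN -ReD Re_le_nrmc.
- by apply: le_trans (vM k); rewrite -ImN -ImD Im_le_nrmc.
Qed.

Lemma ccvg_nrmc_sqr (w : nat -> R[i]) (l z : R[i]) : ccvg w l ->
  (fun k => normc (z - w k) ^+ 2) @ \oo --> normc (z - l) ^+ 2.
Proof.
move=> [w1 w2]; under eq_fun do rewrite nrmc_sqr ReD ImD ReN ImN.
rewrite nrmc_sqr ReD ImD ReN ImN.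
by apply: cvgD; rewrite !expr2; apply: cvgM; apply: cvgB => //; exact: cvg_cst.
Qed.

(** A subsequence with rapidly decaying distances has a pointwise limit, and
    Fatou's lemma along it transfers the Cauchy estimate of the whole sequence
    to that limit. *)
Theorem riesz_fischer u : (forall n, L2 (u n)) ->
  (forall e : R, 0 < e -> exists N, forall m n, (N <= m)%N -> (N <= n)%N ->
     nrm2 (fun t => u m t - u n t) <= e) ->
  exists2 g, L2 g & (fun n => nrm2 (fun t => u n t - g t)) @ \oo --> (0 : R).
Proof.
move=> Lu uC.
have /choice[N HN] : forall k : nat, exists N, forall m n, (N <= m)%N -> (N <= n)%N ->
    nrm2 (fun t => u m t - u n t) <= 8^-1 ^+ k.
  by move=> k; apply: uC; rewrite exprn_gt0.
(* the partial sums are monotone, and the successors make them unbounded *)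
pose s k := (\sum_(i < k.+1) (N i).+1)%N.
have sk k : (k <= s k)%N.
  by elim: k => // k IH; rewrite /s big_ord_recr/= addnS ltnS (leq_trans IH)// leq_addr.
have sN k : (N k <= s k)%N by rewrite /s big_ord_recr/= (leq_trans (leqnSn _))// leq_addl.
have sS k : (s k <= s k.+1)%N by rewrite {2}/s big_ord_recr/= leq_addr.
have shomo : {homo s : x y / (x <= y)%N}.
  by apply: homo_leq => //; exact: leq_trans.
have [] := @L2_fast_cauchy_ae (fun k => u (s k)) => [k|k|g mg vg].
- exact: Lu.
- by apply: HN; rewrite ?sN// (leq_trans (sN k)).
have key e : 0 < e -> exists n0, forall n, (n0 <= n)%N ->
    (\int[mu]_t (normc (u n t - g t) ^+ 2)%:E <= e%:E)%E.
  move=> e0; have [n0 Hn0] := uC e e0; exists n0 => n n0n.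
  apply: (@le_trans _ _ (\int[mu]_t
     limn_einf (fun k => (normc (u n t - u (s k) t) ^+ 2)%:E))%E).
    apply: ae_ge0_le_integral => //.
    - by move=> t _; rewrite lee_fin sqr_ge0.
    - apply/measurable_EFinP; apply: measurable_nrmc_sqr.
      by apply: cmeasurableB => //; exact: L2_measurable.
    - move=> t _; rewrite limn_einf_lim; apply: lime_ge.
        exact: is_cvg_einfs.
      apply: nearW => m; apply: le_ereal_inf_tmp => _ [k _ <-].
      by rewrite lee_fin sqr_ge0.
    - rewrite /limn_einf.
      apply: measurableT_comp => //; apply: measurable_fun_limn_esup => k.
      apply: measurableT_comp => //.
      apply/measurable_EFinP; apply: measurable_nrmc_sqr.
      by apply: cmeasurableB; exact: L2_measurable.
    - apply: filterS vg => t vt _.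
      have cv := ccvg_nrmc_sqr (z := u n t) vt.
      have : (fun k => (normc (u n t - u (s k) t) ^+ 2)%:E) @ \oo -->
             (normc (u n t - g t) ^+ 2)%:E.
        by apply: cvg_EFin => //; exact: nearW.
      by move=> /cvg_limn_einf_sup[-> _].
  apply: le_trans (fatou _ _ _ _) _ => //.
  - move=> k; apply/measurable_EFinP; apply: measurable_nrmc_sqr.
    by apply: cmeasurableB; exact: L2_measurable.
  - by move=> k t _; rewrite lee_fin sqr_ge0.
  rewrite limn_einf_lim; apply: lime_le; first exact: is_cvg_einfs.
  exists n0 => // m /= n0m; apply: ge_ereal_inf.
  exists (\int[mu]_t (normc (u n t - u (s m) t) ^+ 2)%:E)%E.
    by exists m => /=.
  rewrite nrm2E; first by rewrite lee_fin Hn0// (leq_trans n0m).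
  exact: (L2B _ _).1.
have Lg : L2 g.
  have [n0 /(_ n0 (leqnn _)) Hn0] := key 1 ltr01.
  have [] := @L2D R (fun t => - (u n0 t - g t)) (u n0).
  - apply: L2N; apply/L2P; split; last exact: (le_lt_trans Hn0 (ltry _)).
    by apply: cmeasurableB => //; exact: L2_measurable.
  - exact: Lu.
  by under eq_fun do rewrite opprB subrK.
exists g => //; apply/cvgrPdist_le => e e0.
have [n0 Hn0] := key e e0; exists n0 => // n /= n0n.
rewrite sub0r normrN ger0_norm ?nrm2_ge0// -lee_fin -nrm2E ?Hn0//.
exact: (L2B _ _).1.
Qed.

End riesz_fischer.

(** * Affine substitutions *)

Section affine_change_of_variables.
Context {R : realType}.
Notation mu := (@lebesgue_measure R).

Lemma measurable_affine (a b : R) :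
  measurable_fun setT (fun x : measurableTypeR R => a * x + b : measurableTypeR R).
Proof. by apply: measurable_funD => //; exact: measurable_funM. Qed.

(** Uniqueness of the Lebesgue measure: the rescaled image measure gives
    half-open intervals their length. *)
Lemma lebesgue_measure_affine (a b : R) (A : set R) : a != 0 -> measurable A ->
  (`|a|%:E * mu [set x | A (a * x + b)%R])%E = mu A.
Proof.
move=> a0 mA.
have an0 : 0 <= `|a| by [].
pose phi := (fun x : measurableTypeR R => a * x + b : measurableTypeR R).
have mphi : measurable_fun setT phi := measurable_affine a b.
pose m' := (mscale (NngNum an0) (pushforward (@lebesgue_measure R) phi)
  : {measure set (measurableTypeR R) -> \bar R}).
pose m := m' mphi.
transitivity (m A); first by [].
apply/esym; apply: (lebesgue_measure_unique (mu := m)) => //= _ [[c d]] _ <-.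
rewrite /m /m' /mscale /= /pushforward.
have [a_gt0|a_le0] := ltP 0 a.
  have -> : phi @^-1` [set` `]c, d]] = [set` `](c - b) / a, (d - b) / a]].
    apply/seteqP; split=> x; rewrite /phi /= !in_itv /=.
      by rewrite ltr_pdivrMr// ler_pdivlMr// ltrBlDr lerBrDr mulrC.
    by rewrite ltr_pdivrMr// ler_pdivlMr// ltrBlDr lerBrDr mulrC.
  rewrite !lebesgue_measure_itv/= !lte_fin ltr_pM2r ?invr_gt0// ltrD2r.
  case: ifPn => cd; last by rewrite mule0.
  by rewrite -!EFinD -EFinM gtr0_norm//; congr EFin; field.
have {a_le0}a_lt0 : a < 0 by rewrite lt_neqAle a0.
have -> : phi @^-1` [set` `]c, d]] = [set` `[(d - b) / a, (c - b) / a[].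
  apply/seteqP; split=> x; rewrite /phi /= !in_itv /=.
    by rewrite ltr_ndivlMr// ler_ndivrMr// ltrBlDr lerBrDr mulrC andbC.
  by rewrite ltr_ndivlMr// ler_ndivrMr// ltrBlDr lerBrDr mulrC andbC.
rewrite !lebesgue_measure_itv/= !lte_fin ltr_nM2r ?invr_lt0// ltrD2r.
case: ifPn => cd; last by rewrite mule0.
by rewrite -!EFinD -EFinM ltr0_norm//; congr EFin; field.
Qed.

Lemma ge0_integral_affine (a b : R) (f : R -> \bar R) : a != 0 ->
  measurable_fun setT f -> (forall x, 0 <= f x)%E ->
  (\int[mu]_x f x = `|a|%:E * \int[mu]_x f (a * x + b)%R)%E.
Proof.
move=> a0 mf f0.
have an0 : 0 <= `|a| by [].
pose phi := (fun x : measurableTypeR R => a * x + b : measurableTypeR R).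
have mphi : measurable_fun setT phi := measurable_affine a b.
pose m' := (mscale (NngNum an0) (pushforward (@lebesgue_measure R) phi)
  : {measure set (measurableTypeR R) -> \bar R}).
pose m := m' mphi.
transitivity (\int[m]_x f x)%E.
  apply: eq_measure_integral => A mA _; apply/esym.
  exact: lebesgue_measure_affine.
rewrite ge0_integral_mscale//; congr (_ * _)%E.
by rewrite ge0_integral_pushforward.
Qed.

Lemma Rintegral_affine (a b : R) (f : R -> R) : a != 0 ->
  measurable_fun setT f ->
  Rintegral mu setT f = `|a| * Rintegral mu setT (fun x => f (a * x + b)).
Proof.
move=> a0 mf; rewrite /Rintegral integralE [in RHS]integralE.
have mE : measurable_fun setT (EFin \o f) by apply/measurable_EFinP.
rewrite (ge0_integral_affine b a0 (measurable_funepos mE))//.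
rewrite (ge0_integral_affine b a0 (measurable_funeneg mE))//.
set x := integral _ _ _; set y := integral _ _ _.
rewrite (_ : integral _ _ _ = x)//; last first.
  by apply: eq_integral => t _; rewrite !funeposE.
rewrite (_ : integral _ _ _ = y)//; last first.
  by apply: eq_integral => t _; rewrite !funenegE.
have x0 : (0 <= x)%E by apply: integral_ge0.
have y0 : (0 <= y)%E by apply: integral_ge0.
have a_gt0 : 0 < `|a| by rewrite normr_gt0.
move: x y x0 y0 => [x| |] [y| |] //= _ _; rewrite ?gt0_muley ?lte_fin//= ?mulr0//.
by rewrite mulrBr.
Qed.

Lemma cintegral_affine (a b : R) (f : R -> R[i]) : a != 0 -> cmeasurable f ->
  cintegral mu f = `|a|%:C * cintegral mu (fun x => f (a * x + b)).
Proof.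
move=> a0 [f1 f2]; apply: complex_ext; rewrite ?ReM ?ImM /=.
- by rewrite (Rintegral_affine b a0 f1) mul0r subr0.
- by rewrite (Rintegral_affine b a0 f2) mul0r addr0.
Qed.

Lemma cmeasurable_affine (a b : R) (f : R -> R[i]) : cmeasurable f ->
  cmeasurable (fun x => f (a * x + b)).
Proof. by move=> mf; apply: cmeasurable_comp => //; exact: measurable_affine. Qed.

Lemma cintegrable_affine (a b : R) (f : R -> R[i]) : a != 0 ->
  cintegrable mu f -> cintegrable mu (fun x => f (a * x + b)).
Proof.
move=> a0 /cintegrableP[mf fi]; apply/cintegrableP; split.
  exact: cmeasurable_affine.
have mn : measurable_fun [set: R] (fun x => (normc (f x))%:E).
  by apply/measurable_EFinP; exact: measurable_nrmc.
move: fi; rewrite (ge0_integral_affine b a0 mn); last first.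
  by move=> x; rewrite lee_fin nrmc_ge0.
set I := integral _ _ _.
have I0 : (0 <= I)%E by apply: integral_ge0 => x _; rewrite lee_fin nrmc_ge0.
have : 0 < `|a| by rewrite normr_gt0.
by case: I I0 => [I| |] // _ h; [move=> _; exact: ltry|rewrite gt0_muley ?lte_fin].
Qed.

Lemma L2_affine (a b : R) (f : R -> R[i]) : a != 0 -> L2 f ->
  L2 (fun x => f (a * x + b)) /\
  nrm2 f = `|a| * nrm2 (fun x => f (a * x + b)).
Proof.
move=> a0 /L2P[mf fi].
have mn : measurable_fun [set: R] (fun x => (normc (f x) ^+ 2)%:E).
  by apply/measurable_EFinP; exact: measurable_nrmc_sqr.
split; last first.
  rewrite /nrm2 (@Rintegral_affine a b)//.
  exact: measurable_nrmc_sqr.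
apply/L2P; split; first exact: cmeasurable_affine.
move: fi; rewrite (ge0_integral_affine b a0 mn); last first.
  by move=> x; rewrite lee_fin sqr_ge0.
set I := integral _ _ _.
have I0 : (0 <= I)%E by apply: integral_ge0 => x _; rewrite lee_fin sqr_ge0.
have : 0 < `|a| by rewrite normr_gt0.
by case: I I0 => [I| |] // _ h; [move=> _; exact: ltry|rewrite gt0_muley ?lte_fin].
Qed.

End affine_change_of_variables.

(** * The Fourier integral of an integrable function *)

Section fourier_integral.
Context {R : realType}.
Notation mu := (@lebesgue_measure R).
Implicit Types (f g : R -> R[i]).

Lemma cintegrable_expi f (h : R -> R) : cintegrable mu f ->
  measurable_fun setT h -> cintegrable mu (fun t => f t * expi (h t)).
Proof.
move=> fi mh; apply: (le_cintegrable _ fi).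
  apply: cmeasurableM; first exact: cintegrable_measurable fi.
  exact: cmeasurable_expi.
by move=> t; rewrite normcM nrmc_expi mulr1.
Qed.

Lemma measurable_phase (xi : R) :
  measurable_fun setT (fun t : R => - (2 * pi * t * xi)).
Proof.
by apply: measurableT_comp => //; apply: measurable_funM.
Qed.

Lemma fourier_integrable f (xi : R) : cintegrable mu f ->
  cintegrable mu (fun t => f t * expi (- (2 * pi * t * xi))).
Proof. by move=> fi; apply: cintegrable_expi => //; exact: measurable_phase. Qed.

Lemma measurable_phase2 :
  measurable_fun setT (fun z : R * R => - (2 * pi * z.1 * z.2)).
Proof.
apply: measurableT_comp => //; apply: measurable_funM => //.
exact: measurable_funM.
Qed.

Lemma cmeasurable_fourier f : cmeasurable f -> cmeasurable (fourier f).
Proof.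
move=> mf.
apply: (@cmeasurable_cintegral_param _ _ _ _ _ (@lebesgue_measure R) (fun z : R * R =>
  f z.2 * expi (- (2 * pi * z.2 * z.1)))).
apply: cmeasurableM; first exact: (cmeasurable_comp mf).
apply: cmeasurable_expi; apply: measurableT_comp => //.
by apply: measurable_funM => //; exact: measurable_funM.
Qed.

Definition nrm1 f := Rintegral mu setT (fun t => normc (f t)).

Lemma fourier_bounded f (xi : R) : cintegrable mu f ->
  normc (fourier f xi) <= nrm1 f.
Proof.
move=> fi; have := nrmc_cintegral_le (fourier_integrable xi fi).
by under eq_Rintegral do rewrite normcM nrmc_expi mulr1.
Qed.

Lemma fourierB f g (xi : R) : cintegrable mu f -> cintegrable mu g ->
  fourier (fun t => f t - g t) xi = fourier f xi - fourier g xi.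
Proof.
move=> fi gi; rewrite /fourier -cintegralB; [|exact: fourier_integrable..].
by apply: eq_cintegral => t; rewrite mulrBl.
Qed.

(** The inverse transform, obtained from the direct one by conjugation on both
    sides. *)
Definition ifourier g (x : R) : R[i] := conjc (fourier (fun t => conjc (g t)) x).

Lemma ifourierE g (x : R) :
  ifourier g x = cintegral mu (fun t => g t * expi (2 * pi * t * x)).
Proof.
rewrite /ifourier /fourier -cintegralJ; apply: eq_cintegral => t.
by rewrite conjcM conjcK conj_expi opprK.
Qed.

(** The factor [k] stands for the unimodular phases that Fubini is applied to.
    *)
Lemma cintegrable_prod f g (k : R * R -> R[i]) : cintegrable mu f ->
  cintegrable mu g -> cmeasurable k -> (forall z, normc (k z) <= 1) ->
  cintegrable (mu \x mu)%E (fun z : R * R => f z.1 * k z * g z.2).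
Proof.
move=> /cintegrableP[mf fi] /cintegrableP[mg gi] mk k1.
have mtensor : cmeasurable (fun z : R * R => f z.1 * g z.2).
  by apply: cmeasurableM; [exact: (cmeasurable_comp mf)|exact: (cmeasurable_comp mg)].
have If0 : (0 <= \int[mu]_x (normc (f x))%:E)%E.
  by apply: integral_ge0 => x _; rewrite lee_fin nrmc_ge0.
have Ig0 : (0 <= \int[mu]_x (normc (g x))%:E)%E.
  by apply: integral_ge0 => x _; rewrite lee_fin nrmc_ge0.
have tensor : cintegrable (mu \x mu)%E (fun z : R * R => f z.1 * g z.2).
  apply: cintegrable_prod12 => //=.
  rewrite (_ : integral _ _ _ = \int[mu]_x ((normc (f x))%:E *
      \int[mu]_y (normc (g y))%:E))%E; last first.
    apply: eq_integral => x _.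
    rewrite -ge0_integralZl_EFin ?nrmc_ge0//.
    - by apply: eq_integral => y _; rewrite normcM EFinM.
    - by move=> y _; rewrite lee_fin nrmc_ge0.
    - by apply/measurable_EFinP; exact: measurable_nrmc.
  rewrite ge0_integralZr//.
  - by rewrite lte_mul_pinfty// ge0_fin_numE.
  - by apply/measurable_EFinP; exact: measurable_nrmc.
  - by move=> x _; rewrite lee_fin nrmc_ge0.
apply: (le_cintegrable _ tensor).
  apply: cmeasurableM; last exact: (cmeasurable_comp mg).
  by apply: cmeasurableM => //; exact: (cmeasurable_comp mf).
move=> z; rewrite !normcM mulrAC ler_piMr//.
by rewrite mulr_ge0 ?nrmc_ge0.
Qed.

(** Fubini lets the phase change sides. *)
Lemma fourier_adjoint_L1 f g : cintegrable mu f -> cintegrable mu g ->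
  inner (fourier f) g = inner f (ifourier g).
Proof.
move=> fi gi.
have Gi := cintegrableJ gi.
have Hi : cintegrable (mu \x mu)%E (fun z : R * R =>
    f z.1 * expi (- (2 * pi * z.1 * z.2)) * conjc (g z.2)).
  apply: (@cintegrable_prod f (fun t => conjc (g t))) => //.
    by apply: cmeasurable_expi; exact: measurable_phase2.
  by move=> z; rewrite nrmc_expi.
transitivity (cintegral mu (fun xi => cintegral mu (fun t =>
    f t * expi (- (2 * pi * t * xi)) * conjc (g xi)))).
  apply: eq_cintegral => xi; rewrite mulrC -cintegralZ; last exact: fourier_integrable.
  by apply: eq_cintegral => t; rewrite mulrC.
rewrite -(cfubini Hi) /=; apply: eq_cintegral => t.
rewrite /ifourier conjcK -cintegralZ; last exact: fourier_integrable.
by apply: eq_cintegral => xi; rewrite -mulrA (mulrC (expi _)) (mulrAC (2 * pi)).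
Qed.

(** One substitution [t = x + beta s] gives the transform of a whole
    time-frequency atom. *)
Lemma fourier_atom (alpha : R) f (x w xi : R) : cintegrable mu f ->
  fourier (atom alpha f x w) xi =
  expi (- (2 * pi * x * xi)) * (Num.sqrt (beta alpha w))%:C *
  fourier f (beta alpha w * (xi - w)).
Proof.
move=> fi; have mf := cintegrable_measurable fi.
have b0 : 0 < beta alpha w.
  by rewrite /beta powR_gt0// ltr_pwDl.
set b := beta alpha w; have bn0 : b != 0 by rewrite gt_eqF.
have sb0 : 0 < Num.sqrt b by rewrite sqrtr_gt0.
rewrite /fourier (cintegral_affine x bn0); last first.
  apply: cmeasurableM; last by apply: cmeasurable_expi; exact: measurable_phase.
  rewrite /atom /translation /modulation /dilation -/b.
  apply: cmeasurableM.
    apply: cmeasurable_expi; apply: measurable_funM => //.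
    exact: measurable_funB.
  apply: cmeasurableM; first exact: cmeasurable_cst.
  apply: (cmeasurable_comp mf); apply: measurable_funM => //.
  exact: measurable_funB.
have E s : atom alpha f x w (b * s + x) * expi (- (2 * pi * (b * s + x) * xi)) =
    ((Num.sqrt b)^-1)%:C * expi (- (2 * pi * x * xi)) *
    (f s * expi (- (2 * pi * s * (b * (xi - w))))).
  rewrite /atom /translation /modulation /dilation -/b addrK.
  rewrite (mulrC b s) mulfK//.
  have -> : expi (- (2 * pi * (s * b + x) * xi)) =
      expi (- (2 * pi * w * (s * b))) * expi (- (2 * pi * x * xi)) *
      expi (- (2 * pi * s * (b * (xi - w)))) :> R[i].
    by rewrite -!expiD; congr expi; ring.
  set p := expi (2 * pi * w * _).
  have -> : expi (- (2 * pi * w * (s * b))) = conjc p by rewrite conj_expi.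
  have pp : p * conjc p = 1 by rewrite mulzJ nrmc_expi expr1n.
  set q := expi _; set q' := expi _; set c := _%:C.
  transitivity ((p * conjc p) * (c * q * (f s * q'))); last by rewrite pp mul1r.
  by ring.
under eq_cintegral => s do rewrite E.
rewrite cintegralZ; last exact: fourier_integrable.
rewrite !mulrA -rmorphM /= [_%:C * expi _]mulrC; congr (_ * _ * _).
rewrite gtr0_norm// -{1}[b](sqr_sqrtr (ltW b0)) expr2 mulfK ?gt_eqF//.
Qed.

End fourier_integral.

(** * The Abel and Poisson kernels *)

Section abel_kernel.
Context {R : realType}.
Notation mu := (@lebesgue_measure R).

(** The summation factor of Abel: integrable for [0 < e], and increasing to
    [1] as [e] tends to [0]. *)
Definition abel (e xi : R) : R := expR (- (e * `|xi|)).

(** The Poisson kernel of the half-plane at height [e / (2 * pi)]; the scaling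
    is the one in which it is the Fourier transform of [abel e]. *)
Definition poisson (e u : R) : R := 2 * e / (e ^+ 2 + (2 * pi * u) ^+ 2).

Lemma abel_ge0 e xi : 0 <= abel e xi. Proof. exact: expR_ge0. Qed.

Lemma continuous_abel e : continuous (abel e).
Proof.
move=> x; apply: continuous_comp; last exact: continuous_expR.
apply: cvgN; apply: cvgM; first exact: cvg_cst.
exact: norm_continuous.
Qed.

Lemma measurable_abel e : measurable_fun setT (abel e).
Proof. by apply: continuous_measurable_fun; exact: continuous_abel. Qed.

Lemma cvg_expRN_y (e : R) : 0 < e -> expR (- (e * x)) @[x --> +oo] --> (0 : R).
Proof.
move=> e0; apply: (cvg_comp (fun x : R => e * x) (fun y => expR (- y)));
  last exact: cvgr_expR.
by apply: gt0_cvgMry => //; exact: cvg_id.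
Qed.

(** The primitive of [expR (- (e * x)) * (1 + cos (c * x))] obtained from two
    integrations by parts. *)
Definition abel_primitive (e c x : R) : R :=
  expR (- (e * x)) * (- e^-1 + (c * sin (c * x) - e * cos (c * x)) / (e ^+ 2 + c ^+ 2)).

Lemma is_derive_abel_primitive (e c x : R) : 0 < e ->
  is_derive x 1 (abel_primitive e c) (expR (- (e * x)) * (1 + cos (c * x))).
Proof.
move=> e0.
have d0 : e ^+ 2 + c ^+ 2 != 0 by rewrite gt_eqF// ltr_pwDl ?exprn_gt0 ?sqr_ge0.
rewrite /abel_primitive; apply: is_derive_eq.
by rewrite /GRing.scale /=; field; rewrite d0 gt_eqF.
Qed.

Lemma cvg_abel_primitive (e c : R) : 0 < e -> abel_primitive e c x @[x --> +oo] --> (0 : R).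
Proof.
move=> e0.
have d0 : 0 < e ^+ 2 + c ^+ 2 by rewrite ltr_pwDl ?exprn_gt0 ?sqr_ge0.
pose M := e^-1 + (`|c| + e) / (e ^+ 2 + c ^+ 2).
have HM x : `|abel_primitive e c x| <= expR (- (e * x)) * M.
  rewrite /abel_primitive normrM ger0_norm ?expR_ge0// ler_wpM2l ?expR_ge0//.
  apply: le_trans (ler_normD _ _) _; rewrite normrN gtr0_norm ?invr_gt0//.
  rewrite lerD2l normrM (gtr0_norm (x := _^-1)) ?invr_gt0//.
  rewrite ler_pM2r ?invr_gt0//; apply: le_trans (ler_normB _ _) _.
  rewrite !normrM (gtr0_norm e0) lerD//.
    by rewrite ler_piMr// ler_norml sin_geN1 sin_le1.
  by rewrite ler_piMr// ?(ltW e0)// ler_norml cos_geN1 cos_le1.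
have EM : expR (- (e * x)) * M @[x --> +oo] --> (0 : R).
  rewrite -[X in _ --> X](mul0r M); apply: cvgM; last exact: cvg_cst.
  exact: cvg_expRN_y.
apply: (@squeeze_cvgr _ _ _ _ (fun x => - (expR (- (e * x)) * M))
  (fun x => expR (- (e * x)) * M)) => //.
  by apply: nearW => x; rewrite -ler_norml.
by rewrite -[X in _ --> X]oppr0; apply: cvgN.
Qed.

Definition half_abel_cos (e c x : R) := expR (- (e * x)) * (1 + cos (c * x)).

Lemma half_abel_cos_ge0 e c x : 0 <= half_abel_cos e c x.
Proof.
rewrite mulr_ge0 ?expR_ge0//; have := cos_geN1 (c * x); lra.
Qed.

Lemma continuous_mul (c : R) : continuous (fun x : R => c * x).
Proof. by move=> x; apply: cvgM; [exact: cvg_cst|exact: cvg_id]. Qed.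

Lemma continuous_1cos (c : R) : continuous (fun x => 1 + cos (c * x) : R).
Proof.
move=> x; apply: cvgD; first exact: cvg_cst.
by apply: continuous_comp; [exact: continuous_mul|exact: continuous_cos].
Qed.

Lemma integral_half_abel_cos e c : 0 < e ->
  (\int[mu]_(x in `[0%R, +oo[) (half_abel_cos e c x)%:E = (e^-1 + e / (e ^+ 2 + c ^+ 2))%:E)%E.
Proof.
move=> e0; have dF x := is_derive_abel_primitive c x e0.
have cF x : {for x, continuous (abel_primitive e c)}.
  by apply: differentiable_continuous; apply/derivable1_diffP; case: (dF x).
rewrite (ge0_continuous_FTC2y (F := abel_primitive e c) (l := 0)).
- rewrite /abel_primitive mulr0 oppr0 expR0 mul1r mulr0 sin0 cos0 mulr0 mulr1 sub0r.
  by rewrite -EFinB; congr EFin; rewrite sub0r mulNr opprD !opprK.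
- by move=> x _; exact: half_abel_cos_ge0.
- apply: continuous_subspaceT => x; apply: cvgM; last exact: continuous_1cos.
  apply: continuous_comp; last exact: continuous_expR.
  by apply: cvgN; exact: continuous_mul.
- exact: cvg_abel_primitive.
- by move=> x _; case: (dF x).
- exact/cvg_at_right_filter/cF.
- by move=> x _; rewrite derive1E; case: (dF x).
Qed.

(** Adding [1] to the cosine makes the integrand nonnegative, as the
    fundamental theorem of calculus on a half-line requires; the additional
    term is [abel e] itself, the case [c = 0] up to a factor. *)
Definition abel_1cos (e c x : R) := abel e x * (1 + cos (c * x)).

Lemma abel_cos_ge0 e c x : 0 <= abel_1cos e c x.
Proof.
rewrite mulr_ge0 ?expR_ge0//; have := cos_geN1 (c * x); lra.
Qed.

Lemma continuous_abel_cos e c : continuous (abel_1cos e c).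
Proof.
by move=> x; apply: cvgM; [exact: continuous_abel|exact: continuous_1cos].
Qed.

Lemma integral_abel_cos e c : 0 < e ->
  (\int[mu]_x (abel_1cos e c x)%:E = (2 * (e^-1 + e / (e ^+ 2 + c ^+ 2)))%:E)%E.
Proof.
move=> e0; rewrite (ge0_symfun_integralT (abel_cos_ge0 e c) (@continuous_abel_cos e c)); last first.
  by move=> x; rewrite /abel_1cos /abel /= normrN mulrN cosN.
rewrite -set_itvcy EFinM -(integral_half_abel_cos c e0); congr (_ * _)%E.
apply: eq_integral => x; rewrite inE /= in_itv /= andbT => x0.
by rewrite /abel_1cos /abel ger0_norm.
Qed.

Lemma integrable_abel_cos e c : 0 < e -> mu.-integrable setT (EFin \o abel_1cos e c).
Proof.
move=> e0; apply/integrableP; split.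
  by apply/measurable_EFinP; apply: continuous_measurable_fun; exact: continuous_abel_cos.
under eq_integral do rewrite /= ger0_norm ?abel_cos_ge0//.
by rewrite integral_abel_cos// ltry.
Qed.

Lemma abelE e x : abel e x = 2^-1 * abel_1cos e 0 x.
Proof. by rewrite /abel_1cos mul0r cos0; field. Qed.

Lemma integrable_abel e : 0 < e -> mu.-integrable setT (EFin \o abel e).
Proof.
move=> e0; rewrite (_ : EFin \o abel e = (fun x => (2^-1)%:E * (EFin \o abel_1cos e 0) x)%E).
  by apply: integrableZl => //; exact: integrable_abel_cos.
by apply/funext => x; rewrite /= -EFinM -abelE.
Qed.

Lemma Rintegral_abel_1cos e c : 0 < e ->
  Rintegral mu setT (abel_1cos e c) = 2 * (e^-1 + e / (e ^+ 2 + c ^+ 2)).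
Proof. by move=> e0; rewrite /Rintegral integral_abel_cos. Qed.

Lemma Rintegral_abel e : 0 < e -> Rintegral mu setT (abel e) = 2 / e.
Proof.
move=> e0; rewrite (_ : abel e = fun x => 2^-1 * abel_1cos e 0 x); last first.
  by apply/funext => x; exact: abelE.
rewrite RintegralZl//; last exact: integrable_abel_cos.
by rewrite Rintegral_abel_1cos// expr0n/= addr0; field; rewrite gt_eqF.
Qed.

Lemma integrable_abel_mul e (h : R -> R) : 0 < e -> measurable_fun setT h ->
  (forall x, `|h x| <= 1) ->
  mu.-integrable setT (fun x => (abel e x * h x)%:E).
Proof.
move=> e0 mh h1; apply: le_integrable (integrable_abel e0) => //.
  by apply/measurable_EFinP; apply: measurable_funM => //; exact: measurable_abel.
move=> x _; rewrite /= lee_fin normrM (ger0_norm (abel_ge0 _ _)).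
by rewrite ler_piMr ?abel_ge0.
Qed.

Lemma measurable_cosc (c : R) : measurable_fun setT (fun x => cos (c * x)).
Proof.
apply: continuous_measurable_fun => x.
by apply: continuous_comp; [exact: continuous_mul|exact: continuous_cos].
Qed.

Lemma measurable_sinc (c : R) : measurable_fun setT (fun x => sin (c * x)).
Proof.
apply: continuous_measurable_fun => x.
by apply: continuous_comp; [exact: continuous_mul|exact: continuous_sin].
Qed.

Lemma Rintegral_abel_cos e c : 0 < e ->
  Rintegral mu setT (fun x => abel e x * cos (c * x)) = 2 * e / (e ^+ 2 + c ^+ 2).
Proof.
move=> e0; have := Rintegral_abel_1cos c e0.
rewrite (_ : abel_1cos e c = fun x => abel e x + abel e x * cos (c * x)); last first.
  by apply/funext => x; rewrite /abel_1cos mulrDr mulr1.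
rewrite RintegralD//; last 2 first.
- exact: integrable_abel.
- apply: integrable_abel_mul => //; first exact: measurable_cosc.
  by move=> x; rewrite ler_norml cos_geN1 cos_le1.
rewrite Rintegral_abel// mulrDr => /addrI ->; by rewrite mulrA.
Qed.

Lemma Rintegral_abel_sin e c : 0 < e ->
  Rintegral mu setT (fun x => abel e x * sin (c * x)) = 0.
Proof.
move=> e0; set I := Rintegral _ _ _.
have si : mu.-integrable setT (fun x => (abel e x * sin (c * x))%:E).
  apply: integrable_abel_mul => //; first exact: measurable_sinc.
  by move=> x; rewrite ler_norml sin_geN1 sin_le1.
(* the substitution [x := - x] *)
suff : I = - I by lra.
rewrite {1}/I (@Rintegral_affine R (-1) 0) ?oppr_eq0//; last first.
  by apply: measurable_funM; [exact: measurable_abel|exact: measurable_sinc].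
rewrite normrN normr1 mul1r.
under eq_Rintegral do rewrite /abel addr0 mulN1r normrN mulrN sinN mulrN -mulN1r.
by rewrite RintegralZl// mulN1r.
Qed.

Lemma cintegrable_abel e : 0 < e -> cintegrable mu (fun t => (abel e t)%:C).
Proof.
move=> e0; split => /=; first exact: integrable_abel.
exact: integrable0.
Qed.

(** The Fourier transform of the two-sided exponential is the Poisson kernel of
    the half-plane. *)
Lemma abel_transform e u : 0 < e ->
  cintegral mu (fun t => (abel e t)%:C * expi (2 * pi * t * u)) = (poisson e u)%:C.
Proof.
move=> e0; apply: complex_ext => /=.
- rewrite /poisson -Rintegral_abel_cos//; apply: eq_Rintegral => t _.
  by rewrite mul0r subr0 (mulrAC (2 * pi) t).
- rewrite -[RHS](Rintegral_abel_sin (2 * pi * u) e0); apply: eq_Rintegral => t _.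
  by rewrite mul0r addr0 (mulrAC (2 * pi) t).
Qed.

Lemma poisson_ge0 e u : 0 < e -> 0 <= poisson e u.
Proof.
move=> e0; rewrite divr_ge0 ?mulr_ge0 ?addr_ge0 ?sqr_ge0//; exact: ltW.
Qed.

Lemma poisson_den_gt0 (e u : R) : 0 < e -> 0 < e ^+ 2 + (2 * pi * u) ^+ 2.
Proof. by move=> e0; rewrite ltr_pwDl ?exprn_gt0 ?sqr_ge0. Qed.

Lemma continuous_poisson e : 0 < e -> continuous (poisson e).
Proof.
move=> e0 x; apply: cvgM; first exact: cvg_cst.
apply: cvgV; first by rewrite gt_eqF ?poisson_den_gt0.
apply: cvgD; first exact: cvg_cst.
by rewrite expr2; apply: cvgM; exact: continuous_mul.
Qed.

Lemma measurable_poisson e : 0 < e -> measurable_fun setT (poisson e).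
Proof. by move=> e0; apply: continuous_measurable_fun; exact: continuous_poisson. Qed.

Definition poisson_primitive (e u : R) := atan (2 * pi * u / e) / pi.

Lemma is_derive_poisson_primitive (e u : R) : 0 < e ->
  is_derive u 1 (poisson_primitive e) (poisson e u).
Proof.
move=> e0; have := poisson_den_gt0 u e0; rewrite /poisson_primitive /poisson.
move: (pi : R) (pi_gt0 R) => p p0 D0.
apply: is_derive_eq; rewrite /GRing.scale /=; field.
by rewrite !gt_eqF//= (lt_le_trans D0)// le_eqVlt; apply/orP; left; apply/eqP; ring.
Qed.

Lemma integral_poisson e : 0 < e -> (\int[mu]_u (poisson e u)%:E = 1)%E.
Proof.
move=> e0; have dP u := is_derive_poisson_primitive u e0.
have cP x : {for x, continuous (poisson_primitive e)}.
  by apply: differentiable_continuous; apply/derivable1_diffP; case: (dP x).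
rewrite (ge0_symfun_integralT (fun x => poisson_ge0 x e0) (continuous_poisson e0)); last first.
  by move=> x; rewrite /poisson /= mulrN sqrrN.
rewrite -set_itvcy (ge0_continuous_FTC2y (F := poisson_primitive e) (l := 2^-1)).
- by rewrite /poisson_primitive mulr0 mul0r atan0 mul0r sube0 -EFinM divff.
- by move=> x _; exact: poisson_ge0.
- by apply: continuous_subspaceT; exact: continuous_poisson.
- rewrite (_ : 2^-1 = pi / 2 / pi); last first.
    by move: (pi : R) (pi_gt0 R) => p p0; field; rewrite gt_eqF.
  apply: cvgM; last exact: cvg_cst.
  apply: (cvg_comp (fun x : R => 2 * pi * x / e) atan); last exact: cvgy_atan.
  apply: gt0_cvgMly; first by rewrite invr_gt0.
  by apply: gt0_cvgMry; [rewrite mulr_gt0 ?pi_gt0|exact: cvg_id].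
- by move=> x _; case: (dP x).
- exact/cvg_at_right_filter/cP.
- by move=> x _; rewrite derive1E; case: (dP x).
Qed.

Lemma integral_poisson_shift e x : 0 < e ->
  (\int[mu]_y (poisson e (x - y))%:E = 1)%E.
Proof.
move=> e0; rewrite -(integral_poisson e0) [RHS](@ge0_integral_affine R (-1) x) ?oppr_eq0//.
- rewrite normrN normr1 mul1e; apply: eq_integral => y _.
  by rewrite mulN1r addrC.
- by apply/measurable_EFinP; exact: measurable_poisson.
- by move=> u; rewrite lee_fin poisson_ge0.
Qed.

Lemma poissonN e u : poisson e (- u) = poisson e u.
Proof. by rewrite /poisson mulrN sqrrN. Qed.

(** The Poisson means of the indicator of an interval: up to [pi], the angle
    under which the interval is seen from height [e / (2 * pi)]. *)
Definition box (e a b x : R) : R :=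
  (atan (2 * pi * (x - a) / e) - atan (2 * pi * (x - b) / e)) / pi.

(** The explicit form [box] makes the two properties needed of these means
    visible: they lie between [0] and [1], and they tend to the indicator away
    from the endpoints as [e] tends to [0]. *)
Lemma integral_poisson_itv e a b x : 0 < e -> a < b ->
  Rintegral mu `[a, b] (fun y => poisson e (x - y)) = box e a b x.
Proof.
move=> e0 ab.
have dQ (y : R) : is_derive y 1 (fun y => - poisson_primitive e (x - y)) (poisson e (x - y)).
  have := poisson_den_gt0 (x - y) e0; rewrite /poisson_primitive /poisson.
  move: (pi : R) (pi_gt0 R) => p p0 D0.
  apply: is_derive_eq; rewrite /GRing.scale /=; field.
  by rewrite !gt_eqF//= (lt_le_trans D0)// le_eqVlt; apply/orP; left; apply/eqP; ring.
rewrite /Rintegral (continuous_FTC2 (F := fun y => - poisson_primitive e (x - y)))//.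
- by rewrite -EFinB /=; rewrite /poisson_primitive /box; ring.
- have cc : continuous (fun y : R => poisson e (x - y)).
    move=> y; apply: (@continuous_comp _ _ _ (fun y : R => x - y) (poisson e));
      last exact: continuous_poisson.
    by apply: cvgB; [exact: cvg_cst|exact: cvg_id].
  exact: continuous_subspaceT cc.
- have cQ y : {for y, continuous (fun y => - poisson_primitive e (x - y))}.
    by apply: differentiable_continuous; apply/derivable1_diffP; case: (dQ y).
  split.
  + by move=> y _; case: (dQ y).
  + exact/cvg_at_right_filter/cQ.
  + exact/cvg_at_left_filter/cQ.
- by move=> y _; rewrite derive1E; case: (dQ y).
Qed.

Lemma box_ge0 e a b x : 0 < e -> a < b -> 0 <= box e a b x.
Proof.
move=> e0 ab; rewrite -integral_poisson_itv//; apply: Rintegral_ge0 => y _.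
exact: poisson_ge0.
Qed.

Lemma box_le1 e a b x : box e a b x <= 1.
Proof.
have p0 := pi_gt0 R; rewrite ler_pdivrMr// mul1r.
have := atan_ltpi2 (2 * pi * (x - a) / e).
have := atan_gtNpi2 (2 * pi * (x - b) / e); lra.
Qed.

Lemma cvg_atan_scaled (y : R) : y != 0 ->
  (fun n => atan (2 * pi * y / n.+1%:R^-1)) @ \oo --> Num.sg y * (pi / 2).
Proof.
have p0 := pi_gt0 R.
have pos (z : R) : 0 < z -> (fun n => atan (2 * pi * z / n.+1%:R^-1)) @ \oo --> (pi / 2 : R).
  move=> z0; apply: (cvg_comp (fun n : nat => 2 * pi * z / n.+1%:R^-1) atan);
    last exact: cvgy_atan.
  under eq_fun do rewrite invrK.
  have H1 : (fun n : nat => n.+1%:R : R) @ \oo --> +oo.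
    by have := @cvgr_idn R; rewrite -(cvg_shiftS (fun n : nat => n%:R : R)).
  have H2 : 2 * pi * z * x @[x --> +oo] --> +oo.
    by apply: gt0_cvgMry; [rewrite !mulr_gt0|exact: cvg_id].
  exact: (cvg_comp _ _ H1 H2).
case: (ltgtP y 0) => // y0 _.
- rewrite ltr0_sg// mulN1r.
  have -> : (fun n => atan (2 * pi * y / n.+1%:R^-1)) =
      (fun n => - atan (2 * pi * (- y) / n.+1%:R^-1)).
    by apply/funext => n; rewrite -atanN mulrN mulNr opprK.
  by apply: cvgN; apply: pos; rewrite oppr_gt0.
- by rewrite gtr0_sg// mul1r; exact: pos.
Qed.

Lemma cvg_box a b x : a < b -> x != a -> x != b ->
  (fun n => box n.+1%:R^-1 a b x) @ \oo --> (\1_(`[a, b]%classic) x : R).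
Proof.
move=> ab xa xb; have p0 := pi_gt0 R.
have -> : \1_(`[a, b]%classic) x =
    (Num.sg (x - a) * (pi / 2) - Num.sg (x - b) * (pi / 2)) / pi :> R.
  rewrite indicE /= mem_setE in_itv /=.
  case: (ltgtP x a) xa => // xa _.
    rewrite ltr0_sg ?subr_lt0// ltr0_sg ?subr_lt0 ?(lt_trans xa)//=.
    by rewrite subrr mul0r.
  rewrite gtr0_sg ?subr_gt0//.
  case: (ltgtP x b) xb => // xb _.
    rewrite [Num.sg _]ltr0_sg ?subr_lt0//=.
    by move: (pi : R) p0 => p p0; field; rewrite gt_eqF.
  by rewrite gtr0_sg ?subr_gt0//= subrr mul0r.
apply: cvgM; last exact: cvg_cst.
by apply: cvgB; apply: cvg_atan_scaled; rewrite subr_eq0.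
Qed.

End abel_kernel.

(** * Abel summation of the inverse transform *)

Section abel_summation.
Context {R : realType}.
Notation mu := (@lebesgue_measure R).
Implicit Types (f g : R -> R[i]).

Lemma nrmc_cintegral_lee_measurable f : cmeasurable f ->
  ((normc (cintegral mu f))%:E <= \int[mu]_x (normc (f x))%:E)%E.
Proof.
move=> mf; have [fi|] := ltP (\int[mu]_x (normc (f x))%:E)%E +oo%E.
  by apply: nrmc_cintegral_lee; apply/cintegrableP.
by rewrite leye_eq => /eqP ->; exact: leey.
Qed.

Lemma fatou_le (h_ : nat -> R -> R) (h : R -> R) (M : \bar R) :
  (forall n, measurable_fun setT (h_ n)) -> (forall n x, 0 <= h_ n x) ->
  (forall x, h_ ^~ x @ \oo --> h x) ->
  (forall n, (\int[mu]_x (h_ n x)%:E <= M)%E) -> (\int[mu]_x (h x)%:E <= M)%E.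
Proof.
move=> mh h0 hh hM.
rewrite (_ : integral _ _ _ =
    \int[mu]_x limn_einf (fun n => (h_ n x)%:E))%E; last first.
  apply: eq_integral => x _.
  have : (fun n => (h_ n x)%:E) @ \oo --> (h x)%:E.
    by apply: cvg_EFin => //; [exact: nearW|exact: hh].
  by move=> /cvg_limn_einf_sup[-> _].
apply: le_trans (fatou _ _ _ _) _ => //.
- by move=> n; apply/measurable_EFinP; exact: mh.
- by move=> n x _; rewrite lee_fin.
rewrite limn_einf_lim; apply: lime_le; first exact: is_cvg_einfs.
apply: nearW => n; apply: ge_ereal_inf.
by exists (\int[mu]_x (h_ n x)%:E)%E => //; exists n => /=.
Qed.

Lemma cvg_abel (x : R) : (fun n => abel n.+1%:R^-1 x) @ \oo --> (1 : R).
Proof.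
rewrite -[X in _ --> X](expR0 R); apply: continuous_cvg; first exact: continuous_expR.
rewrite -[X in _ --> X]oppr0; apply: cvgN; rewrite -[X in _ --> X](mul0r `|x|).
by apply: cvgM; [exact: cvg_harmonic|exact: cvg_cst].
Qed.

Lemma abel_le1 (e x : R) : 0 < e -> abel e x <= 1.
Proof. by move=> e0; rewrite -expR0 ler_expR oppr_le0 mulr_ge0// ltW. Qed.

Lemma fourier_abel_integrable f (e : R) : 0 < e -> cintegrable mu f ->
  cintegrable mu (fun xi => fourier f xi * (abel e xi)%:C).
Proof.
move=> e0 fi; apply: (le_cintegrable _ (cintegrableZ (nrm1 f)%:C (cintegrable_abel e0))).
- apply: cmeasurableM.
    by apply: cmeasurable_fourier; exact: cintegrable_measurable fi.
  by apply: cmeasurable_real; exact: measurable_abel.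
- move=> xi; rewrite !normcM ler_wpM2r ?nrmc_ge0//.
  by rewrite nrmc_real (le_trans _ (ler_norm _))// fourier_bounded.
Qed.

(** Damping the inverse transform by [abel] turns it into convolution with the
    Poisson kernel. *)
Lemma ifourier_abel f (e x : R) : 0 < e -> cintegrable mu f ->
  ifourier (fun xi => fourier f xi * (abel e xi)%:C) x =
  cintegral mu (fun y => f y * (poisson e (x - y))%:C).
Proof.
move=> e0 fi; rewrite ifourierE.
pose k (z : R * R) : R[i] := expi (- (2 * pi * z.1 * z.2)) * expi (2 * pi * z.2 * x).
have Hi : cintegrable (mu \x mu)%E (fun z : R * R => f z.1 * k z * (abel e z.2)%:C).
  apply: (@cintegrable_prod R f (fun t => (abel e t)%:C)) => //.
  - exact: cintegrable_abel.
  - apply: cmeasurableM; apply: cmeasurable_expi; first exact: measurable_phase2.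
    by apply: measurable_funM => //; exact: measurable_funM.
  - by move=> z; rewrite normcM !nrmc_expi mulr1.
transitivity (cintegral mu (fun xi => cintegral mu (fun y =>
    f y * k (y, xi) * (abel e xi)%:C))).
  apply: eq_cintegral => xi.
  rewrite -mulrA mulrC -cintegralZ; last exact: fourier_integrable.
  by apply: eq_cintegral => y; rewrite /k /=; ring.
rewrite -(cfubini Hi) /=; apply: eq_cintegral => y.
rewrite -abel_transform// -cintegralZ; last first.
  apply: cintegrable_expi; first exact: cintegrable_abel.
  by apply: measurable_funM => //; exact: measurable_funM.
apply: eq_cintegral => xi; rewrite /k /= -expiD -mulrA; congr (_ * _).
by rewrite mulrC; congr (_ * expi _); ring.
Qed.

Lemma abel_parseval f g (e : R) : 0 < e -> cintegrable mu f -> cintegrable mu g ->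
  inner (fourier f) (fun xi => fourier g xi * (abel e xi)%:C) =
  inner f (fun x => cintegral mu (fun y => g y * (poisson e (x - y))%:C)).
Proof.
move=> e0 fi gi; rewrite (fourier_adjoint_L1 fi (fourier_abel_integrable e0 gi)).
by congr inner; apply/funext => x; exact: ifourier_abel.
Qed.

Lemma measurable_poisson_diff (e : R) : 0 < e ->
  measurable_fun setT (fun z : R * R => poisson e (z.1 - z.2)).
Proof.
move=> e0; apply: (measurableT_comp (measurable_poisson e0)).
exact: measurable_funB.
Qed.

(** Schur's test for the Poisson kernel, which has total mass one in each
    variable: the product of [normc (f x)] and [normc (f y)] is at most the
    mean of the squares. *)
Lemma poisson_schur f (e : R) : 0 < e -> L2 f ->
  (\int[mu]_x ((normc (f x))%:E *
     \int[mu]_y (normc (f y * (poisson e (x - y))%:C))%:E) <= (nrm2 f)%:E)%E.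
Proof.
move=> e0 Lf; have mf := L2_measurable Lf.
pose b (z : R * R) := ((2^-1 * normc (f z.2) ^+ 2) * poisson e (z.1 - z.2))%:E.
have b0 z : (0 <= b z)%E.
  by rewrite lee_fin mulr_ge0 ?poisson_ge0// mulr_ge0// sqr_ge0.
have mb : measurable_fun setT b.
  apply/measurable_EFinP; apply: measurable_funM; last exact: measurable_poisson_diff.
  apply: measurable_funM => //.
  by apply: (measurable_nrmc_sqr (cmeasurable_comp mf measurable_snd)).
have mP (x : R) : measurable_fun setT (fun y : R => (poisson e (x - y))%:E).
  apply/measurable_EFinP; apply: (measurableT_comp (measurable_poisson e0)).
  exact: measurable_funB.
have mP' (y : R) : measurable_fun setT (fun x : R => (poisson e (x - y))%:E).
  apply/measurable_EFinP; apply: (measurableT_comp (measurable_poisson e0)).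
  exact: measurable_funB.
have mB : measurable_fun [set: R] (fun x => \int[mu]_y b (x, y))%E.
  exact: (measurable_fun_fubini_tonelli_F (m2 := @lebesgue_measure R) b mb b0).
have mh : measurable_fun [set: R] (fun x => (2^-1 * normc (f x) ^+ 2)%:E).
  by apply/measurable_EFinP; apply: measurable_funM => //; exact: measurable_nrmc_sqr.
have half : (\int[mu]_x (2^-1 * normc (f x) ^+ 2)%:E = (2^-1 * nrm2 f)%:E)%E.
  rewrite EFinM -nrm2E// -ge0_integralZl_EFin//.
  - by move=> x _; rewrite lee_fin sqr_ge0.
  - by apply/measurable_EFinP; exact: measurable_nrmc_sqr.
have -> : (nrm2 f)%:E =
    (\int[mu]_x ((2^-1 * normc (f x) ^+ 2)%:E + \int[mu]_y b (x, y)))%E.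
  rewrite ge0_integralD//; last 2 first.
  - by move=> x _; rewrite lee_fin mulr_ge0// sqr_ge0.
  - by move=> x _; apply: integral_ge0.
  rewrite half (fubini_tonelli (m1 := @lebesgue_measure R) (m2 := @lebesgue_measure R) b)//.
  rewrite (_ : integral _ _ _ = (2^-1 * nrm2 f)%:E)%E; last first.
    rewrite -half; apply: eq_integral => y _; rewrite /b /=.
    under eq_integral do rewrite EFinM.
    rewrite ge0_integralZl_EFin//; last 3 first.
    - by move=> x _; rewrite lee_fin poisson_ge0.
    - exact: mP'.
    - by rewrite mulr_ge0// sqr_ge0.
    under eq_integral do rewrite -poissonN opprB.
    by rewrite integral_poisson_shift// mule1.
  by rewrite -EFinD; congr EFin; field.
apply: ge0_le_integral => //.
- move=> x _; apply: mule_ge0; first by rewrite lee_fin nrmc_ge0.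
  by apply: integral_ge0 => y _; rewrite lee_fin nrmc_ge0.
- apply: emeasurable_funM; first by apply/measurable_EFinP; exact: measurable_nrmc.
  apply: (measurable_fun_fubini_tonelli_F (m2 := @lebesgue_measure R)
    (fun z : R * R => (normc (f z.2 * (poisson e (z.1 - z.2))%:C))%:E)).
    apply/measurable_EFinP; apply: measurable_nrmc; apply: cmeasurableM.
      exact: (cmeasurable_comp mf measurable_snd).
    by apply: cmeasurable_real; exact: measurable_poisson_diff.
  by move=> z; rewrite lee_fin nrmc_ge0.
- exact: emeasurable_funD.
- move=> x _; rewrite -ge0_integralZl_EFin ?nrmc_ge0//; last 2 first.
  + by move=> y _; rewrite lee_fin nrmc_ge0.
  + apply/measurable_EFinP; apply: measurable_nrmc; apply: cmeasurableM => //.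
    by apply: cmeasurable_real; apply/measurable_EFinP; exact: mP.
  rewrite -[(2^-1 * _)%:E]mule1 -(integral_poisson_shift x e0).
  rewrite -ge0_integralZl_EFin//; last 3 first.
  + by move=> y _; rewrite lee_fin poisson_ge0.
  + exact: mP.
  + by rewrite mulr_ge0// sqr_ge0.
  rewrite -ge0_integralD//; last 3 first.
  + move=> y _; apply: mule_ge0; rewrite lee_fin ?poisson_ge0//.
    by rewrite mulr_ge0// sqr_ge0.
  + by apply: emeasurable_funM; [exact: measurable_cst|exact: mP].
  + exact: (measurableT_comp mb (measurable_pair1 x)).
  apply: ge0_le_integral => //.
  + by move=> y _; rewrite -EFinM lee_fin mulr_ge0 ?nrmc_ge0.
  + apply: emeasurable_funM; first exact: measurable_cst.
    apply/measurable_EFinP; apply: measurable_nrmc; apply: cmeasurableM => //.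
    by apply: cmeasurable_real; apply/measurable_EFinP; exact: mP.
  + apply: emeasurable_funD; last exact: (measurableT_comp mb (measurable_pair1 x)).
    by apply: emeasurable_funM; [exact: measurable_cst|exact: mP].
  + move=> y _; rewrite /b /= -!EFinM -EFinD lee_fin normcM nrmc_real.
    rewrite ger0_norm ?poisson_ge0// mulrA -mulrDl ler_wpM2r ?poisson_ge0//.
    have := sqr_ge0 (normc (f x) - normc (f y)); nra.
Qed.

(** The damped norm of [fourier f] is the inner product of [f] with its
    Poisson means, by [abel_parseval]; [poisson_schur] bounds it by the
    squared norm of [f], uniformly in [e]. *)
Lemma fourier_abel_bound f (e : R) : 0 < e -> cintegrable mu f -> L2 f ->
  (\int[mu]_xi (normc (fourier f xi) ^+ 2 * abel e xi)%:E <= (nrm2 f)%:E)%E.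
Proof.
move=> e0 fi Lf; have mf := L2_measurable Lf.
have hi := fourier_abel_integrable e0 fi.
pose G x := cintegral mu (fun y => f y * (poisson e (x - y))%:C).
have GE : G = ifourier (fun xi => fourier f xi * (abel e xi)%:C).
  by apply/funext => x; rewrite ifourier_abel.
have mG : cmeasurable G.
  rewrite GE; apply: cmeasurableJ; apply: cmeasurable_fourier.
  by apply: cmeasurableJ; exact: cintegrable_measurable hi.
have Gi : cintegrable mu (fun x => f x * conjc (G x)).
  apply: (le_cintegrable _ (cintegrableZ (nrm1 (fun xi => fourier f xi * (abel e xi)%:C))%:C fi)).
    by apply: cmeasurableM => //; exact: cmeasurableJ.
  move=> x; rewrite !normcM mulrC ler_wpM2r ?nrmc_ge0// nrmcJ nrmc_real.
  rewrite (le_trans _ (ler_norm _))// GE /ifourier nrmcJ.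
  have := fourier_bounded x (cintegrableJ hi).
  by rewrite /nrm1; under eq_Rintegral do rewrite nrmcJ.
have mA : measurable_fun setT (fun xi => normc (fourier f xi) ^+ 2 * abel e xi).
  apply: measurable_funM; last exact: measurable_abel.
  by apply: measurable_nrmc_sqr; exact: cmeasurable_fourier.
have A0 xi : 0 <= normc (fourier f xi) ^+ 2 * abel e xi.
  by rewrite mulr_ge0 ?abel_ge0// sqr_ge0.
have Ai : mu.-integrable setT (fun xi => (normc (fourier f xi) ^+ 2 * abel e xi)%:E).
  apply: (le_integrable _ _ _ (integrableZl _ (nrm1 f ^+ 2) (integrable_abel e0))) => //.
    exact/measurable_EFinP.
  move=> xi _; rewrite /= lee_fin !ger0_norm ?A0//; last first.
    by rewrite mulr_ge0 ?abel_ge0// sqr_ge0.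
  rewrite ler_wpM2r ?abel_ge0// lerXn2r ?nnegrE ?nrmc_ge0 ?fourier_bounded//.
  by apply: Rintegral_ge0 => x _; exact: nrmc_ge0.
have <- : (Rintegral mu setT (fun xi => normc (fourier f xi) ^+ 2 * abel e xi))%:E =
    (\int[mu]_xi (normc (fourier f xi) ^+ 2 * abel e xi)%:E)%E.
  by rewrite /Rintegral fineK//; exact: integrable_fin_num.
have E : (Rintegral mu setT (fun xi => normc (fourier f xi) ^+ 2 * abel e xi))%:C =
    inner f G.
  rewrite -abel_parseval// -cintegral_real; apply: eq_cintegral => xi.
  by rewrite conjcM conjc_real mulrA mulzJ -rmorphM.
apply: (@le_trans _ _ (\int[mu]_x (normc (f x * conjc (G x)))%:E)%E).
  have := Re_cintegral_le Gi; rewrite -/(inner f G) -E => h.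
  apply: (@le_trans _ _ (Rintegral mu setT (fun x => normc (f x * conjc (G x))))%:E).
    by rewrite lee_fin.
  by rewrite /Rintegral fineK//; apply: integrable_fin_num => //; exact: cintegrable_nrmc.
apply: le_trans (poisson_schur e0 Lf); apply: ge0_le_integral => //.
- by move=> x _; rewrite lee_fin nrmc_ge0.
- by apply/measurable_EFinP; apply: measurable_nrmc; exact: cintegrable_measurable Gi.
- apply: emeasurable_funM; first by apply/measurable_EFinP; exact: measurable_nrmc.
  apply: (measurable_fun_fubini_tonelli_F (m2 := @lebesgue_measure R)
    (fun z : R * R => (normc (f z.2 * (poisson e (z.1 - z.2))%:C))%:E)).
    apply/measurable_EFinP; apply: measurable_nrmc; apply: cmeasurableM.
      exact: (cmeasurable_comp mf measurable_snd).
    by apply: cmeasurable_real; exact: measurable_poisson_diff.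
  by move=> z; rewrite lee_fin nrmc_ge0.
- move=> x _; rewrite normcM nrmcJ EFinM; apply: lee_wpmul2l.
    by rewrite lee_fin nrmc_ge0.
  apply: nrmc_cintegral_lee_measurable; apply: cmeasurableM => //.
  apply: cmeasurable_real; apply: (measurableT_comp (measurable_poisson e0)).
  exact: measurable_funB.
Qed.

(** Fatou's lemma removes the damping. *)
Lemma fourier_contraction f : cintegrable mu f -> L2 f ->
  L2 (fourier f) /\ nrm2 (fourier f) <= nrm2 f.
Proof.
move=> fi Lf; have mF := cmeasurable_fourier (L2_measurable Lf).
have bound : (\int[mu]_xi (normc (fourier f xi) ^+ 2)%:E <= (nrm2 f)%:E)%E.
  apply: (@fatou_le (fun n xi => normc (fourier f xi) ^+ 2 * abel n.+1%:R^-1 xi)).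
  - move=> n; apply: measurable_funM; last exact: measurable_abel.
    exact: measurable_nrmc_sqr.
  - by move=> n xi; rewrite mulr_ge0 ?abel_ge0// sqr_ge0.
  - move=> xi; rewrite -[X in _ --> X]mulr1.
    by apply: cvgM; [exact: cvg_cst|exact: cvg_abel].
  - by move=> n; apply: fourier_abel_bound => //; rewrite invr_gt0.
have LF : L2 (fourier f).
  by apply/L2P; split => //; apply: le_lt_trans bound _; exact: ltry.
by split => //; rewrite -lee_fin -nrm2E.
Qed.

Definition cindic (a b : R) (t : R) : R[i] := (\1_(`[a, b]%classic) t)%:C.

Lemma cmeasurable_cindic a b : cmeasurable (cindic a b).
Proof. by apply: cmeasurable_real; exact: measurable_indic. Qed.

Lemma nrmc_cindic a b t : normc (cindic a b t) = \1_(`[a, b]%classic) t.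
Proof. by rewrite nrmc_real ger0_norm// indicE. Qed.

Lemma cintegrable_cindic a b : cintegrable mu (cindic a b).
Proof.
split; last exact: integrable0.
exact: integrable_indic_itv.
Qed.

Lemma L2_cindic a b : L2 (cindic a b).
Proof.
have [] := @le_L2 R (cindic a b) (\1_(`[a, b]%classic)) => //.
- exact: cmeasurable_cindic.
- exact: integrable_indic_itv.
- by move=> t; rewrite nrmc_cindic indicE; case: (_ \in _); rewrite ?expr0n ?expr1n.
Qed.

Lemma cindic_poisson (a b e x : R) : 0 < e -> a < b ->
  cintegral mu (fun y => cindic a b y * (poisson e (x - y))%:C) = (box e a b x)%:C.
Proof.
move=> e0 ab; rewrite -integral_poisson_itv// Rintegral_mkcond.
rewrite -cintegral_real; apply: eq_cintegral => y.
by rewrite /cindic indicE patchE; case: (_ \in _); rewrite ?mul1r ?mul0r.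
Qed.

Lemma measurable_box (a b e : R) : measurable_fun setT (box e a b).
Proof.
apply: measurable_funM => //; apply: measurable_funB;
  apply: measurableT_comp; try (by apply: continuous_measurable_fun;
    exact: continuous_atan);
  by apply: measurable_funM => //; apply: measurable_funM => //; exact: measurable_funB.
Qed.

(** The seed of Plancherel's theorem. Against the indicator of an interval
    both sides of [abel_parseval] have dominated limits as [e] tends to [0]:
    on the left because [fourier] is square-integrable, on the right because
    the Poisson means of the indicator are bounded and converge. Indicators
    suffice, since they determine a function by [L2_cindic_eq0]. *)
Lemma parseval_cindic_L1 f (a b : R) : a < b -> cintegrable mu f -> L2 f ->
  inner (fourier f) (fourier (cindic a b)) = inner f (cindic a b).
Proof.
move=> ab fi Lf; have gi := cintegrable_cindic a b; have Lg := L2_cindic a b.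
have [LF _] := fourier_contraction fi Lf.
have [LG _] := fourier_contraction gi Lg.
have e0 n : 0 < n.+1%:R^-1 :> R by rewrite invr_gt0.
pose L n := inner (fourier f) (fun xi => fourier (cindic a b) xi * (abel n.+1%:R^-1 xi)%:C).
apply: (@ccvg_unique R L).
  apply: (@cdominated_convergence _ _ _ mu _ _
     (fun xi => normc (fourier f xi * conjc (fourier (cindic a b) xi)))).
  - move=> n; apply: cmeasurableM; first exact: L2_measurable.
    apply: cmeasurableJ; apply: cmeasurableM; first exact: L2_measurable.
    by apply: cmeasurable_real; exact: measurable_abel.
  - apply: cmeasurableM; first exact: L2_measurable.
    by apply: cmeasurableJ; exact: L2_measurable.
  - apply: nearW => xi.
    have := ccvg_scale (fourier f xi * conjc (fourier (cindic a b) xi)) (cvg_abel xi).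
    rewrite mul1r; apply: eq_ccvg => n.
    by rewrite conjcM conjc_real mulrC -mulrA.
  - exact: (cintegrable_nrmc (inner_integrable LF LG)).
  - move=> n xi; rewrite conjcM mulrA normcM ler_piMr ?nrmc_ge0// nrmcJ nrmc_real.
    by rewrite ger0_norm ?abel_ge0 ?abel_le1.
have LE n : L n = cintegral mu (fun x => f x * (box n.+1%:R^-1 a b x)%:C).
  rewrite /L abel_parseval//; apply: eq_cintegral => x.
  by rewrite cindic_poisson// conjc_real.
rewrite (_ : L = fun n => cintegral mu (fun x => f x * (box n.+1%:R^-1 a b x)%:C));
  last exact/funext.
apply: (@cdominated_convergence _ _ _ mu _ _ (fun x => normc (f x))).
- move=> n; apply: cmeasurableM; first exact: L2_measurable.
  by apply: cmeasurable_real; exact: measurable_box.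
- apply: cmeasurableM; first exact: L2_measurable.
  by apply: cmeasurableJ; exact: cmeasurable_cindic.
- have N : (@lebesgue_measure R).-negligible [set a; b].
    exists [set a; b]; split => //; first by apply: measurableU; exact: measurable_set1.
    by apply: countable_lebesgue_measure0; apply: finite_set_countable; exact: finite_set2.
  move: N; apply: negligibleS => x H /=; apply: contrapT => /not_orP[/eqP xa /eqP xb].
  have G : ccvg (fun n => f x * (box n.+1%:R^-1 a b x)%:C) (f x * conjc (cindic a b x)).
    rewrite /cindic conjc_real mulrC.
    have := ccvg_scale (f x) (cvg_box ab xa xb); apply: eq_ccvg => n.
    by rewrite mulrC.
  exact: H G.
- exact: cintegrable_nrmc.
- move=> n x; rewrite normcM ler_piMr ?nrmc_ge0// nrmc_real.
  by rewrite ger0_norm ?box_ge0 ?box_le1.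
Qed.

End abel_summation.

(** * Mean-square convergence and truncation *)

Section mean_square_convergence.
Context {R : realType}.
Notation mu := (@lebesgue_measure R).
Implicit Types (f g : R -> R[i]) (u v : nat -> R -> R[i]).

Definition L2cvg u f := (fun n => nrm2 (fun t => u n t - f t)) @ \oo --> (0 : R).

Lemma L2cvg_le u f (a : nat -> R) : (forall n, nrm2 (fun t => u n t - f t) <= a n) ->
  a @ \oo --> (0 : R) -> L2cvg u f.
Proof.
move=> ua a0; apply: (@squeeze_cvgr _ _ _ _ (cst 0) a) => //; last exact: cvg_cst.
by apply: nearW => n; rewrite nrm2_ge0 ua.
Qed.

Lemma L2cvg_cst f : L2cvg (fun _ => f) f.
Proof.
rewrite /L2cvg (_ : (fun _ => _) = cst 0); first exact: cvg_cst.
by apply/funext => n; rewrite /nrm2; under eq_Rintegral do rewrite subrr normc0 expr0n;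
  rewrite /Rintegral integral0.
Qed.

Lemma cvg_combination0 (a b : nat -> R) (k : R) : a @ \oo --> (0 : R) -> b @ \oo --> (0 : R) ->
  (fun n => k * a n + 2 * b n) @ \oo --> (0 : R).
Proof.
move=> a0 b0; rewrite (_ : 0 = k * 0 + 2 * 0); last by rewrite !mulr0 addr0.
by apply: cvgD; apply: cvgM => //; exact: cvg_cst.
Qed.

Lemma L2cvg_unique u f g : (forall n, L2 (u n)) -> L2 f -> L2 g ->
  L2cvg u f -> L2cvg u g -> aeeq f g.
Proof.
move=> Lu Lf Lg uf ug; apply: aeeq_nrm2 => //.
have := @L2cvg_le (fun _ => f) g _ (fun n => nrm2_triangle Lf (Lu n) Lg).
have fu : (fun n => nrm2 (fun t => f t - u n t)) @ \oo --> (0 : R).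
  by under eq_fun do rewrite nrm2BC.
move=> /(_ (cvg_combination0 2 fu ug)) h.
exact: (cvg_unique _ (cvg_cst _) h).
Qed.

Lemma L2cvg_trans u v f : (forall n, L2 (u n)) -> (forall n, L2 (v n)) -> L2 f ->
  (fun n => nrm2 (fun t => v n t - u n t)) @ \oo --> (0 : R) ->
  L2cvg u f -> L2cvg v f.
Proof.
move=> Lu Lv Lf vu uf.
exact: (L2cvg_le (fun n => nrm2_triangle (Lv n) (Lu n) Lf) (cvg_combination0 2 vu uf)).
Qed.

Lemma L2cvgJ u f : L2cvg u f -> L2cvg (fun n t => conjc (u n t)) (fun t => conjc (f t)).
Proof.
rewrite /L2cvg => uf; rewrite (_ : (fun n => _) = (fun n => nrm2 (fun t => u n t - f t)))//.
apply/funext => n; rewrite -[RHS]nrm2J; congr nrm2; apply/funext => t.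
by rewrite rmorphB.
Qed.

Lemma L2cvg_ae u f g : (forall n, L2 (u n)) -> L2 f -> L2 g -> aeeq f g ->
  L2cvg u f -> L2cvg u g.
Proof.
move=> Lu Lf Lg fg uf.
apply: (L2cvg_le (fun n => nrm2_triangle (Lu n) Lf Lg)); apply: cvg_combination0 => //.
rewrite (nrm2_aeeq0 (L2_measurable Lf) (L2_measurable Lg) fg); exact: cvg_cst.
Qed.

Definition trunc (n : nat) f (t : R) : R[i] := cindic (- n%:R) n%:R t * f t.

Lemma L2_trunc n f : L2 f -> L2 (trunc n f).
Proof.
move=> Lf; apply: (L2_bounded_mul (M := 1) (cmeasurable_cindic _ _) _ Lf).1 => t.
by rewrite nrmc_cindic indicE; case: (_ \in _).
Qed.

Lemma cintegrable_trunc n f : L2 f -> cintegrable mu (trunc n f).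
Proof.
move=> Lf; have := inner_integrable (L2J (L2_cindic (- n%:R) n%:R)) (L2J Lf).
rewrite (_ : (fun t => _) = trunc n f)//; apply/funext => t.
by rewrite conjcK /cindic conjc_real.
Qed.

Lemma trunc_cvg f : L2 f -> L2cvg (fun n => trunc n f) f.
Proof.
move=> Lf; rewrite /L2cvg; pose h n t := normc (trunc n f t - f t) ^+ 2.
have /= [] := @dominated_convergence _ _ _ (@lebesgue_measure R) setT measurableT
   (fun n t => (h n t)%:E) (cst 0%E) (fun t => (normc (f t) ^+ 2)%:E).
- move=> n; apply/measurable_EFinP; apply: measurable_nrmc_sqr.
  by apply: cmeasurableB; apply: L2_measurable => //; exact: L2_trunc.
- exact: measurable_cst.
- apply: nearW => t _; apply: cvg_EFin; first exact: nearW.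
  have [N HN] : exists N : nat, `|t| <= N%:R.
    by exists (Num.trunc `|t|).+1; rewrite ltW// truncnS_gt.
  apply: cvg_near_cst; exists N => // n /= Nn.
  rewrite /h /trunc /cindic indicE mem_set /= ?mul1r ?subrr ?normc0 ?expr0n//.
  rewrite in_itv/= -ler_norml; apply: le_trans HN _; by rewrite ler_nat.
- exact: L2_integrable_sqr.
- apply: nearW => t n _; rewrite lee_fin ger0_norm ?sqr_ge0//.
  rewrite /h /trunc /cindic indicE; case: (_ \in _).
    by rewrite mul1r subrr normc0 expr0n sqr_ge0.
  by rewrite mul0r sub0r nrmcN.
- move=> _ _; rewrite integral0 => hc.
  exact: fine_cvg hc.
Qed.

Lemma truncJ n f t : trunc n (fun t => conjc (f t)) t = conjc (trunc n f t).
Proof. by rewrite /trunc conjcM /cindic conjc_real. Qed.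

Lemma aeeq_cindic0 a b : b <= a -> aeeq (cindic a b : R -> R[i]) (fun _ => 0).
Proof.
move=> ba; have N : (@lebesgue_measure R).-negligible [set a].
  exists [set a]; split; [exact: measurable_set1|exact: lebesgue_measure_set1|by []].
move: N; apply: negligibleS => x H /=; apply: contrapT => /eqP xa; apply: H.
rewrite /= /cindic indicE memNset//= in_itv/= => /andP[ax xb].
by move: xa; rewrite eq_le ax (le_trans xb ba).
Qed.

(** A function with vanishing integrals over all bounded intervals has a
    constant primitive, so that Lebesgue's differentiation theorem kills it. *)
Lemma L2_cindic_eq0 (d : R -> R[i]) : L2 d ->
  (forall a b, inner d (cindic a b) = 0) -> aeeq d (fun _ => 0).
Proof.
move=> Ld d0.
have tr n x : cintegral mu (fun t => trunc n d t * cindic (- n%:R) x t) = 0.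
  rewrite -(d0 (- n%:R) (Num.min n%:R x)); apply: eq_cintegral => t.
  rewrite /trunc /cindic conjc_real mulrAC -rmorphM /= mulrC; congr (_ * _).
  rewrite !indicE !mem_setE !in_itv /= le_min.
  by case: (- n%:R <= t); case: (t <= n%:R); case: (t <= x) => /=;
    rewrite ?mulr1 ?mulr0.
have part (p : R[i] -> R) (n : nat) :
    mu.-integrable setT (fun t => (p (trunc n d t))%:E) ->
    (forall x, Rintegral mu setT (fun t => \1_(`]-oo, x]%classic) t * p (trunc n d t)) = 0) ->
    {ae mu, forall t, p (trunc n d t) = 0}.
  move=> ip p0.
  have locp : locally_integrable setT (fun t => p (trunc n d t)).
    by apply: open_integrable_locally; [exact: openT|exact: ip].
  have := @FTC1Ny R (fun t => p (trunc n d t)) _ locp.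
  have F0 : (fun x => Rintegral mu `]-oo, x] (fun t => p (trunc n d t))) = cst 0.
    apply/funext => x; rewrite /cst -[RHS](p0 x) Rintegral_mkcond.
    apply: eq_Rintegral => t _; rewrite patchE indicE.
    by case: (_ \in _); rewrite ?mul1r ?mul0r.
  rewrite F0 => F; apply: filterS (F _) => [t [_]|y].
    by rewrite derive1_cst => <-.
  by apply: (integrableS measurableT).
have tr0 n : {ae mu, forall t, trunc n d t = 0}.
  have [ti1 ti2] := cintegrable_trunc n Ld.
  have E x t : trunc n d t * cindic (- n%:R) x t =
      (\1_(`]-oo, x]%classic) t)%:C * trunc n d t.
    rewrite /trunc /cindic mulrAC mulrA; congr (_ * _).
    rewrite -!(rmorphM (real_complex R)).
    apply: (congr1 (fun r : R => r%:C)).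
    rewrite !indicE !mem_setE !in_itv /=.
    by case: (- n%:R <= t); case: (t <= n%:R); case: (t <= x) => /=;
      rewrite ?mulr1 ?mulr0.
  have p1 := @part (@complex.Re R) n ti1 _.
  have p2 := @part (@complex.Im R) n ti2 _.
  apply: filterS2 (p1 _) (p2 _) => [t Re0 Im0|x|x].
  - exact: complex_ext.
  - have := congr1 (@complex.Re R) (tr n x) => /= <-.
    by apply: eq_Rintegral => t _; rewrite E [RHS]ReCM.
  - have := congr1 (@complex.Im R) (tr n x) => /= <-.
    by apply: eq_Rintegral => t _; rewrite E [RHS]ImCM.
have : {ae mu, forall t n, trunc n d t = 0} by apply/ae_foralln.
apply: filterS => t tn.
have [N HN] : exists N : nat, `|t| <= N%:R.
  by exists (Num.trunc `|t|).+1; rewrite ltW// truncnS_gt.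
rewrite -(tn N) /trunc /cindic indicE mem_set /= ?mul1r//.
by rewrite in_itv/= -ler_norml.
Qed.

End mean_square_convergence.

(** * The Fourier transform of square-integrable functions *)

Section plancherel.
Context {R : realType}.
Notation mu := (@lebesgue_measure R).
Implicit Types (f g : R -> R[i]) (u v : nat -> R -> R[i]).

Definition L12 f := cintegrable mu f /\ L2 f.

Lemma L12_trunc n f : L2 f -> L12 (trunc n f).
Proof. by move=> Lf; split; [exact: cintegrable_trunc|exact: L2_trunc]. Qed.

Lemma L12J f : L12 f -> L12 (fun t => conjc (f t)).
Proof. by move=> [fi Lf]; split; [exact: cintegrableJ|exact: L2J]. Qed.

Lemma L2_fourier f : L12 f -> L2 (fourier f).
Proof. by move=> [fi Lf]; exact: (fourier_contraction fi Lf).1. Qed.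

Lemma fourier_dist f g : L12 f -> L12 g ->
  nrm2 (fun xi => fourier f xi - fourier g xi) <= nrm2 (fun t => f t - g t).
Proof.
move=> [fi Lf] [gi Lg].
rewrite (_ : (fun xi => _) = fourier (fun t => f t - g t)); last first.
  by apply/funext => xi; rewrite fourierB.
apply: (fourier_contraction _ _).2; last exact: (L2B _ _).1.
apply: cintegrableD => //.
by have := cintegrableZ (-1) gi; under eq_fun do rewrite mulN1r.
Qed.

Definition ft_lim f g := [/\ L2 f, L2 g & L2cvg (fun n => fourier (trunc n f)) g].

(** Since [fourier] is a contraction on [L12], the limit does not depend on
    the approximating sequence. *)
Lemma ft_lim_seq f g u : ft_lim f g -> (forall n, L12 (u n)) -> L2cvg u f ->
  L2cvg (fun n => fourier (u n)) g.
Proof.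
move=> [Lf Lg fg] Lu uf.
apply: (L2cvg_trans _ _ _ _ fg) => //.
- by move=> n; apply: L2_fourier; exact: L12_trunc.
- by move=> n; exact: L2_fourier.
have Lu2 n : L2 (u n) by case: (Lu n).
apply: (@squeeze_cvgr _ _ _ _ (cst 0) (fun n =>
  2 * nrm2 (fun t => u n t - f t) + 2 * nrm2 (fun t => f t - trunc n f t))).
- apply: nearW => n; rewrite nrm2_ge0 /=.
  apply: le_trans (fourier_dist (Lu n) (L12_trunc n Lf)) _.
  by apply: nrm2_triangle => //; exact: L2_trunc.
- exact: cvg_cst.
- apply: cvg_combination0 => //; under eq_fun do rewrite nrm2BC; exact: trunc_cvg.
Qed.

Lemma ft_lim_exists f : L2 f -> exists g, ft_lim f g.
Proof.
move=> Lf; have LF n : L2 (fourier (trunc n f)) by apply: L2_fourier; exact: L12_trunc.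
have [] := @riesz_fischer R (fun n => fourier (trunc n f)) LF.
  move=> e e0; have tc := trunc_cvg Lf.
  have e4 : 0 < e / 4 by rewrite divr_gt0.
  have /cvgrPdist_le/(_ _ e4)[N _ HN] := tc.
  exists N => m n Nm Nn.
  apply: le_trans (fourier_dist (L12_trunc m Lf) (L12_trunc n Lf)) _.
  apply: le_trans (nrm2_triangle (L2_trunc m Lf) Lf (L2_trunc n Lf)) _.
  have := HN m Nm; have := HN n Nn.
  rewrite /= !sub0r !normrN !ger0_norm ?nrm2_ge0//.
  rewrite [X in _ + 2 * X]nrm2BC; lra.
by move=> g Lg fg; exists g.
Qed.

(** A choice among the almost everywhere equal limits of the transforms of the
    truncations. Outside of [L2] the value is a default. *)
Definition FT f : R -> R[i] :=
  if pselect (exists g, ft_lim f g) is left h then projT1 (cid h) else fun _ => 0.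

Lemma FTP f : L2 f -> ft_lim f (FT f).
Proof.
move=> Lf; rewrite /FT; case: pselect => [h|[]]; last exact: ft_lim_exists.
exact: (projT2 (cid h)).
Qed.

Lemma L2_FT f : L2 f -> L2 (FT f).
Proof. by move=> /FTP[]. Qed.

Lemma FT_seq f u : L2 f -> (forall n, L12 (u n)) -> L2cvg u f ->
  L2cvg (fun n => fourier (u n)) (FT f).
Proof. by move=> Lf; apply: ft_lim_seq; exact: FTP. Qed.

(** The way the transform is computed below: it suffices to exhibit one
    approximating sequence. *)
Lemma FT_unique f g u : L2 f -> L2 g -> (forall n, L12 (u n)) -> L2cvg u f ->
  L2cvg (fun n => fourier (u n)) g -> aeeq (FT f) g.
Proof.
move=> Lf Lg Lu uf ug.
apply: (L2cvg_unique _ _ _ (FT_seq Lf Lu uf) ug) => //; last exact: L2_FT.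
by move=> n; exact: L2_fourier.
Qed.

Lemma FT_fourier f : L12 f -> aeeq (FT f) (fourier f).
Proof.
move=> Lf; apply: (@FT_unique f _ (fun _ => f)) => //.
- by case: Lf.
- exact: L2_fourier.
- exact: L2cvg_cst.
- exact: L2cvg_cst.
Qed.

Lemma FT_ae f g : L2 f -> L2 g -> aeeq f g -> aeeq (FT f) (FT g).
Proof.
move=> Lf Lg fg; apply: (@FT_unique f (FT g) (fun n => trunc n g)) => //.
- exact: L2_FT.
- by move=> n; exact: L12_trunc.
- apply: (@L2cvg_ae R _ g f) => //; last exact: trunc_cvg.
    by move=> n; exact: L2_trunc.
  exact: aeeq_sym.
- by case: (FTP Lg).
Qed.

Lemma FT_linear (c : R[i]) f g : L2 f -> L2 g ->
  aeeq (FT (fun t => c * f t + g t)) (fun xi => c * FT f xi + FT g xi).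
Proof.
move=> Lf Lg.
have Lfg : L2 (fun t => c * f t + g t) by exact: (L2D (L2Z c Lf) Lg).1.
have LFG : L2 (fun t => c * FT f t + FT g t).
  by apply: (L2D (L2Z c _) _).1; exact: L2_FT.
apply: (@FT_unique _ _ (fun n => trunc n (fun t => c * f t + g t))) => //.
- by move=> n; exact: L12_trunc.
- exact: trunc_cvg.
have [_ _ Ff] := FTP Lf; have [_ _ Fg] := FTP Lg.
apply: (L2cvg_le _ (cvg_combination0 (2 * normc c ^+ 2) Ff Fg)) => n.
have Lf' : L2 (fun xi => fourier (trunc n f) xi - FT f xi).
  by apply: (L2B _ _).1; [apply: L2_fourier; exact: L12_trunc|exact: L2_FT].
have Lg' : L2 (fun xi => fourier (trunc n g) xi - FT g xi).
  by apply: (L2B _ _).1; [apply: L2_fourier; exact: L12_trunc|exact: L2_FT].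
have E xi : fourier (trunc n (fun t => c * f t + g t)) xi - (c * FT f xi + FT g xi) =
    c * (fourier (trunc n f) xi - FT f xi) + (fourier (trunc n g) xi - FT g xi).
  have -> : fourier (trunc n (fun t => c * f t + g t)) xi =
      c * fourier (trunc n f) xi + fourier (trunc n g) xi.
    have fi := fourier_integrable xi (cintegrable_trunc n Lf).
    have gi := fourier_integrable xi (cintegrable_trunc n Lg).
    rewrite /fourier -cintegralZ// -cintegralD//; last exact: cintegrableZ.
    by apply: eq_cintegral => t; rewrite /trunc; ring.
  move: (fourier _ xi) (fourier _ xi) (FT f xi) (FT g xi) => p q p' q'.
  by ring.
rewrite (_ : (fun t => _) = (fun xi => c * (fourier (trunc n f) xi - FT f xi) +
  (fourier (trunc n g) xi - FT g xi))); last exact/funext.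
apply: le_trans (L2D (L2Z c Lf') Lg').2 _; rewrite lerD2r -mulrA ler_pM2l//.
exact: (L2_bounded_mul (M := normc c) (cmeasurable_cst _ c) _ Lf').2.
Qed.

Definition iFT g (x : R) : R[i] := conjc (FT (fun t => conjc (g t)) x).

Lemma L2_iFT f : L2 f -> L2 (iFT f).
Proof. by move=> Lf; apply: L2J; apply: L2_FT; exact: L2J. Qed.

Lemma iFT_ae f g : L2 f -> L2 g -> aeeq f g -> aeeq (iFT f) (iFT g).
Proof.
move=> Lf Lg fg.
have : aeeq (fun t => conjc (f t)) (fun t => conjc (g t)).
  by apply: filterS fg => t ->.
by move=> /(FT_ae (L2J Lf) (L2J Lg)); apply: filterS => t; rewrite /iFT => ->.
Qed.

Lemma iFT_linear (c : R[i]) f g : L2 f -> L2 g ->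
  aeeq (iFT (fun t => c * f t + g t)) (fun xi => c * iFT f xi + iFT g xi).
Proof.
move=> Lf Lg; have := FT_linear (conjc c) (L2J Lf) (L2J Lg).
rewrite (_ : (fun t => _) = (fun t => conjc (c * f t + g t))); last first.
  by apply/funext => t; rewrite conjcD conjcM.
by apply: filterS => t; rewrite /iFT => ->; rewrite conjcD conjcM conjcK.
Qed.

(** [fourier_adjoint_L1] passes to the limit, in [f] for an integrable [g] and
    then in [g]. *)
Lemma FT_adjoint f g : L2 f -> L2 g -> inner (FT f) g = inner f (iFT g).
Proof.
move=> Lf Lg.
have LfF n : L2 (fourier (trunc n f)) by apply: L2_fourier; exact: L12_trunc.
have Li h : L12 h -> L2 (ifourier h).
  by move=> Lh; apply: L2J; apply: L2_fourier; exact: L12J.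
have step h : L12 h -> inner (FT f) h = inner f (ifourier h).
  move=> Lh; have [hi Lh2] := Lh.
  have [_ _ Ff] := FTP Lf.
  apply: (ccvg_unique (inner_cvgl LfF (L2_FT Lf) Lh2 Ff)).
  apply: eq_ccvg (inner_cvgl (fun n => L2_trunc n Lf) Lf (Li _ Lh) (trunc_cvg Lf)) => n.
  by rewrite fourier_adjoint_L1//; exact: cintegrable_trunc.
have icvg : L2cvg (fun n => ifourier (trunc n g)) (iFT g).
  have [_ _ /L2cvgJ] := FTP (L2J Lg).
  rewrite (_ : (fun n t => conjc _) = (fun n => ifourier (trunc n g)))//.
  apply/funext => n; apply/funext => x; rewrite /ifourier.
  rewrite (_ : (fun t => conjc (trunc n g t)) = trunc n (fun t => conjc (g t)))//.
  by apply/funext => t; rewrite truncJ.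
apply: (ccvg_unique (inner_cvgr (fun n => L2_trunc n Lg) Lg (L2_FT Lf) (trunc_cvg Lg))).
apply: eq_ccvg (inner_cvgr (fun n => Li _ (L12_trunc n Lg)) (L2_iFT Lg) Lf icvg) => n.
by rewrite step//; exact: L12_trunc.
Qed.

Lemma L12_cindic a b : L12 (cindic a b).
Proof. by split; [exact: cintegrable_cindic|exact: L2_cindic]. Qed.

Lemma parseval_cindic f (a b : R) : L2 f ->
  inner (FT f) (FT (cindic a b)) = inner f (cindic a b).
Proof.
move=> Lf.
have zero : b <= a -> inner (FT f) (FT (cindic a b)) = inner f (cindic a b).
  move=> ba.
  have L0 : L2 (fun _ : R => 0 : R[i]).
    by have := (L2B (L2_cindic a b) (L2_cindic a b)).1; under eq_fun do rewrite subrr.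
  have L0' : L12 (fun _ : R => 0 : R[i]).
    by split => //; split; exact: integrable0.
  have i0 h : inner h (fun _ : R => 0 : R[i]) = 0.
    rewrite -[RHS](cintegral0 (@lebesgue_measure R)); apply: eq_cintegral => t.
    by rewrite conjc0 mulr0.
  have c0 := aeeq_cindic0 (R := R) ba.
  rewrite (inner_ae Lf (L2_cindic a b) (L2_measurable Lf) (L2_measurable L0) _ c0);
    last exact: nearW.
  have F0 : aeeq (FT (cindic a b)) (fun _ => 0).
    apply: aeeq_trans (FT_ae (L2_cindic a b) L0 c0) _.
    apply: aeeq_trans (FT_fourier L0') _; apply: nearW => xi.
    rewrite -[RHS](cintegral0 (@lebesgue_measure R)); apply: eq_cintegral => t.
    by rewrite mul0r.
  rewrite (inner_ae (L2_FT Lf) (L2_FT (L2_cindic a b)) (L2_measurable (L2_FT Lf))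
    (L2_measurable L0) _ F0); last exact: nearW.
  by rewrite !i0.
have [/zero//|ab] := leP b a.
have Lc := L12_cindic a b; have LF := L2_fourier Lc.
rewrite (inner_ae (L2_FT Lf) (L2_FT (L2_cindic a b)) (L2_measurable (L2_FT Lf))
    (L2_measurable LF) _ (FT_fourier Lc)); last exact: nearW.
have [_ _ Ff] := FTP Lf.
have LfF n : L2 (fourier (trunc n f)) by apply: L2_fourier; exact: L12_trunc.
apply: (ccvg_unique (inner_cvgl LfF (L2_FT Lf) LF Ff)).
apply: eq_ccvg (inner_cvgl (fun n => L2_trunc n Lf) Lf (L2_cindic a b) (trunc_cvg Lf)) => n.
by rewrite parseval_cindic_L1//; [exact: cintegrable_trunc|exact: L2_trunc].
Qed.

(** Tested against the indicator [u] of an interval: [inner (iFT (FT f)) u =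
    inner (FT f) (FT u) = inner f u]. *)
Lemma iFTK f : L2 f -> aeeq (iFT (FT f)) f.
Proof.
move=> Lf; set h := iFT (FT f); have Lh : L2 h by apply: L2_iFT; exact: L2_FT.
have : aeeq (fun t => h t - f t) (fun _ => 0).
  apply: L2_cindic_eq0; first exact: (L2B Lh Lf).1.
  move=> a b; have Lc := L2_cindic a b.
  rewrite innerBl// [inner h _]innerJ -FT_adjoint//; last exact: L2_FT.
  by rewrite -innerJ parseval_cindic// subrr.
by apply: filterS => t /eqP; rewrite subr_eq0 => /eqP.
Qed.

Lemma FTK f : L2 f -> aeeq (FT (iFT f)) f.
Proof.
move=> Lf; apply: filterS (iFTK (L2J Lf)) => t /(congr1 conjc).
by rewrite /iFT !conjcK.
Qed.

Theorem plancherel f g : L2 f -> L2 g -> inner (FT f) (FT g) = inner f g.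
Proof.
move=> Lf Lg; rewrite FT_adjoint//; last exact: L2_FT.
apply: inner_ae => //; [exact: L2_iFT (L2_FT Lg)|exact: L2_measurable|
  exact: L2_measurable|exact: nearW|exact: iFTK].
Qed.

Lemma nrm2_FT f : L2 f -> nrm2 (FT f) = nrm2 f.
Proof.
move=> Lf; have := plancherel Lf Lf; rewrite !inner_nrm2.
by move=> /(congr1 (@complex.Re R)).
Qed.

Lemma nrm2_iFT f : L2 f -> nrm2 (iFT f) = nrm2 f.
Proof. by move=> Lf; rewrite /iFT nrm2J nrm2_FT ?nrm2J//; exact: L2J. Qed.

Lemma L2cvgE u f : (forall n, L2 (u n)) -> L2 f ->
  L2cvg u f <-> L2norm (u n \- f) @[n --> \oo] --> 0%E.
Proof.
move=> Lu Lf.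
have E n : L2norm (u n \- f) = (Num.sqrt (nrm2 (fun t => u n t - f t)))%:E.
  by apply: L2norm_nrm2; exact: (L2B (Lu n) Lf).1.
under eq_fun do rewrite E; split => [uf|/fine_cvg uf].
- apply: cvg_EFin; first exact: nearW.
  rewrite -[X in _ --> X]sqrtr0; apply: continuous_cvg => //; exact: sqrt_continuous.
- rewrite /L2cvg (_ : (fun n => _) = (fun n => Num.sqrt (nrm2 (fun t => u n t - f t)) *
    Num.sqrt (nrm2 (fun t => u n t - f t)))); last first.
    by apply/funext => n; rewrite -expr2 sqr_sqrtr ?nrm2_ge0.
  by rewrite -[X in _ --> X](mulr0 0); apply: cvgM.
Qed.

Lemma is_L2_fourier_FT f g : is_L2_fourier f g -> aeeq (FT f) g.
Proof.
move=> [Lf Lg H]; apply: (@FT_unique f g (fun n => trunc n f)) => //.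
- by move=> n; exact: L12_trunc.
- exact: trunc_cvg.
have LF n : L2 (fourier (trunc n f)) by apply: L2_fourier; exact: L12_trunc.
apply/(L2cvgE LF Lg); apply: (H (fun n => trunc n f)) => [n|].
  exact: L12_trunc.
by apply/(L2cvgE (fun n => L2_trunc n Lf) Lf); exact: trunc_cvg.
Qed.

Lemma parseval_ifourier (u v : R -> R[i]) : L12 u -> L12 v ->
  inner (ifourier u) (ifourier v) = inner u v.
Proof.
move=> /L12J Lu /L12J Lv.
have E (a b : R -> R[i]) :
    inner (fun t => conjc (a t)) (fun t => conjc (b t)) = conjc (inner a b).
  by rewrite /inner -cintegralJ; apply: eq_cintegral => t; rewrite conjcM.
have [Lu2 Lv2] := (Lu.2, Lv.2).
rewrite /ifourier E.
rewrite -(inner_ae (L2_FT Lu2) (L2_FT Lv2) _ _ (FT_fourier Lu) (FT_fourier Lv)).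
- rewrite plancherel// -E; apply: eq_cintegral => t.
  by rewrite !conjcK.
- exact: L2_measurable (L2_fourier Lu).
- exact: L2_measurable (L2_fourier Lv).
Qed.

End plancherel.

(** * The frequency weight *)

Section frequency_weight.
Context {R : realType}.
Variable alpha : R.
Hypotheses (alpha_ge0 : 0 <= alpha) (alpha_lt1 : alpha < 1).
Notation mu := (@lebesgue_measure R).
Implicit Types (w xi y : R).

Definition weight w : R := (1 + `|w|) `^ alpha.

Lemma base_ge1 w : 1 <= 1 + `|w|. Proof. by rewrite lerDl. Qed.

Lemma base_gt0 w : 0 < 1 + `|w|. Proof. by rewrite ltr_pwDl. Qed.

Lemma betaE w : beta alpha w = (weight w)^-1.
Proof. by rewrite /beta powRN. Qed.

Lemma weight_gt0 w : 0 < weight w.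
Proof. by rewrite powR_gt0// base_gt0. Qed.

Lemma weight_ge1 w : 1 <= weight w.
Proof. by rewrite -(powRr0 (1 + `|w|)) ler_powR// base_ge1. Qed.

Lemma weight_le w : weight w <= 1 + `|w|.
Proof. by rewrite ler1_powR ?base_ge1// ltW. Qed.

Lemma weight_ge_scale (s w w' : R) : 0 < s <= 1 ->
  s * (1 + `|w'|) <= 1 + `|w| -> s * weight w' <= weight w.
Proof.
move=> /andP[s0 s1] h.
apply: (@le_trans _ _ ((s * (1 + `|w'|)) `^ alpha)).
  rewrite powRM ?(ltW s0) ?(ltW (base_gt0 w'))// /weight ler_wpM2r ?powR_ge0//.
  by rewrite ger1_powR ?s0// ltW.
by rewrite ge0_ler_powR// nnegrE ?mulr_ge0// ltW// base_gt0.
Qed.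

Lemma weight_le_scale (s w : R) (b : R) : 1 <= s -> 0 <= b ->
  1 + `|w| <= s * b -> weight w <= s * b `^ alpha.
Proof.
move=> s1 b0 h; have s0 : 0 <= s by exact: le_trans s1.
apply: (@le_trans _ _ ((s * b) `^ alpha)).
  by rewrite ge0_ler_powR// nnegrE ?mulr_ge0// ltW// base_gt0.
by rewrite powRM// ler_wpM2r ?powR_ge0// ler1_powR// ltW.
Qed.

(** The weight grows at most like the power [alpha] of the distance. *)
Lemma weight_triangle xi w :
  weight w <= 2 * weight xi + 2 * `|xi - w| `^ alpha.
Proof.
have tri : 1 + `|w| <= (1 + `|xi|) + `|xi - w|.
  have : `|w| <= `|xi| + `|xi - w|.
    by rewrite -{1}[w](subKr xi) (le_trans (ler_normB _ _)).
  lra.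
have w0 := weight_gt0 xi; have p0 := powR_ge0 `|xi - w| alpha.
have [h|h] := leP `|xi - w| (1 + `|xi|).
  have : weight w <= 2 * weight xi.
    apply: (@weight_le_scale 2 w (1 + `|xi|)); [by rewrite ler1n| |lra].
    exact: ltW (base_gt0 xi).
  lra.
have : weight w <= 2 * `|xi - w| `^ alpha.
  by apply: (@weight_le_scale 2 w `|xi - w|); [rewrite ler1n| |lra].
lra.
Qed.

(** The contribution of the frequencies at distance [y]; it is integrable
    because [alpha < 1]. *)
Definition tail (y : R) : R := weight y / (1 + `|y|) ^+ 2.

Lemma tail_ge0 y : 0 <= tail y.
Proof. by rewrite divr_ge0 ?sqr_ge0// ltW// weight_gt0. Qed.

Lemma tailE y : tail y = (1 + `|y|) `^ (alpha - 2).
Proof.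
rewrite /tail /weight powRD; last first.
  by apply/implyP => _; rewrite gt_eqF ?base_gt0.
by rewrite powRN powR_mulrn// ltW// base_gt0.
Qed.

(** Let [K = weight xi]. At distance at most [K / 2] the weights of [w] and
    [xi] are comparable, and the left-hand side is at most a bump of width [K]
    and height of order [K^-1]. Written as a Poisson kernel, the bump has an
    integral that does not depend on [K], which is what makes the resulting
    bound uniform in [xi]. Farther away, [weight_triangle] leaves a term [K /
    y ^+ 2], absorbed by the same kernel, and the tail. *)
Lemma weighted_decay_bound xi w :
  weight w / (weight w + `|xi - w|) ^+ 2 <=
  10 * pi * poisson (2 * pi * weight xi) (xi - w) + 18 * tail (xi - w).
Proof.
set B := weight w; set K := weight xi; set y := `|xi - w|.
have B0 : 0 < B := weight_gt0 w. have K0 : 0 < K := weight_gt0 xi.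
have y0 : 0 <= y by exact: normr_ge0.
have -> : 10 * pi * poisson (2 * pi * K) (xi - w) = 10 * K / (K ^+ 2 + y ^+ 2).
  rewrite /poisson /y real_normK ?num_real//; set u := xi - w.
  have : 0 < K ^+ 2 + u ^+ 2 by rewrite ltr_pwDl ?sqr_ge0// exprn_gt0.
  move: (pi : R) (pi_gt0 R) => p p0 D0; field.
  rewrite gt_eqF// gt_eqF//.
  by rewrite (_ : _ + _ = p ^+ 2 * 4 * (K ^+ 2 + u ^+ 2)); [rewrite !mulr_gt0// exprn_gt0|ring].
have t0 := tail_ge0 (xi - w).
have D0 : 0 < K ^+ 2 + y ^+ 2 by rewrite ltr_pwDl ?sqr_ge0// exprn_gt0.
have By0 : 0 < B + y by rewrite ltr_pwDl.
(* nearby, the weight of [w] is at least [K / 2] *)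
have [near|far] := leP y (K / 2).
  have KB : K / 2 <= B.
    rewrite mulrC; apply: weight_ge_scale; first by rewrite invr_gt0 invf_le1// ler1n ltr0n.
    have := weight_le xi; rewrite -/K => Kle.
    have : `|xi| <= `|w| + y by rewrite -{1}[xi](subrK w) addrC ler_normD.
    lra.
  apply: (@le_trans _ _ (10 * K / (K ^+ 2 + y ^+ 2))); last by rewrite lerDl mulr_ge0.
  rewrite ler_pdivrMr ?exprn_gt0// mulrAC ler_pdivlMr//.
  apply: (@le_trans _ _ (B * (5 / 4 * K ^+ 2))).
    rewrite ler_pM2l//; nra.
  apply: (@le_trans _ _ (10 * K * B ^+ 2)).
    rewrite -subr_ge0.
    have -> : 10 * K * B ^+ 2 - B * (5 / 4 * K ^+ 2) =
        10 * (K * B) * (B - K / 2) + 15 / 4 * (B * K ^+ 2) by field.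
    by rewrite addr_ge0// mulr_ge0// ?mulr_ge0 ?sqr_ge0 ?subr_ge0// ltW.
  rewrite ler_pM2l ?mulr_gt0//.
  by rewrite lerXn2r ?nnegrE ?lerDl ?(ltW B0) ?(ltW By0).
have K1 : 1 <= K := weight_ge1 xi.
have yp : 0 < y by lra.
have Bt : B <= 2 * K + 2 * y `^ alpha := weight_triangle xi w.
apply: (@le_trans _ _ ((2 * K + 2 * y `^ alpha) / y ^+ 2)).
  apply: ler_pM => //; [exact: ltW|by rewrite invr_ge0 sqr_ge0|].
  rewrite lef_pV2 ?posrE ?exprn_gt0//.
  by rewrite lerXn2r ?nnegrE ?lerDr ?(ltW B0) ?(ltW By0).
rewrite mulrDl lerD//.
  rewrite ler_pdivrMr ?exprn_gt0// mulrAC ler_pdivlMr// -subr_ge0.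
  have -> : 10 * K * y ^+ 2 - 2 * K * (K ^+ 2 + y ^+ 2) =
      8 * K * (y - K / 2) * (y + K / 2) by field.
  by rewrite !mulr_ge0 ?subr_ge0 ?addr_ge0 ?divr_ge0 ?(ltW K0) ?(ltW far).
have yb : y `^ alpha <= weight (xi - w).
  by rewrite /weight ge0_ler_powR ?nnegrE// ?addr_ge0// lerDr.
have b0 := base_gt0 (xi - w).
rewrite /tail -/y ler_pdivrMr ?exprn_gt0//.
have -> : 18 * (weight (xi - w) / (1 + y) ^+ 2) * y ^+ 2 =
   2 * weight (xi - w) * ((3 * y) ^+ 2 / (1 + y) ^+ 2).
  by field; rewrite gt_eqF.
apply: (@le_trans _ _ (2 * weight (xi - w))); first by rewrite ler_pM2l.
rewrite ler_peMr ?mulr_ge0 ?(ltW (weight_gt0 _))//.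
rewrite ler_pdivlMr ?exprn_gt0// mul1r.
by rewrite lerXn2r ?nnegrE ?addr_ge0 ?mulr_ge0//; lra.
Qed.

Lemma continuous_base : continuous (fun y : R => 1 + `|y|).
Proof. by move=> y; apply: cvgD; [exact: cvg_cst|exact: norm_continuous]. Qed.

Lemma continuous_base_powR (p : R) : continuous (fun y : R => (1 + `|y|) `^ p).
Proof.
move=> y; apply: (@continuous_comp _ _ _ (fun y : R => 1 + `|y|) (fun x => x `^ p)).
  exact: continuous_base.
apply: differentiable_continuous; apply/derivable1_diffP.
by have [] := is_derive1_powR p (base_gt0 y).
Qed.

Lemma continuous_tail : continuous tail.
Proof. by rewrite (funext tailE); exact: continuous_base_powR. Qed.

Lemma measurable_tail : measurable_fun setT tail.
Proof. by apply: continuous_measurable_fun; exact: continuous_tail. Qed.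

Lemma cvg_powR_neg (p : R) : p < 0 -> (1 + x) `^ p @[x --> +oo] --> (0 : R).
Proof.
move=> p0; apply/cvgrPdist_le => e e0.
have pn0 : p != 0 by rewrite lt_eqF.
set N := e `^ p^-1.
have Np : N `^ p = e by rewrite -powRrM mulVf// powRr1// ltW.
have N0 : 0 < N by rewrite powR_gt0.
near=> x.
have x0 : 0 < x by near: x; exact: nbhs_pinfty_gt.
rewrite sub0r normrN ger0_norm ?powR_ge0// -Np.
have Nx : N <= 1 + x.
  apply: (@le_trans _ _ x); last by rewrite lerDr.
  by near: x; apply: nbhs_pinfty_ge; exact: num_real.
have [q q0 ->] : exists2 q, 0 <= q & p = - q.
  by exists (- p); rewrite ?opprK// oppr_ge0 ltW.
have x1 : 0 < 1 + x by exact: lt_le_trans Nx.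
rewrite !powRN lef_pV2 ?posrE ?powR_gt0//.
by rewrite ge0_ler_powR// nnegrE ltW.
Unshelve. all: by end_near. Qed.

Lemma integral_tail : (\int[mu]_y (tail y)%:E = (2 / (1 - alpha))%:E)%E.
Proof.
rewrite (ge0_symfun_integralT tail_ge0 continuous_tail); last first.
  by move=> y; rewrite /tail /weight /= normrN.
have p0 : alpha - 1 < 0 by rewrite subr_lt0.
pose F x := (1 + x) `^ (alpha - 1) / (alpha - 1).
have dF (x : R) : 0 <= x -> is_derive x 1 F ((1 + x) `^ (alpha - 2)).
  move=> x0; have bx : 0 < 1 + x by rewrite ltr_pwDl.
  have H := is_derive1_powR (alpha - 1) bx.
  have s1 : is_derive x 1 (fun y : R => 1 + y) 1.
    have := is_deriveD (is_derive_cst (1 : R) x 1) (is_derive_id x (1 : R)).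
    by rewrite add0r.
  have := is_derive1_comp H s1 => H2.
  apply: is_derive_eq (is_deriveM H2 (is_derive_cst (alpha - 1)^-1 x 1)) _.
  rewrite /GRing.scale /= (_ : alpha - 1 - 1 = alpha - 2); last by ring.
  by move: (_ `^ _) (_ `^ _) => q q'; field; rewrite lt_eqF.
have cF (x : R) : 0 <= x -> {for x, continuous F}.
  move=> /dF[d _].
  by apply: differentiable_continuous; exact/derivable1_diffP.
rewrite -set_itvcy (ge0_continuous_FTC2y (F := F) (l := 0)).
- rewrite /F addr0 powR1 mul1r sub0e -EFinN -EFinM; congr EFin.
  by field; rewrite subr_eq0 gt_eqF//= subr_eq0 lt_eqF.
- by move=> x _; exact: tail_ge0.
- by apply: continuous_subspaceT; exact: continuous_tail.
- rewrite -[X in _ --> X](mul0r (alpha - 1)^-1); apply: cvgM; last exact: cvg_cst.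
  exact: cvg_powR_neg.
- by move=> x x0; case: (dF x (ltW x0)).
- exact/cvg_at_right_filter/cF.
- move=> x; rewrite in_itv/= andbT => x0; rewrite derive1E tailE gtr0_norm//.
  by case: (dF x (ltW x0)).
Qed.

Lemma integral_dominating xi :
  (\int[mu]_w (10 * pi * poisson (2 * pi * weight xi) (xi - w) +
     18 * tail (xi - w))%:E = (10 * pi + 36 / (1 - alpha))%:E)%E.
Proof.
have e0 : 0 < 2 * pi * weight xi by rewrite !mulr_gt0 ?pi_gt0 ?weight_gt0.
have mP : measurable_fun setT (fun w => (poisson (2 * pi * weight xi) (xi - w))%:E).
  apply/measurable_EFinP; apply: (measurableT_comp (measurable_poisson e0)).
  exact: measurable_funB.
have mT : measurable_fun setT (fun w => (tail (xi - w))%:E).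
  apply/measurable_EFinP; apply: (measurableT_comp measurable_tail).
  exact: measurable_funB.
under eq_integral do rewrite EFinD !(EFinM _ (poisson _ _)) (EFinM _ (tail _)).
rewrite ge0_integralD//; last 4 first.
- move=> w _; apply: mule_ge0; rewrite lee_fin.
    by rewrite mulr_ge0// pi_ge0.
  exact: poisson_ge0 _ e0.
- by apply: emeasurable_funM; [exact: measurable_cst|exact: mP].
- by move=> w _; apply: mule_ge0; rewrite lee_fin// tail_ge0.
- by apply: emeasurable_funM; [exact: measurable_cst|exact: mT].
rewrite ge0_integralZl_EFin//; last 2 first.
- by move=> w _; rewrite lee_fin; exact: poisson_ge0 _ e0.
- by rewrite mulr_ge0// pi_ge0.
rewrite ge0_integralZl_EFin//; last first.
- by move=> w _; rewrite lee_fin tail_ge0.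
rewrite integral_poisson_shift// mule1.
have -> : (\int[mu]_w (tail (xi - w))%:E = (2 / (1 - alpha))%:E)%E.
  rewrite -integral_tail [RHS](@ge0_integral_affine R (-1) xi) ?oppr_eq0//.
  - rewrite normrN normr1 mul1e; apply: eq_integral => y _.
    by rewrite mulN1r addrC.
  - by apply/measurable_EFinP; exact: measurable_tail.
  - by move=> u; rewrite lee_fin tail_ge0.
rewrite -EFinM -EFinD; congr EFin.
by field; rewrite subr_eq0 gt_eqF.
Qed.

End frequency_weight.

(** * Two-sided bounds of the symbol *)

Section symbol.
Context {R : realType}.
Variable alpha : R.
Hypotheses (alpha_ge0 : 0 <= alpha) (alpha_lt1 : alpha < 1).
Notation mu := (@lebesgue_measure R).
Implicit Types (w xi y : R) (h : R -> R[i]).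

Lemma beta_gt0 w : 0 < beta alpha w.
Proof. by rewrite /beta powR_gt0// base_gt0. Qed.

Lemma measurable_beta : measurable_fun setT (beta alpha).
Proof. by apply: continuous_measurable_fun; exact: continuous_base_powR. Qed.

(** When [h] is the transform of [psi], the squared modulus at frequency [p.1]
    of the transform of an atom centered at frequency [p.2]. *)
Definition density h (p : R * R) : R :=
  beta alpha p.2 * normc (h (beta alpha p.2 * (p.1 - p.2))) ^+ 2.

Definition symbol h xi : R := Rintegral mu setT (fun w => density h (xi, w)).

Lemma density_ge0 h p : 0 <= density h p.
Proof. by rewrite mulr_ge0 ?sqr_ge0// ltW// beta_gt0. Qed.

Lemma measurable_dilated_frequency :
  measurable_fun setT (fun p : R * R => beta alpha p.2 * (p.1 - p.2)).
Proof.
apply: measurable_funM; last by apply: measurable_funB.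
exact: measurableT_comp measurable_beta measurable_snd.
Qed.

Lemma measurable_density h : cmeasurable h ->
  measurable_fun setT (density h).
Proof.
move=> mh; apply: measurable_funM.
  exact: measurableT_comp measurable_beta measurable_snd.
apply: measurable_nrmc_sqr; apply: cmeasurable_comp mh _.
exact: measurable_dilated_frequency.
Qed.

Lemma measurable_density_section h xi : cmeasurable h ->
  measurable_fun setT (fun w => density h (xi, w)).
Proof.
move=> /measurable_density mh.
exact: (measurableT_comp mh (pair1_measurable xi)).
Qed.

Lemma measurable_symbol h : cmeasurable h -> measurable_fun setT (symbol h).
Proof.
by move=> mh; apply: measurable_Rintegral_param; exact: measurable_density.
Qed.

Section upper_bound.
Variables (h : R -> R[i]) (C r : R).
Hypotheses (mh : cmeasurable h) (C_ge0 : 0 <= C) (r_ge1 : 1 <= r).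
Hypothesis decay : forall y, normc (h y) <= C * (1 + `|y|) `^ (- r).

Lemma decay_inv y : normc (h y) <= C / (1 + `|y|).
Proof.
apply: le_trans (decay y) _; rewrite ler_wpM2l//.
rewrite -powR_inv1; last by rewrite ltW// base_gt0.
by rewrite ler_powR ?base_ge1// lerN2.
Qed.

Lemma density_le xi w : density h (xi, w) <=
  C ^+ 2 * (10 * pi * poisson (2 * pi * weight alpha xi) (xi - w) +
            18 * tail alpha (xi - w)).
Proof.
apply: le_trans (ler_wpM2l (sqr_ge0 C) (weighted_decay_bound alpha_ge0 alpha_lt1 xi w)).
have W0 := weight_gt0 alpha w; rewrite /density /= betaE.
have := decay_inv ((weight alpha w)^-1 * (xi - w)).
rewrite normrM gtr0_norm ?invr_gt0//.
move: (normc _) (nrmc_ge0 (h ((weight alpha w)^-1 * (xi - w)))) => n n0 hn.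
have y0 : 0 <= `|xi - w| by [].
move: (weight alpha w) `|xi - w| W0 y0 hn => W y W0 y0 hn.
have Wy : 0 < W + y by rewrite ltr_pwDl.
have hn' : n <= C * W / (W + y).
  rewrite (_ : C * W / (W + y) = C / (1 + W^-1 * y))//; field.
  by rewrite !gt_eqF.
have -> : C ^+ 2 * (W / (W + y) ^+ 2) = W^-1 * (C * W / (W + y)) ^+ 2.
  by field; rewrite !gt_eqF.
by rewrite ler_pM2l ?invr_gt0// lerXn2r// nnegrE (le_trans n0).
Qed.

Lemma integral_density_le xi :
  (\int[mu]_w (density h (xi, w))%:E <=
   (C ^+ 2 * (10 * pi + 36 / (1 - alpha)))%:E)%E.
Proof.
have e0 : 0 < 2 * pi * weight alpha xi by rewrite !mulr_gt0 ?pi_gt0 ?weight_gt0.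
rewrite EFinM -(integral_dominating alpha_lt1 xi).
have mD : measurable_fun setT (fun w : R => (10 * pi * poisson (2 * pi * weight alpha xi)
   (xi - w) + 18 * tail alpha (xi - w))%:E).
  apply/measurable_EFinP; apply: measurable_funD; apply: measurable_funM => //.
    apply: (measurableT_comp (measurable_poisson e0)); exact: measurable_funB.
  apply: (measurableT_comp (measurable_tail alpha)); exact: measurable_funB.
have D0 (w : R) : (0 <= (10 * pi * poisson (2 * pi * weight alpha xi)
   (xi - w) + 18 * tail alpha (xi - w))%:E)%E.
  rewrite lee_fin addr_ge0// mulr_ge0 ?tail_ge0//; last exact: poisson_ge0 _ e0.
  by rewrite mulr_ge0// pi_ge0.
rewrite -ge0_integralZl_EFin//; last exact: sqr_ge0.
apply: ge0_le_integral => //.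
- by move=> w _; rewrite lee_fin density_ge0.
- by apply/measurable_EFinP; exact: measurable_density_section.
- by apply: emeasurable_funM; [exact: measurable_cst|exact: mD].
- by move=> w _; rewrite -EFinM lee_fin density_le.
Qed.

Lemma integral_densityE xi :
  (\int[mu]_w (density h (xi, w))%:E = (symbol h xi)%:E)%E.
Proof.
rewrite /symbol /Rintegral fineK// ge0_fin_numE.
  exact: le_lt_trans (integral_density_le xi) (ltry _).
by apply: integral_ge0 => w _; rewrite lee_fin density_ge0.
Qed.

Lemma symbol_le xi : symbol h xi <= C ^+ 2 * (10 * pi + 36 / (1 - alpha)).
Proof. by rewrite -lee_fin -integral_densityE integral_density_le. Qed.

End upper_bound.

Lemma continuous_weight : continuous (weight alpha).
Proof. exact: continuous_base_powR. Qed.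

(** The weight is of lower order than the frequency, because [alpha < 1]. *)
Lemma weight_sublinear (c : R) :
  exists2 N, 0 < N & forall w, N <= `|w| -> c * weight alpha w <= (1 + `|w|) / 2.
Proof.
have p0 : alpha - 1 < 0 by rewrite subr_lt0.
have e0 : 0 < (2 * (1 + `|c|))^-1 by rewrite invr_gt0 mulr_gt0// base_gt0.
have := cvg_powR_neg p0 => /cvgrPdist_le/(_ _ e0)[N [_ hN]].
exists (1 + `|N|); first exact: base_gt0.
move=> w Nw; have := hN `|w|.
have -> : N < `|w| by apply: lt_le_trans Nw; rewrite (le_lt_trans (ler_norm N))// ltrDr.
move=> /(_ isT); rewrite sub0r normrN ger0_norm ?powR_ge0// => h.
have b0 := base_gt0 w.
have -> : weight alpha w = (1 + `|w|) * (1 + `|w|) `^ (alpha - 1).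
  rewrite -[X in X * _](powRr1 (ltW b0)) -powRD; last first.
    by apply/implyP => _; rewrite gt_eqF.
  by rewrite addrCA subrr addr0.
rewrite mulrCA ler_pM2l//.
have c1 := base_gt0 c.
have cc : c <= 1 + `|c| by have := ler_norm c; lra.
apply: le_trans (ler_wpM2r (powR_ge0 _ _) cc) _.
apply: le_trans (ler_wpM2l (ltW c1) h) _.
by rewrite invfM mulrCA divff ?mulr1 ?gt_eqF.
Qed.

(** By sublinearity of the weight the left-hand side is below [xi] for very
    negative [w] and above it for very large [w]; the intermediate value
    theorem applies. *)
Lemma frequency_center (c xi : R) : exists w, w + c * weight alpha w = xi.
Proof.
have [N N0 hN] := weight_sublinear `|c|.
pose b := N + 2 * `|xi| + 1.
have b0 : 0 < b by rewrite /b; have := normr_ge0 xi; lra.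
pose k w := w + c * weight alpha w.
have hb w : `|w| = b -> `|k w - w| <= b - `|xi|.
  move=> wb; rewrite /k addrAC subrr add0r normrM (gtr0_norm (weight_gt0 _ _)).
  have := hN w; rewrite wb => /(_ _)/le_trans; apply.
    by rewrite /b; have := normr_ge0 xi; lra.
  by rewrite /b; have := normr_ge0 xi; lra.
have k1 : k b >= xi.
  have := hb b (gtr0_norm b0); rewrite ler_norml => /andP[+ _].
  have := ler_norm xi; lra.
have k2 : k (- b) <= xi.
  have := hb (- b); rewrite normrN gtr0_norm// => /(_ erefl).
  rewrite ler_norml => /andP[_].
  have := ler_norm (- xi); rewrite normrN; lra.
have bb : - b <= b by lra.
have [||w _ <-] := @IVT R k (- b) b xi bb; last by exists w.
  apply: continuous_subspaceT => w; apply: cvgD; first exact: cvg_id.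
  by apply: cvgM; [exact: cvg_cst|exact: continuous_weight].
by rewrite ge_min k2 le_max k1 orbT.
Qed.

(** Around a solution [w1] of [w + c * weight w = xi], where the window is
    evaluated at [c], the frequencies at which it is evaluated within [rho] of
    [c] contain an interval of length proportional to [weight w1]. This
    compensates the factor [beta w] in the density. *)
Lemma symbol_lower_bound h (c rho eps : R) :
  cmeasurable h -> 0 < rho -> 0 < eps ->
  (forall y, `|y - c| <= rho -> eps <= normc (h y) ^+ 2) ->
  exists2 m : R, 0 < m &
    forall xi, (m%:E <= \int[mu]_w (density h (xi, w))%:E)%E.
Proof.
move=> mh rho0 eps0 hh.
have c1 : 0 < 1 + `|c| := base_gt0 c.
pose dl := Num.min 2^-1 (rho / (2 * (1 + `|c|))).
have dl0 : 0 < dl by rewrite lt_min invr_gt0 ltr0n/= divr_gt0// mulr_gt0.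
have dl_half : dl <= 2^-1 by rewrite /dl ge_min lexx.
have dl_rho : dl * (2 * (1 + `|c|)) <= rho.
  by rewrite -ler_pdivlMr ?mulr_gt0// /dl ge_min lexx orbT.
exists (eps * dl); first by rewrite mulr_gt0.
move=> xi; have [w1 hw1] := frequency_center c xi.
set W := weight alpha w1.
have W0 : 0 < W := weight_gt0 alpha w1.
have W1 : W <= 1 + `|w1| := weight_le alpha_lt1 w1.
pose D := [set` `[w1 - dl * W, w1 + dl * W]] : set R.
have muD : mu D = (2 * dl * W)%:E.
  rewrite /D lebesgue_measure_itv/= lte_fin ifT; last first.
    by have := mulr_gt0 dl0 W0; lra.
  by rewrite -EFinB; congr EFin; ring.
have mdens := measurable_density_section xi mh.
apply: (@le_trans _ _ (\int[mu]_(w in D) (density h (xi, w))%:E)%E); last first.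
  apply: ge0_subset_integral => //.
  - exact: measurable_itv.
  - by apply/measurable_EFinP.
  - by move=> w _; rewrite lee_fin density_ge0.
apply: (@le_trans _ _ (\int[mu]_(w in D) (cst (eps / (2 * W))%:E w))%E).
  rewrite integral_cst; last exact: measurable_itv.
  rewrite (_ : (eps * dl)%:E = ((eps / (2 * W))%:E * mu D)%E)// muD.
  by rewrite -EFinM; congr EFin; field; rewrite gt_eqF.
apply: ge0_le_integral.
- exact: measurable_itv.
- by move=> w _; rewrite lee_fin divr_ge0 ?mulr_ge0 ?ltW.
- exact: measurable_cst.
- by apply: measurable_funTS; apply/measurable_EFinP.
move=> w; rewrite /D /= in_itv/= => /andP[wl wr]; rewrite lee_fin.
have wd : `|w - w1| <= dl * W by rewrite ler_distl wl wr.
have dW : dl * W <= dl * (1 + `|w1|) by rewrite ler_pM2l.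
(* on the interval the weight changes at most by the factors [1 + dl] and
   [1 - dl], because [W <= 1 + `|w1|] *)
have up : weight alpha w <= (1 + dl) * W.
  apply: (weight_le_scale alpha_ge0 alpha_lt1); rewrite ?lerDl ?(ltW dl0)//.
  have : `|w| <= `|w1| + `|w - w1| by rewrite -{1}(subrKC w1 w) ler_normD.
  lra.
have lo : (1 - dl) * W <= weight alpha w.
  apply: (weight_ge_scale alpha_ge0 alpha_lt1); first by apply/andP; lra.
  have : `|w1| <= `|w| + `|w - w1| by rewrite -{1}(subrKC w w1) distrC ler_normD.
  lra.
have B0 : 0 < weight alpha w := weight_gt0 alpha w.
rewrite /density /= betaE [X in _ <= X]mulrC.
apply: (@le_trans _ _ (eps * (weight alpha w)^-1)).
  rewrite ler_pM2l// lef_pV2 ?posrE ?mulr_gt0//.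
  apply: le_trans up _; rewrite ler_pM2r//; lra.
rewrite ler_pM2r ?invr_gt0//; apply: hh.
(* the equation for [w1] turns the deviation from [c] into increments of [w]
   and of the weight *)
have -> : (weight alpha w)^-1 * (xi - w) - c =
    ((w1 - w) + c * (W - weight alpha w)) / weight alpha w.
  by rewrite -hw1 -/W; field; rewrite gt_eqF.
rewrite normrM [X in _ * X]gtr0_norm ?invr_gt0// ler_pdivrMr//.
have hW : `|W - weight alpha w| <= dl * W by rewrite ler_norml; apply/andP; lra.
apply: (@le_trans _ _ (dl * W * (1 + `|c|))).
  apply: le_trans (ler_normD _ _) _; rewrite [X in _ <= X]mulrDr mulr1 (distrC w1 w).
  by apply: lerD => //; rewrite normrM mulrC ler_wpM2r.
apply: (@le_trans _ _ (rho / 2 * W)).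
  have -> : dl * W * (1 + `|c|) = dl * (2 * (1 + `|c|)) / 2 * W by field.
  by rewrite ler_pM2r// ler_pM2r// invr_gt0.
rewrite -mulrA ler_pM2l//.
apply: le_trans lo; rewrite ler_pM2r//; lra.
Qed.

End symbol.

Lemma continuous_nrmc (R : realType) (h : R -> R[i]) :
  continuous (h : R -> (R[i] : numFieldType)) ->
  continuous (fun y => normc (h y)).
Proof.
move=> ch c; apply/cvgrPdist_lt => e e0.
have := ch c => /cvgrPdist_lt/(_ e%:C); rewrite ltcR => /(_ e0).
apply: filterS => y; rewrite -[`|_|]/((normc (h c - h y))%:C) ltcR => hy.
apply: le_lt_trans hy.
have n1 := nrmcD (h c - h y) (h y).
have n2 := nrmcD (h y - h c) (h c).
rewrite !subrK in n1 n2; rewrite -opprB nrmcN in n2.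
by rewrite ler_norml; apply/andP; lra.
Qed.

(** * Fourier multipliers *)

Section fourier_multiplier.
Context {R : realType}.
Notation mu := (@lebesgue_measure R).
Implicit Types (a b : R -> R) (f g : R -> R[i]).

Definition multiplier a f : R -> R[i] := iFT (fun xi => (a xi)%:C * FT f xi).

Lemma L2_real_mul a (K : R) f : measurable_fun setT a ->
  (forall xi, `|a xi| <= K) -> L2 f ->
  L2 (fun xi => (a xi)%:C * f xi) /\
  nrm2 (fun xi => (a xi)%:C * f xi) <= K ^+ 2 * nrm2 f.
Proof.
move=> ma aK Lf.
apply: (@L2_bounded_mul R (fun xi => (a xi)%:C) K f (cmeasurable_real ma)) => //.
by move=> xi; rewrite nrmc_real.
Qed.

Lemma bounded_multiplier a (K : R) : measurable_fun setT a ->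
  (forall xi, `|a xi| <= K) -> bounded_operator (multiplier a).
Proof.
move=> ma aK.
have La f : L2 f -> L2 (fun xi => (a xi)%:C * FT f xi).
  by move=> Lf; exact: (L2_real_mul ma aK (L2_FT Lf)).1.
have K0 : 0 <= K by exact: le_trans (aK 0).
split.
- by move=> f Lf; exact: L2_iFT (La f Lf).
- move=> f g Lf Lg fg; apply: iFT_ae; [exact: La|exact: La|].
  by apply: filterS (FT_ae Lf Lg fg) => xi ->.
- move=> c f g Lf Lg; have Lcfg := (L2D (L2Z c Lf) Lg).1.
  apply: aeeq_trans (iFT_linear c (La f Lf) (La g Lg)).
  apply: iFT_ae; [exact: La|exact: (L2D (L2Z c (La f Lf)) (La g Lg)).1|].
  by apply: filterS (FT_linear c Lf Lg) => xi ->; rewrite mulrDr mulrCA.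
- exists K => f Lf; rewrite !L2norm_nrm2//; last exact: L2_iFT (La f Lf).
  rewrite -EFinM lee_fin nrm2_iFT; last exact: La.
  apply: le_trans (ler_wsqrtr (L2_real_mul ma aK (L2_FT Lf)).2) _.
  by rewrite sqrtrM ?sqr_ge0// sqrtr_sqr ger0_norm// nrm2_FT.
Qed.

Lemma multiplierK a b (K : R) f :
  measurable_fun setT a -> measurable_fun setT b ->
  (forall xi, `|a xi| <= K) -> (forall xi, `|b xi| <= K) ->
  (forall xi, a xi * b xi = 1) ->
  L2 f -> aeeq (multiplier a (multiplier b f)) f.
Proof.
move=> ma mb aK bK ab1 Lf.
have Lb := (L2_real_mul mb bK (L2_FT Lf)).1.
apply: aeeq_trans (iFTK Lf); apply: iFT_ae.
- by apply: (L2_real_mul ma aK _).1; apply: L2_FT; exact: L2_iFT.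
- exact: L2_FT.
apply: filterS (FTK Lb) => xi; rewrite /multiplier => ->.
by rewrite mulrA -rmorphM ab1 mul1r.
Qed.

(** The inverse is the multiplier by the reciprocal, which is bounded by
    [c^-1]. *)
Lemma invertible_multiplier a (c K : R) : measurable_fun setT a -> 0 < c ->
  (forall xi, c <= a xi <= K) -> boundedly_invertible (multiplier a).
Proof.
move=> ma c0 aK; have a0 xi : 0 < a xi.
  by have /andP[ca _] := aK xi; exact: lt_le_trans ca.
have mb : measurable_fun setT (fun xi => (a xi)^-1).
  rewrite (_ : (fun xi => _) = fun xi => a xi `^ (-1)); last first.
    by apply/funext => xi; rewrite powR_inv1 ?ltW.
  exact: measurableT_comp (measurable_powR _) ma.
have hb xi : `|(a xi)^-1| <= c^-1.
  rewrite gtr0_norm ?invr_gt0// lef_pV2 ?posrE//.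
  by have /andP[] := aK xi.
have ha xi : `|a xi| <= K by rewrite gtr0_norm//; have /andP[] := aK xi.
exists (multiplier (fun xi => (a xi)^-1)); first exact: bounded_multiplier hb.
have ha' xi : `|a xi| <= Num.max K c^-1 by rewrite le_max ha.
have hb' xi : `|(a xi)^-1| <= Num.max K c^-1 by rewrite le_max hb orbT.
move=> f Lf; split; apply: (multiplierK (K := Num.max K c^-1)) => //.
- by move=> xi; rewrite divff// gt_eqF.
- by move=> xi; rewrite mulVf// gt_eqF.
Qed.

Lemma inner_multiplier a (K : R) f g : measurable_fun setT a ->
  (forall xi, `|a xi| <= K) -> L2 f -> L2 g ->
  inner (multiplier a f) g = inner (fun xi => (a xi)%:C * FT f xi) (FT g).
Proof.
move=> ma aK Lf Lg; have La := (L2_real_mul ma aK (L2_FT Lf)).1.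
by rewrite innerJ -FT_adjoint// -innerJ.
Qed.

End fourier_multiplier.

(** * Atoms and their spectra *)

Section atoms.
Context {R : realType}.
Variable alpha : R.
Notation mu := (@lebesgue_measure R).
Implicit Types (f g h : R -> R[i]) (w x xi : R).

(** Atoms and their spectra share this form: an affine substitution followed
    by a factor whose modulus restores the norm. *)
Lemma L2_modulated_affine (a b k : R) (m : R -> R[i]) f : a != 0 ->
  cmeasurable m -> (forall t, normc (m t) <= k) -> k ^+ 2 = `|a| -> L2 f ->
  L2 (fun t => m t * f (a * t + b)) /\
  nrm2 (fun t => m t * f (a * t + b)) <= nrm2 f.
Proof.
move=> a0 mm mk ka Lf; have [La ->] := L2_affine b a0 Lf.
by rewrite -ka; exact: L2_bounded_mul.
Qed.

Lemma atomE f x w t : atom alpha f x w t =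
  (expi (2 * pi * w * (t - x)) * ((Num.sqrt (beta alpha w))^-1)%:C) *
  f ((beta alpha w)^-1 * t + - (x / beta alpha w)).
Proof.
rewrite /atom /translation /modulation /dilation mulrA.
by rewrite mulrBl [t / _]mulrC.
Qed.

Lemma atom_nrm2 f x w : L2 f ->
  L2 (atom alpha f x w) /\ nrm2 (atom alpha f x w) <= nrm2 f.
Proof.
move=> Lf; have b0 := beta_gt0 alpha w.
rewrite (funext (atomE f x w)).
apply: (@L2_modulated_affine _ _ (Num.sqrt (beta alpha w))^-1
  (fun t => expi (2 * pi * w * (t - x)) * _)) => //.
- by rewrite invr_eq0 gt_eqF.
- apply: cmeasurableM; last exact: cmeasurable_cst.
  apply: cmeasurable_expi; apply: measurable_funM => //; exact: measurable_funB.
- by move=> t; rewrite normcM nrmc_expi mul1r nrmc_real ger0_norm// invr_ge0 sqrtr_ge0.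
- by rewrite exprVn sqr_sqrtr ?ltW// gtr0_norm// invr_gt0.
Qed.

Lemma atomB f g x w t :
  atom alpha f x w t - atom alpha g x w t = atom alpha (fun t => f t - g t) x w t.
Proof. by rewrite !atomE -mulrBr. Qed.

Lemma cintegrable_atom f x w : cintegrable mu f -> cintegrable mu (atom alpha f x w).
Proof.
move=> fi; have b0 := beta_gt0 alpha w.
have bn0 : (beta alpha w)^-1 != 0 by rewrite invr_eq0 gt_eqF.
have fai := cintegrable_affine (- (x / beta alpha w)) bn0 fi.
rewrite (funext (atomE f x w)).
apply: (le_cintegrable _ (cintegrableZ ((Num.sqrt (beta alpha w))^-1)%:C fai)).
  apply: cmeasurableM; last exact: cintegrable_measurable fai.
  apply: cmeasurableM; last exact: cmeasurable_cst.
  apply: cmeasurable_expi; apply: measurable_funM => //; exact: measurable_funB.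
by move=> t; rewrite !normcM nrmc_expi mul1r.
Qed.

Definition window w h xi : R[i] :=
  (Num.sqrt (beta alpha w))%:C * h (beta alpha w * (xi - w)).

(** The transform of an atom, according to [FT_atom]. *)
Definition spectrum x w h xi : R[i] := expi (- (2 * pi * x * xi)) * window w h xi.

Lemma spectrum_nrm2 x w h : L2 h ->
  L2 (spectrum x w h) /\ nrm2 (spectrum x w h) <= nrm2 h.
Proof.
move=> Lh; have b0 := beta_gt0 alpha w.
rewrite (_ : spectrum x w h = fun xi =>
   (expi (- (2 * pi * x * xi)) * (Num.sqrt (beta alpha w))%:C) *
   h (beta alpha w * xi + - (beta alpha w * w))); last first.
  by apply/funext => xi; rewrite /spectrum /window mulrA mulrBr.
apply: (@L2_modulated_affine _ _ (Num.sqrt (beta alpha w))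
  (fun xi => expi (- (2 * pi * x * xi)) * _)) => //.
- by rewrite gt_eqF.
- apply: cmeasurableM; last exact: cmeasurable_cst.
  apply: cmeasurable_expi; apply: measurableT_comp => //.
- by move=> t; rewrite normcM nrmc_expi mul1r nrmc_real ger0_norm// sqrtr_ge0.
- by rewrite sqr_sqrtr ?ltW// gtr0_norm.
Qed.

Lemma spectrumB x w g h xi :
  spectrum x w g xi - spectrum x w h xi = spectrum x w (fun t => g t - h t) xi.
Proof. by rewrite /spectrum /window !mulrBr. Qed.

Lemma L2_window w h : L2 h -> L2 (window w h).
Proof.
move=> Lh; have := (spectrum_nrm2 0 w Lh).1.
rewrite (_ : spectrum 0 w h = window w h)//; apply/funext => xi.
by rewrite /spectrum mulr0 mul0r oppr0 expi0 mul1r.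
Qed.

Lemma spectrum_ae x w g h : L2 g -> L2 h -> aeeq g h ->
  aeeq (spectrum x w g) (spectrum x w h).
Proof.
move=> Lg Lh gh; have Lgh := (L2B Lg Lh).1.
apply: aeeq_nrm2; [exact: (spectrum_nrm2 _ _ Lg).1|exact: (spectrum_nrm2 _ _ Lh).1|].
apply/eqP; rewrite eq_le nrm2_ge0 andbT.
rewrite -[X in _ <= X](nrm2_aeeq0 (L2_measurable Lg) (L2_measurable Lh) gh).
under [X in nrm2 X]eq_fun do rewrite spectrumB.
exact: (spectrum_nrm2 x w Lgh).2.
Qed.

(** [fourier_atom] gives the transform for the truncated windows, and both
    atoms and spectra depend continuously on the window. *)
Lemma FT_atom f x w : L2 f ->
  aeeq (FT (atom alpha f x w)) (spectrum x w (FT f)).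
Proof.
move=> Lf; have LFf := L2_FT Lf; have [_ _ Ff] := FTP Lf.
apply: (@FT_unique _ _ _ (fun n => atom alpha (trunc n f) x w)).
- exact: (atom_nrm2 x w Lf).1.
- exact: (spectrum_nrm2 x w LFf).1.
- move=> n; split; first by apply: cintegrable_atom; exact: cintegrable_trunc.
  exact: (atom_nrm2 x w (L2_trunc n Lf)).1.
- apply: L2cvg_le (trunc_cvg Lf) => n.
  under eq_fun do rewrite atomB.
  exact: (atom_nrm2 x w (L2B (L2_trunc n Lf) Lf).1).2.
- apply: L2cvg_le Ff => n.
  have Ln : L2 (fourier (trunc n f)) by apply: L2_fourier; exact: L12_trunc.
  rewrite (_ : (fun t => _) = spectrum x w (fun t => fourier (trunc n f) t - FT f t)).
    exact: (spectrum_nrm2 x w (L2B Ln LFf).1).2.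
  apply/funext => xi; rewrite -spectrumB fourier_atom ?/spectrum ?/window ?mulrA//.
  exact: cintegrable_trunc.
Qed.

End atoms.

(** * The operator of the atoms as a multiplier *)

Section weak_representation.
Context {R : realType}.
Variables (alpha : R) (psi h : R -> R[i]) (C M : R).
Hypotheses (psi_L2 : L2 psi) (h_L2 : L2 h) (psi_h : aeeq (FT psi) h).
Hypothesis h_bounded : forall y, normc (h y) <= C.
Hypothesis symbolE : forall xi,
  (\int[@lebesgue_measure R]_w (density alpha h (xi, w))%:E =
   (symbol alpha h xi)%:E)%E.
Hypothesis symbol_bounded : forall xi, symbol alpha h xi <= M.
Notation mu := (@lebesgue_measure R).
Implicit Types (f g F G : R -> R[i]) (w x xi : R).

(** The part of the spectrum [F] seen by the window at frequency [w]. By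
    [inner_atom], its inverse transform lists the coefficients of the function
    at all positions. *)
Definition localize F w xi : R[i] := F xi * conjc (window alpha w h xi).

Lemma symbol_ge0 xi : 0 <= symbol alpha h xi.
Proof.
rewrite -lee_fin -symbolE; apply: integral_ge0 => w _.
by rewrite lee_fin density_ge0.
Qed.

Lemma window_sqr w xi : normc (window alpha w h xi) ^+ 2 = density alpha h (xi, w).
Proof.
rewrite /window /density normcM nrmc_real exprMn ger0_norm ?sqrtr_ge0//.
by rewrite sqr_sqrtr// ltW// beta_gt0.
Qed.

Lemma L12_localize F w : L2 F -> L12 (localize F w).
Proof.
move=> LF; have Lw := L2_window alpha w h_L2; split.
  exact: inner_integrable.
rewrite (_ : localize F w = fun xi => conjc (window alpha w h xi) * F xi); last first.
  by apply/funext => xi; rewrite /localize mulrC.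
apply: (L2_bounded_mul (M := Num.sqrt (beta alpha w) * C) _ _ LF).1.
  exact: cmeasurableJ (L2_measurable Lw).
move=> xi; rewrite nrmcJ normcM nrmc_real ger0_norm ?sqrtr_ge0//.
by rewrite ler_wpM2l// sqrtr_ge0.
Qed.

(** Plancherel makes the coefficient an integral over frequencies, in which
    the position enters through a phase only. *)
Lemma inner_atom f x w : L2 f ->
  inner f (atom alpha psi x w) = ifourier (localize (FT f) w) x.
Proof.
move=> Lf; have La := (atom_nrm2 alpha x w psi_L2).1.
have LF := L2_FT Lf; have Ls := (spectrum_nrm2 alpha x w h_L2).1.
have ae : aeeq (FT (atom alpha psi x w)) (spectrum alpha x w h).
  apply: aeeq_trans (FT_atom alpha x w psi_L2) _.
  exact: spectrum_ae (L2_FT psi_L2) h_L2 psi_h.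
rewrite -(plancherel Lf La).
rewrite (inner_ae LF (L2_FT La) (L2_measurable LF) (L2_measurable Ls) _ ae);
  last exact: nearW.
rewrite ifourierE; apply: eq_cintegral => xi.
rewrite /spectrum /localize (conjcM (expi _)) conj_expi opprK.
rewrite mulrCA [RHS]mulrC (mulrAC _ x xi); congr (_ * _).
Qed.

Lemma localize_mulJ F G w xi :
  localize F w xi * conjc (localize G w xi) =
  (F xi * conjc (G xi)) * (density alpha h (xi, w))%:C.
Proof.
rewrite /localize (conjcM (G xi)) conjcK -window_sqr -mulzJ.
by rewrite mulrACA [conjc (window _ _ _ _) * _]mulrC.
Qed.

Lemma cmeasurable_localize F : cmeasurable F ->
  cmeasurable (fun p : R * R => localize F p.2 p.1).
Proof.
move=> mF; apply: cmeasurableM; first exact: (cmeasurable_comp mF).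
apply: cmeasurableJ; apply: cmeasurableM.
  apply: cmeasurable_real; apply: (measurableT_comp (continuous_measurable_fun _)).
    exact: sqrt_continuous.
  exact: measurableT_comp (measurable_beta alpha) measurable_snd.
apply: cmeasurable_comp; first exact: L2_measurable h_L2.
exact: measurable_dilated_frequency.
Qed.

(** Integrating in [w] first replaces the window by the bounded symbol. *)
Lemma cintegrable_localize F : L2 F -> cintegrable (mu \x mu)%E
  (fun p : R * R => localize F p.2 p.1 * conjc (localize F p.2 p.1)).
Proof.
move=> LF; have mF := cmeasurable_localize (L2_measurable LF).
have mn := measurable_nrmc_sqr (L2_measurable LF).
apply: cintegrable_prod12; first by apply: cmeasurableM => //; exact: cmeasurableJ.
have ms : measurable_fun setT (symbol alpha h).
  by apply: measurable_symbol; exact: L2_measurable.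
apply: (@le_lt_trans _ _ (\int[mu]_xi (M%:E * (normc (F xi) ^+ 2)%:E))%E).
  have E (xi : R) : (\int[mu]_w (normc (localize F w xi * conjc (localize F w xi)))%:E =
      (normc (F xi) ^+ 2 * symbol alpha h xi)%:E)%E.
    under eq_integral => w _.
      rewrite localize_mulJ mulzJ -rmorphM nrmc_real ger0_norm; last first.
        by rewrite mulr_ge0 ?sqr_ge0 ?density_ge0.
      rewrite EFinM; over.
    rewrite ge0_integralZl_EFin ?sqr_ge0//.
    - by rewrite symbolE EFinM.
    - by move=> w _; rewrite lee_fin density_ge0.
    - apply/measurable_EFinP; apply: measurable_density_section.
      exact: L2_measurable.
  under eq_integral => xi _ do rewrite E.
  apply: ge0_le_integral => //.
  - by move=> xi _; rewrite lee_fin mulr_ge0 ?sqr_ge0 ?symbol_ge0.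
  - by apply/measurable_EFinP; exact: measurable_funM.
  - apply: emeasurable_funM; first exact: measurable_cst.
    exact/measurable_EFinP.
  - by move=> xi _; rewrite -EFinM lee_fin mulrC ler_wpM2r ?sqr_ge0.
have M0 : 0 <= M by exact: le_trans (symbol_ge0 0) (symbol_bounded 0).
rewrite ge0_integralZl_EFin//.
- by rewrite nrm2E// -EFinM ltry.
- by move=> xi _; rewrite lee_fin sqr_ge0.
- exact/measurable_EFinP.
Qed.

Lemma cmeasurable_coefficient F : cmeasurable F ->
  cmeasurable (fun p : R * R => ifourier (localize F p.2) p.1).
Proof.
move=> mF.
rewrite (_ : (fun p => _) = fun p : R * R => cintegral mu (fun xi =>
    localize F p.2 xi * expi (2 * pi * xi * p.1))); last first.
  by apply/funext => p; rewrite ifourierE.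
apply: (@cmeasurable_cintegral_param _ _ _ _ _ (@lebesgue_measure R)
  (fun q : (R * R) * R => localize F q.1.2 q.2 * expi (2 * pi * q.2 * q.1.1))).
apply: cmeasurableM.
  apply: (cmeasurable_comp (h := fun q : (R * R) * R => (q.2, q.1.2))
    (cmeasurable_localize mF)).
  apply: measurable_fun_pair => //.
  exact: measurableT_comp measurable_snd measurable_fst.
apply: cmeasurable_expi; apply: measurable_funM.
  exact: measurable_funM.
exact: measurableT_comp measurable_fst measurable_fst.
Qed.

(** For fixed [w], Plancherel in the position variable replaces the
    coefficients by the localized spectrum, which [cintegrable_localize] deals
    with. *)
Lemma cintegrable_coefficient F : L2 F -> cintegrable (mu \x mu)%E
  (fun p : R * R => ifourier (localize F p.2) p.1 *
                    conjc (ifourier (localize F p.2) p.1)).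
Proof.
move=> LF; have mF := cmeasurable_coefficient (L2_measurable LF).
apply: cintegrable_prod21; first by apply: cmeasurableM => //; exact: cmeasurableJ.
have E (w : R) : (\int[mu]_x (normc (ifourier (localize F w) x *
      conjc (ifourier (localize F w) x)))%:E =
    \int[mu]_xi (normc (localize F w xi * conjc (localize F w xi)))%:E)%E.
  have Ll := L12_localize w LF.
  have Li : L2 (ifourier (localize F w)).
    by apply: L2J; apply: L2_fourier; exact: L12J.
  have sq f : L2 f ->
      (\int[mu]_t (normc (f t * conjc (f t)))%:E = (nrm2 f)%:E)%E.
    move=> Lf; rewrite -nrm2E//; apply: eq_integral => t _.
    by rewrite mulzJ nrmc_real ger0_norm ?sqr_ge0.
  rewrite !sq//; last exact: Ll.2.
  have := parseval_ifourier Ll Ll; rewrite !inner_nrm2.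
  by move=> /(congr1 (@complex.Re R)) /= ->.
under eq_integral => w _ do rewrite E.
exact: (integral21_cintegrable (cintegrable_localize LF)).
Qed.

(** For fixed [w], Plancherel in [x] turns the inner integral into the inner
    product of the localized spectra of [f] and [g]; exchanging the integrals
    in [w] and in the frequency then makes the symbol appear. *)
Lemma multiplier_represents :
  weakly_represents alpha psi (multiplier (symbol alpha h)).
Proof.
move=> f g Lf Lg; have LF := L2_FT Lf; have LG := L2_FT Lg.
have coef x w : inner f (atom alpha psi x w) * inner (atom alpha psi x w) g =
    ifourier (localize (FT f) w) x * conjc (ifourier (localize (FT g) w) x).
  by rewrite [inner (atom _ _ _ _) g]innerJ !inner_atom.
split.
  rewrite (_ : (fun p => _) = fun p : R * R => ifourier (localize (FT f) p.2) p.1 *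
      conjc (ifourier (localize (FT g) p.2) p.1)); last first.
    by apply/funext => p; rewrite coef.
  apply: cintegrable_mulJ; [apply: cmeasurable_coefficient; exact: L2_measurable..|
    exact: cintegrable_coefficient|exact: cintegrable_coefficient].
have ms : measurable_fun setT (symbol alpha h).
  by apply: measurable_symbol; exact: L2_measurable.
rewrite (inner_multiplier (K := M) ms)//; last first.
  by move=> xi; rewrite ger0_norm ?symbol_ge0.
transitivity (cintegral mu (fun w => inner (localize (FT f) w) (localize (FT g) w))).
  have ci : cintegrable (mu \x mu)%E (fun p : R * R =>
      localize (FT f) p.2 p.1 * conjc (localize (FT g) p.2 p.1)).
    apply: cintegrable_mulJ; [apply: cmeasurable_localize; exact: L2_measurable..|
      exact: cintegrable_localize|exact: cintegrable_localize].
  rewrite /inner -(cfubini ci); apply: eq_cintegral => xi.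
  transitivity (cintegral mu (fun w =>
      (FT f xi * conjc (FT g xi)) * (density alpha h (xi, w))%:C)); last first.
    by apply: eq_cintegral => w; rewrite -localize_mulJ.
  rewrite (@cintegralZ _ _ _ mu _ (fun w => (density alpha h (xi, w))%:C)); last first.
    split => /=; last exact: integrable0.
    apply/integrableP; split.
      apply/measurable_EFinP; apply: measurable_density_section.
      exact: L2_measurable.
    under eq_integral => w _ do rewrite abse_EFin ger0_norm ?density_ge0//.
    by rewrite symbolE ltry.
  by rewrite cintegral_real -mulrA [LHS]mulrC.
apply: eq_cintegral => w.
rewrite -parseval_ifourier; [|exact: L12_localize..].
by apply: eq_cintegral => x; rewrite coef.
Qed.

End weak_representation.

(** * Admissibility *)

(** By Plancherel a transform that vanishes identically belongs to a function
    that vanishes almost everywhere. *)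
Lemma L2_fourier_neq0 (R : realType) (f g : R -> R[i]) :
  is_L2_fourier f g -> ~ aeeq f (fun _ => 0) -> exists c, g c != 0.
Proof.
move=> fg; have [Lf Lg _] := fg; have FTg := is_L2_fourier_FT fg.
apply: contra_notP => g0; apply: nrm2_eq0 => //.
rewrite -nrm2_FT// (_ : nrm2 _ = nrm2 (fun _ : R => 0 : R[i])).
  rewrite /nrm2 /Rintegral; under eq_integral do rewrite normc0 expr0n.
  by rewrite integral0.
have g00 : g = (fun _ => 0).
  apply/funext => c; apply/eqP; apply: contrapT => gc; apply: g0.
  by exists c; exact/negP.
rewrite -g00; apply: (congr1 (@complex.Re R) (x := (nrm2 _)%:C) (y := (nrm2 _)%:C)).
rewrite -!inner_nrm2; apply: inner_ae => //; try exact: L2_FT; exact: L2_measurable.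
Qed.

Unset Implicit Arguments.

Theorem theorem3p1 (R : realType) (alpha : R)
  (alpha_ge0 : 0 <= alpha) (alpha_lt1 : alpha < 1)
  (psi psihat : R -> R[i])
  (psi_L2 : L2 psi) (psi_neq0 : ~ aeeq psi (fun _ => 0))
  (psihatE : is_L2_fourier psi psihat)
  (psihat_cont : continuous (psihat : R -> (R[i] : numFieldType)))
  (C r : R) (C_gt0 : 0 < C)
  (psihat_decay : forall xi : R, normc (psihat xi) <= C * (1 + `|xi|) `^ (- r))
  (r_gt : Num.max 1 (alpha / (2 * (1 - alpha))) < r) :
  admissible alpha psi.
Proof.
have [_ h_L2 _] := psihatE; have mh := L2_measurable h_L2.
have r1 : 1 <= r by move: r_gt; rewrite gt_max => /andP[/ltW].
have C0 := ltW C_gt0.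
have sE := integral_densityE alpha_ge0 alpha_lt1 mh C0 r1 psihat_decay.
have sM := symbol_le alpha_ge0 alpha_lt1 mh C0 r1 psihat_decay.
have hC y : normc (psihat y) <= C.
  apply: le_trans (decay_inv C0 r1 psihat_decay y) _.
  by rewrite ler_pdivrMr ?base_gt0// ler_peMr// base_ge1.
have ms : measurable_fun setT (symbol alpha psihat) by exact: measurable_symbol.
have [c hc] := L2_fourier_neq0 psihatE psi_neq0.
have nc0 : 0 < normc (psihat c).
  by rewrite lt_def nrmc_ge0 andbT; apply: contra hc => /eqP/eq0_normc ->.
have [rho rho0 hrho] : exists2 rho : R, 0 < rho &
    forall y, `|y - c| <= rho -> (normc (psihat c) / 2) ^+ 2 <= normc (psihat y) ^+ 2.
  have nc2 : 0 < normc (psihat c) / 2 by rewrite divr_gt0.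
  have := @continuous_nrmc R psihat psihat_cont c.
  move=> /cvgrPdist_lt/(_ _ nc2)/nbhs_ballP[e /= e0 he].
  exists (e / 2); first by rewrite divr_gt0.
  move=> y yc; have : `|normc (psihat c) - normc (psihat y)| < normc (psihat c) / 2.
    apply: he; rewrite /ball /= distrC; apply: le_lt_trans yc _.
    by rewrite ltr_pdivrMr// ltr_pMr// ltr1n.
  rewrite ltr_norml => /andP[_ hy].
  rewrite lerXn2r ?nnegrE ?nrmc_ge0 ?(ltW nc2)//; lra.
have eps0 : 0 < (normc (psihat c) / 2) ^+ 2 by rewrite exprn_gt0// divr_gt0.
have [m m0 hm] := symbol_lower_bound alpha_ge0 alpha_lt1 mh rho0 eps0 hrho.
have sm xi : m <= symbol alpha psihat xi by rewrite -lee_fin -sE.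
exists (multiplier (symbol alpha psihat)); split.
- exact: multiplier_represents psi_L2 h_L2 (is_L2_fourier_FT psihatE) hC sE sM.
- apply: bounded_multiplier ms _ => xi; rewrite ger0_norm; first exact: sM.
  exact: le_trans (ltW m0) (sm xi).
- apply: (invertible_multiplier ms m0) => xi.
  by rewrite sm; exact: sM.
Qed.
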